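(* Assume the setup below, with the sequence $(d_n)$ satisfying $0<d_n\le 1$ for all $n$ and $d_n\ge C|n|^{-\zeta}$ for all $n\neq 0$, for some constants $C>0$ and $\zeta<\tfrac12$. Then for $\mu$-almost every $\omega\in\Omega$, the operator $J_\omega$ has purely pure point spectrum.
   Context: Setup: $r:\mathbb R\to[0,\infty)$ is bounded, measurable, compactly supported, with $\int_{\mathbb R} r(x)\,dx=1$. $(d_n)_{n\in\mathbb Z}$ is a fixed sequence of positive reals and $r_n(x)=d_n^{-1}r(d_n^{-1}x)$. $c\in\ell^\infty(\mathbb Z)$ is a real sequence (background potential). $a\in\ell^\infty(\mathbb Z)$ is real with $a(n)\ge\delta>0$ for all $n$. $\Omega=\mathbb R^{\mathbb Z}$ and $\mu$ is the product probability measure $d\mu(\omega)=\prod_{n\in\mathbb Z} r_n(\omega(n)-c(n))\,d\omega(n)$, i.e. the coordinates $\omega(n)$ are independent and $\omega(n)-c(n)$ has density $r_n$. For $\omega\in\Omega$, $J_\omega$ is the operator on $\ell^2(\mathbb Z)$ given by $(J_\omega\phi)(n)=a(n)\phi(n+1)+a(n-1)\phi(n-1)+\omega(n)\phi(n)$. *)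

(* Defs.v *)
From HB Require Import structures.
From mathcomp Require Import all_boot all_order all_algebra.
From mathcomp Require Import all_classical all_reals all_analysis.
Set Implicit Arguments. Unset Strict Implicit. Unset Printing Implicit Defensive.
Import Order.TTheory GRing.Theory Num.Theory.
Import numFieldNormedType.Exports.
Local Open Scope classical_set_scope.
Local Open Scope ring_scope.

Definition in_l2 (R : realType) (phi : int -> R) : Prop :=
  (\esum_(n in [set: int]) ((phi n) ^+ 2)%:E < +oo)%E.

Definition l2norm2 (R : realType) (phi : int -> R) : \bar R :=
  (\esum_(n in [set: int]) ((phi n) ^+ 2)%:E)%E.

Definition Jop (R : realType) (a omega : int -> R) (phi : int -> R) : int -> R :=
  fun n => a n * phi (n + 1) + a (n - 1) * phi (n - 1) + omega n * phi n.

Definition is_eigenvector (R : realType) (a omega : int -> R) (phi : int -> R) : Prop :=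
  in_l2 phi /\ phi <> (fun _ => 0) /\
  exists E : R, forall n, Jop a omega phi n = E * phi n.

(* J_omega has pure point spectrum: the eigenvectors span a dense subspace of
   l^2(Z), i.e. every psi in l^2 is an l^2-limit of finite linear combinations
   of eigenvectors. *)
Definition pure_point (R : realType) (a omega : int -> R) : Prop :=
  forall psi : int -> R, in_l2 psi ->
  forall eps : R, 0 < eps ->
  exists s : seq (R * (int -> R)),
    (forall p, p \in s -> is_eigenvector a omega p.2) /\
    (l2norm2 (fun n => (psi n - \sum_(p <- s) p.1 * p.2 n)%R) < eps%:E)%E.

Definition mutually_independent (d : measure_display) (T : measurableType d)
  (R : realType) (P : probability T R) (X : int -> T -> R) : Prop :=
  forall (S : seq int) (B : int -> set R), uniq S ->
    (forall n, measurable (B n)) ->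
    fine (P (\bigcap_(n in [set` S]) (X n @^-1` B n))) =
    \prod_(n <- S) fine (P (X n @^-1` B n)).

Definition rescaled (R : realType) (r : R -> R) (dn : R) : R -> R :=
  fun x => dn^-1 * r (dn^-1 * x).

(* Main.v *)
Require Import Defs.
From HB Require Import structures.
From mathcomp Require Import all_boot all_order all_algebra.
From mathcomp Require Import all_classical all_reals all_analysis.
From mathcomp Require Import measurable_realfun spectral.
From mathcomp Require Import ring lra zify complex.
Set Implicit Arguments. Unset Strict Implicit. Unset Printing Implicit Defensive.
Import Order.TTheory GRing.Theory Num.Theory.
Import numFieldNormedType.Exports.
Local Open Scope classical_set_scope.
Local Open Scope ring_scope.

(* A Kunz-Souillard argument.  On the box [-L, L], the ratio |u_m / u_0| of the
   solution of the difference equation vanishing at L + 1 is a product of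
   Riccati variables.  Its expectation, localised by a small window in omega(0)
   to energies that are eigenvalues of the box, is a product of m operators on
   L^2(R), each an inversion isometry followed by averaging over the law of one
   site.  If these laws have densities at most M, two consecutive operators
   shrink the norm by a factor 1 - c / M^2; with M growing like m^zeta,
   zeta < 1/2, the expectation decays like exp(- c m^(1 - 2 zeta)).  Hence the
   expectation of sum_k |phi_k(0)| sum_m |m| |phi_k(m)|, over the orthonormal
   eigenbasis phi_k of the box, is bounded uniformly in L.  By Fatou's lemma,
   almost surely this sum stays bounded along infinitely many boxes.  Then the
   eigenvectors carrying delta_0, up to a small error, have half of their mass
   in a fixed window [-N, N]; there are at most 2 (2N + 1) of them, so they have
   limits as L grows, which are l^2-eigenvectors of J_omega spanning delta_0 up
   to that error.  Translating, every delta_n is approximated. *)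

(** * Changes of variables for Lebesgue integrals *)

(** The first power of [|u_m / u_0|] is the moment that fits L^2: each of its factors is the square
    root of the Jacobian of one inversion, so norm is lost only in the averaging. Averaging over a
    law of density at most M shrinks the norm unless the function barely changes under differences
    of two draws of that law. It then changes little under n times such differences either, with n
    of order M, and is too spread out to have much mass in a fixed interval. Passing to n-fold
    translations costs n^2: this is the origin of the loss 1 / M^2 and of the threshold 1/2. Ratios
    become [|phi_k(0)| |phi_k(m)|] through an integral over the energy: the window of width e sees
    the k-th eigenvalue on a set of length of order e phi_k(0)^2, has height 1 / (2 e), and the
    ratio there is close to [|phi_k(m) / phi_k(0)|]. The eigenvectors of a box are merely chosen for
    each omega, with no measurability in omega. Expectations are therefore taken only of explicit
    functions of the energy and omega; the sum over eigenvectors is bounded, for each omega, by a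
    liminf of their energy integrals as e tends to 0. *)

Lemma measurable_funV (R : realType) d (T : measurableType d) (f : T -> R) :
  measurable_fun [set: T] f -> measurable_fun [set: T] (fun x => (f x)^-1).
Proof.
move=> mf; apply: (@measurableT_comp _ _ _ _ _ _ (@GRing.inv R)) => //.
rewrite (_ : GRing.inv = (fun x : R => if x == 0 then 0 else x^-1)); last first.
  by apply/funext => x; case: eqP => [->|//]; rewrite invr0.
apply: measurable_fun_if => //.
  exact: measurable_fun_eqr.
rewrite setTI; apply: open_continuous_measurable_fun.
  rewrite (_ : _ @^-1` _ = [set x | x != 0]); first exact: open_neq.
  by apply/seteqP; split => x /=; case: eqP.
by move=> x /[!inE]/= /negbT x0; exact: inv_continuous.
Qed.

Section affine.
Context {R : realType}.
Notation mu := (@lebesgue_measure R).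
Local Open Scope ereal_scope.

(** Scaled by [|al|], the pushforward of Lebesgue measure gives every []a, b]] its length, and this
    characterises Lebesgue measure. For [al < 0] the preimage is closed on the left instead, hence
    two cases. *)
Lemma ge0_integral_affine (al be : R) (f : R -> \bar R) : (al != 0)%R ->
  measurable_fun [set: R] f -> (forall x, 0 <= f x) ->
  \int[mu]_x f (al * x + be)%R = (`|al|^-1)%:E * \int[mu]_x f x.
Proof.
move=> al0 mf f0.
pose phi : R -> R := fun x => (al * x + be)%R.
have mphi : measurable_fun [set: R] phi.
  by apply: measurable_funD => //; apply: measurable_funM.
have nal : (0 < `|al|)%R by rewrite normr_gt0.
pose k : {nonneg R} := NngNum (ltW nal).
pose m' : {measure set (measurableTypeR R) -> \bar R} := mscale k (pushforward mu (phi : _ -> measurableTypeR R)).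
have H : forall A, measurable A -> mu A = m' mphi A.
  apply: lebesgue_measure_unique => _ [[a b] _ <-] /=.
  rewrite /m' /mscale/= /pushforward.
  have [ap|an] := ltP 0%R al.
    rewrite (_ : phi @^-1` _ = `]((a - be) / al)%R, ((b - be)/al)%R]%classic); last first.
      apply/seteqP; split => x /=; rewrite !in_itv/= /phi ltr_pdivrMr// ler_pdivlMr//;
      rewrite (mulrC x) => /andP[h1 h2]; apply/andP; split; lra.
    rewrite !lebesgue_measure_itv/= !lte_fin gtr0_norm//.
    rewrite ltr_pM2r ?invr_gt0// ltrD2r.
    case: ifPn => ab; last by rewrite mule0.
    by rewrite -!EFinD -EFinM; congr EFin; field.
  have {an}an : (al < 0)%R by rewrite lt_neqAle al0.
  rewrite (_ : phi @^-1` _ = `[((b - be) / al)%R, ((a - be)/al)%R[%classic); last first.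
    apply/seteqP; split => x /=; rewrite !in_itv/= /phi ler_ndivrMr// ltr_ndivlMr//;
    rewrite (mulrC x) => /andP[h1 h2]; apply/andP; split; lra.
  rewrite !lebesgue_measure_itv/= !lte_fin ltr0_norm//.
  rewrite ltr_nM2r ?invr_lt0// ltrD2r.
  case: ifPn => ab; last by rewrite mule0.
  by rewrite -!EFinD -EFinM; congr EFin; field.
transitivity (\int[pushforward mu (phi : _ -> measurableTypeR R)]_x f x).
  by rewrite ge0_integral_pushforward.
rewrite [in RHS](eq_measure_integral (m' mphi)); last by move=> A mA _; exact: H.
rewrite ge0_integral_mscale//= muleA -EFinM mulVf ?mul1e//.
by rewrite normr_eq0.
Qed.

End affine.

Section inversion.
Context {R : realType}.
Notation mu := (@lebesgue_measure R).
Local Open Scope ereal_scope.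

(** The measure of density [w] is realised as planar measure on the region [S] under the graph of
    [w]. Its image under [phi] of the first coordinate agrees with Lebesgue measure on half-open
    intervals, hence everywhere. *)
Lemma ge0_integral_weighted (w phi : R -> R) (F : R -> \bar R) :
  measurable_fun [set: R] w -> (forall x, (0 <= w x)%R) ->
  measurable_fun [set: R] phi ->
  (forall a b, (a < b)%R ->
    \int[mu]_y (w y * \1_(`]a, b]%classic) (phi y))%:E = (b - a)%:E) ->
  measurable_fun [set: R] F -> (forall x, 0 <= F x) ->
  \int[mu]_y ((w y)%:E * F (phi y)) = \int[mu]_x F x.
Proof.
move=> mw w0 mphi H mF F0.
pose S := [set z : R * R | (0 <= z.2)%R && (z.2 <= w z.1)%R].
have mS : measurable S.
  have -> : S = (fun z : R * R => (0 <= z.2)%R && (z.2 <= w z.1)%R) @^-1` [set true].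
    by [].
  rewrite -[X in measurable X]setTI.
  apply: measurable_and => //.
    by apply: measurable_fun_ler => //.
  by apply: measurable_fun_ler => //; exact: measurableT_comp.
pose psi (z : R * R) := phi z.1.
have mpsi : measurable_fun [set: R * R] psi by exact: measurableT_comp.
pose m2 : {measure set (measurableTypeR R) -> \bar R} :=
  pushforward (mrestr (mu \x mu) mS) (psi : _ -> measurableTypeR R).
have key (G : R -> \bar R) : measurable_fun [set: R] G -> (forall x, 0 <= G x) ->
    \int[m2 mpsi]_x G x = \int[mu]_y ((w y)%:E * G (phi y)).
  move=> mG G0; rewrite /m2 ge0_integral_pushforward// preimage_setT.
  have mGp : measurable_fun [set: R * R] (G \o psi) by exact: measurableT_comp.
  transitivity (\int[mrestr (mu \x mu) mS]_(x in setT `\` ~` S) (G \o psi) x).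
    apply: ge0_negligible_integral => //; first exact: measurableC.
    by move=> x _; exact: G0.
    change ((mu \x mu) (~` S `&` S) = 0); by rewrite setICl measure0.
  rewrite setTD setCK (eq_measure_integral (mu \x mu)); last first.
    by move=> A mA AS; rewrite /= /mrestr setIidl.
  rewrite integral_mkcond fubini_tonelli1//; last 2 first.
    by apply/(measurable_restrictT _ mS); exact: measurable_funTS.
    by move=> x; rewrite patchE; case: ifP => // _; exact: G0.
  apply: eq_integral => y _; rewrite /fubini_F.
  transitivity (\int[mu]_(h in `[0%R, w y]) G (phi y)).
    rewrite [RHS]integral_mkcond; apply: eq_integral => h _.
    rewrite !patchE.
    have -> : ((y, h) \in S) = (h \in `[0%R, w y]%classic); last by [].
    by apply/idP/idP => /set_mem h0; apply/mem_set; move: h0; rewrite /S /= in_itv/=.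
  rewrite integral_cst//= lebesgue_measure_itv/= lte_fin; case: ifPn => wy.
    by rewrite oppr0 addr0 muleC.
  have -> : w y = 0%R by apply/eqP; rewrite eq_le w0 leNgt wy.
  by rewrite mul0e mule0.
have E : forall A, measurable A -> mu A = m2 mpsi A.
  apply: lebesgue_measure_unique => _ [[a b] _ <-] /=.
  have [ab|ab] := ltP a b; last first.
    by rewrite set_itv_ge ?measure0// bnd_simp -leNgt.
  rewrite lebesgue_measure_itv/= lte_fin ab -EFinB.
  rewrite -H//; under eq_integral do rewrite EFinM.
  rewrite -(key (fun x => (\1_(`]a, b]%classic) x)%:E))//.
    by rewrite integral_indic// setIT.
  exact/measurable_EFinP/measurable_indic.
rewrite -key//; apply: eq_measure_integral => A mA _; exact/esym/E.
Qed.

Lemma integral_inv_sqr (a s : R) : (0 < a)%R -> (0 < s)%R ->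
  \int[mu]_(y in `[(a ^+ 2 / s)%R, +oo[) ((a / y) ^+ 2)%:E = s%:E.
Proof.
move=> a0 s0.
have p0 : (0 < a ^+ 2 / s)%R by rewrite divr_gt0// exprn_gt0.
rewrite (@ge0_continuous_FTC2y _ _ (fun y => - (a ^+ 2 * y^-1))%R _ 0%R).
- by rewrite -EFinB; congr EFin; rewrite sub0r opprK invf_div mulrCA divff ?mulr1// gt_eqF// exprn_gt0.
- by move=> x _; exact: sqr_ge0.
- apply: continuous_in_subspaceT => x /[!inE]/=; rewrite in_itv/= andbT => xa.
  have x0 : x != 0%R by rewrite gt_eqF// (lt_le_trans p0).
  have c1 : {for x, continuous (fun y : R => a / y)%R}.
    by apply: continuousM; [exact: cst_continuous|exact: inv_continuous].
  exact: (continuousM c1 c1).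
- rewrite -oppr0; apply: cvgN; rewrite -(mulr0 (a ^+ 2)%R); apply: cvgM; first exact: cvg_cst.
  apply/(@gtr0_cvgV0 R R +oo%R _ (fun y : R => y)); last exact: cvg_id.
  exact: nbhs_pinfty_gt.
- move=> x ax.
  have x0 : x != 0%R by rewrite gt_eqF// (lt_trans p0).
  apply: derivableN; apply: derivableM => //; exact: derivableV.
- apply: cvg_at_right_filter.
  have x0 : (a^+2/s)%R != 0%R by rewrite gt_eqF.
  apply: cvgN; apply: cvgM; [exact: cvg_cst|exact: inv_continuous].
- move=> x; rewrite in_itv/= andbT => ax.
  have x0 : x != 0%R by rewrite gt_eqF// (lt_trans p0).
  rewrite derive1E.
  have -> : (fun y : R => - (a ^+ 2 * y^-1))%R = (- (cst (a ^+ 2) * (fun y : R => y^-1)))%R by [].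
  rewrite deriveN ?deriveM//; last by apply: derivableM => //; exact: derivableV.
  rewrite derive_cst deriveV// derive_id.
  rewrite scaler0 addr0 /= /GRing.scale/= mulr1 exprMn exprVn; ring.
  exact: derivableV.
Qed.

(** The weight is the Jacobian of the inversion. By [ge0_integral_weighted] half-open intervals
    suffice; those with an endpoint at 0 pull back to half-lines, and the others follow by cutting
    or subtracting at 0. *)
Lemma ge0_integral_inversion (a : R) (F : R -> \bar R) : (0 < a)%R ->
  measurable_fun [set: R] F -> (forall x, 0 <= F x) ->
  \int[mu]_y (((a / y) ^+ 2)%:E * F (a ^+ 2 / y)%R) = \int[mu]_x F x.
Proof.
move=> a0 mF F0.
have a20 : (0 < a ^+ 2)%R by rewrite exprn_gt0.
have mdiv (b : R) : measurable_fun [set: R] (fun y : R => b / y)%R.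
  by apply: measurable_funM => //; exact: measurable_funV.
have mw : measurable_fun [set: R] (fun y : R => (a / y) ^+ 2)%R.
  exact: measurable_funX.
apply: (@ge0_integral_weighted (fun y => (a / y) ^+ 2)%R (fun y => a ^+ 2 / y)%R) => //.
  by move=> x; exact: sqr_ge0.
have mI (A : set R) : measurable A ->
    measurable_fun [set: R] (fun y => ((a / y) ^+ 2 * \1_A (a ^+ 2 / y))%:E).
  move=> mA; apply/measurable_EFinP/measurable_funM => //.
  exact: (measurableT_comp (measurable_indic mA) (mdiv _)).
pose J (A : set R) := \int[mu]_y (((a / y) ^+ 2) * \1_A (a ^+ 2 / y))%:E.
have JD (A B : set R) : measurable A -> measurable B -> A `&` B = set0 ->
    J (A `|` B) = J A + J B.
  move=> mA mB AB0; rewrite /J -ge0_integralD//.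
  - apply: eq_integral => y _; rewrite /= -EFinD -mulrDr !indicE in_setU.
    have [yA|yA] := boolP (_ \in A); have [yB|yB] := boolP (_ \in B); rewrite ?addr0 ?add0r//.
    by have : (A `&` B) (a ^+ 2 / y)%R; [split; exact: set_mem|rewrite AB0].
  - by move=> y _; rewrite lee_fin mulr_ge0 ?sqr_ge0.
  - exact: mI.
  - by move=> y _; rewrite lee_fin mulr_ge0 ?sqr_ge0.
  - exact: mI.
have Jp s : (0 < s)%R -> J `]0%R, s]%classic = s%:E.
  move=> s0; rewrite -(integral_inv_sqr a0 s0) [RHS]integral_mkcond.
  apply: eq_integral => y _; rewrite patchE indicE.
  have -> : ((a ^+ 2 / y)%R \in `]0%R, s]%classic) = (y \in `[(a ^+ 2 / s)%R, +oo[%classic).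
    apply/idP/idP => /set_mem /=; rewrite in_itv/= => /andP[h1 h2]; apply/mem_set => /=; rewrite in_itv/=.
      have y0 : (0 < y)%R by rewrite pmulr_rgt0 ?invr_gt0 in h1.
      by rewrite andbT ler_pdivrMr// mulrC -ler_pdivrMr.
    have y0 : (0 < y)%R by apply: lt_le_trans h1; rewrite divr_gt0.
    by rewrite divr_gt0//= ler_pdivrMr// mulrC -ler_pdivrMr.
  by case: ifP; rewrite ?mulr1 ?mulr0.
have Jn s : (0 < s)%R -> J `](- s)%R, 0%R]%classic = s%:E.
  move=> s0; rewrite -(integral_inv_sqr a0 s0) -integral_itv_obnd_cbnd; last first.
    by apply: measurable_funTS; exact/measurable_EFinP.
  have -> : J `](- s)%R, 0%R]%classic =
     \int[mu]_y (((a / (-1 * y + 0)) ^+ 2) * \1_(`](- s)%R, 0%R]%classic) (a ^+ 2 / (-1 * y + 0)))%:E.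
    rewrite (@ge0_integral_affine _ _ _ (fun y => (((a / y) ^+ 2) * \1_(`](- s)%R, 0%R]%classic) (a ^+ 2 / y))%:E))//.
    + by rewrite normrN normr1 invr1 mul1e.
    + exact: mI.
    + by move=> y; rewrite lee_fin mulr_ge0 ?sqr_ge0.
  rewrite [RHS]integral_mkcond.
  apply: eq_integral => y _; rewrite patchE indicE addr0 mulN1r invrN !mulrN sqrrN.
  (* The point 0 is sent to 0, which lies in the interval, but its weight [a / 0] is 0. *)
  have [->|y0] := eqVneq y 0%R.
    by rewrite invr0 mulr0 expr0n/= mul0r; case: ifP => //.
  have -> : ((- (a ^+ 2 / y))%R \in `](- s)%R, 0%R]%classic) = (y \in `](a ^+ 2 / s)%R, +oo[%classic).
    apply/idP/idP => /set_mem /=; rewrite in_itv/= => /andP[h1 h2]; apply/mem_set => /=; rewrite in_itv/=.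
      have yp : (0 < y)%R.
        by rewrite lt_neqAle eq_sym y0/= -invr_ge0 -(pmulr_rge0 _ a20) -oppr_le0.
      by move: h1; rewrite ltrN2 andbT !ltr_pdivrMr// mulrC.
    have yp : (0 < y)%R by apply: lt_trans h1; rewrite divr_gt0.
    rewrite ltrN2 oppr_le0 divr_ge0 ?ltW//= andbT.
    by move: h1; rewrite !ltr_pdivrMr// mulrC.
  by case: ifP; rewrite ?mulr1 ?mulr0.
have split (x y z : R) : (x <= y)%R -> (y <= z)%R ->
    J `]x, z]%classic = J `]x, y]%classic + J `]y, z]%classic.
  move=> xy yz; rewrite -JD//.
    by congr J; rewrite -itv_bndbnd_setU// bnd_simp.
  apply/seteqP; split => t //=; rewrite !in_itv/= => -[/andP[_ h1] /andP[h2 _]].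
  by have := lt_le_trans h2 h1; rewrite ltxx.
have add_cancel (x y z : R) (e : \bar R) : (x%:E + e = y%:E -> z = y - x)%R -> x%:E + e = y%:E -> e = z%:E.
  case: e => [e| |]//= h E; have := h E => ->; move: E; rewrite -EFinD => -[<-]; congr EFin; ring.
move=> p q pq; change (J `]p, q]%classic = (q - p)%:E).
have [p0|p0|p0] := ltgtP p 0%R; last by rewrite p0 subr0 Jp// -p0.
- have Jp0 : J `]p, 0%R]%classic = (- p)%:E by rewrite -{1}(opprK p) Jn// oppr_gt0.
  have [q0|q0|q0] := ltgtP q 0%R; last by rewrite q0 sub0r.
    have := split p q 0%R (ltW pq) (ltW q0); rewrite Jp0 -{2}(opprK q) Jn ?oppr_gt0// addeC => /esym.
    apply: add_cancel => _; ring.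
  rewrite (split p 0%R q) ?ltW// Jp0 Jp// -EFinD; congr EFin; ring.
- have := split 0%R p q (ltW p0) (ltW pq); rewrite !Jp// ?(lt_trans p0)// => /esym.
  exact: add_cancel.
Qed.

End inversion.

(** * Averaging and transfer operators on L^2 *)

Lemma sqr_sum_le (R : realFieldType) (f : nat -> R) n :
  (\sum_(i < n) f i) ^+ 2 <= n%:R * \sum_(i < n) f i ^+ 2.
Proof.
elim: n => [|n IH]; first by rewrite !big_ord0 expr0n mulr0.
rewrite !big_ord_recr/=; set S := \sum_(i < n) f i in IH *.
set Q := \sum_(i < n) _ in IH *; set x := f n.
have Q0 : 0 <= Q by apply: sumr_ge0 => i _; exact: sqr_ge0.
have [n0|n0] := eqVneq n 0%N.
  have S0 : S = 0 by apply/eqP; rewrite -sqrf_eq0 eq_le sqr_ge0 andbT (le_trans IH) ?n0 ?mul0r.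
  rewrite S0 n0 add0r mul1r; lra.
have n0' : 0 < n%:R :> R by rewrite ltr0n lt0n.
rewrite -natr1 -subr_ge0 -(pmulr_rge0 _ n0').
have := sqr_ge0 (S - n%:R * x).
set N : R := n%:R in IH n0' *.
have H2 : 0 <= (N + 1) * (N * Q - S ^+ 2) by apply: mulr_ge0; lra.
rewrite sqrrB => H1.
have -> : N * ((N + 1) * (Q + x ^+ 2) - (S + x) ^+ 2)
   = (N + 1) * (N * Q - S ^+ 2) + (S ^+ 2 - S * (N * x) *+ 2 + (N * x) ^+ 2) by ring.
by rewrite addr_ge0.
Qed.

Section averaging.
Context {R : realType}.
Notation mu := (@lebesgue_measure R).
Local Open Scope ereal_scope.

Definition sqn (g : R -> R) : \bar R := \int[mu]_x ((g x) ^+ 2)%:E.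

(** One step of the Riccati recursion with the site value [w] averaged out; [x] is the contribution
    [a ^+ 2 / y] of the next site. It is the convolution with [nu] followed by the reflection
    [x |-> E - x]. *)
Definition avg (nu : probability (measurableTypeR R) R) (E : R) (g : R -> R) (x : R) : R :=
  fine (\int[nu]_w (g (E - w - x)%R)%:E).

Lemma sqn_ge0 g : 0 <= sqn g.
Proof. by apply: integral_ge0 => x _; rewrite lee_fin sqr_ge0. Qed.

Variables (nu : probability (measurableTypeR R) R) (M : R).
Hypothesis M0 : (0 <= M)%R.
Hypothesis dom : forall B : set R, measurable B -> nu B <= M%:E * mu B.

Lemma dom_integral (f : R -> \bar R) : measurable_fun [set: R] f ->
  (forall x, 0 <= f x) -> \int[nu]_x f x <= M%:E * \int[mu]_x f x.
Proof.
move=> mf f0.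
pose k : {nonneg R} := NngNum M0.
rewrite -[M]/(k%:num) -ge0_integral_mscale//.
by apply: (@ge0_le_measure_integral _ _ _ nu (mscale k mu)) => //= S mS; exact: dom.
Qed.

Section fixed.
Variable g : R -> R.
Hypothesis mg : measurable_fun [set: R] g.
Hypothesis g0 : forall x, (0 <= g x)%R.

Let mg2 : measurable_fun [set: R] (fun x => ((g x) ^+ 2)%:E).
Proof. exact/measurable_EFinP/measurable_funX. Qed.

Lemma dom_sqr (al be : R) : (al != 0)%R ->
  \int[nu]_w ((g (al * w + be)) ^+ 2)%:E <= (M / `|al|)%:E * sqn g.
Proof.
move=> al0; apply: le_trans.
  apply: dom_integral; last by move=> x; rewrite lee_fin sqr_ge0.
  apply/measurable_EFinP/measurable_funX; apply: measurableT_comp => //.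
  by apply: measurable_funD => //; exact: measurable_funM.
rewrite (@ge0_integral_affine _ _ _ (fun x => ((g x) ^+ 2)%:E))//.
  by rewrite muleA -EFinM.
by move=> x; rewrite lee_fin sqr_ge0.
Qed.

Let aff (E x : R) : (fun w : R => E - w - x)%R = (fun w => -1 * w + (E - x))%R.
Proof. by apply/funext => w; ring. Qed.

Let maff (E x : R) : measurable_fun [set: R] (fun w : R => E - w - x)%R.
Proof. by rewrite aff; apply: measurable_funD => //; exact: measurable_funM. Qed.

Let mgE (E x : R) : measurable_fun [set: R] (fun w => g (E - w - x)%R).
Proof. exact: (measurableT_comp mg (maff E x)). Qed.

Lemma dom_sqr1 E x : \int[nu]_w ((g (E - w - x)%R) ^+ 2)%:E <= M%:E * sqn g.
Proof.
have := @dom_sqr (-1)%R (E - x)%R; rewrite normrN normr1 divr1 => H.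
apply: le_trans (H _); last by rewrite oppr_eq0 oner_eq0.
rewrite le_eqVlt; apply/orP; left; apply/eqP; apply: eq_integral => w _.
by congr ((g _ ^+ 2)%:E); ring.
Qed.

Lemma sqn_affine (al be : R) : (`|al| = 1)%R ->
  \int[mu]_x ((g (al * x + be)) ^+ 2)%:E = sqn g.
Proof.
move=> al1; rewrite (@ge0_integral_affine _ _ _ (fun x => ((g x) ^+ 2)%:E))//.
- by rewrite al1 invr1 mul1e.
- by rewrite -normr_eq0 al1 oner_eq0.
- by move=> x; rewrite lee_fin sqr_ge0.
Qed.

Lemma prob_integral_cst (k : \bar R) : \int[nu]_x k = k.
Proof.
rewrite (integral_cst nu measurableT) -[RHS]mule1; congr (_ * _).
exact: probability_setT.
Qed.

Hypothesis gfin : sqn g < +oo.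

Lemma avgE E x : (avg nu E g x)%:E = \int[nu]_w (g (E - w - x)%R)%:E.
Proof.
rewrite /avg fineK// ge0_fin_numE; last by apply: integral_ge0 => w _; rewrite lee_fin.
(* Since [g <= 1 + g ^+ 2], a finite second moment gives integrability. *)
apply: (@le_lt_trans _ _ (\int[nu]_w (1 + ((g (E - w - x)%R) ^+ 2)%:E))).
  apply: ge0_le_integral => //.
  - by move=> w _; rewrite lee_fin.
  - by apply/measurable_EFinP; exact: mgE.
  - by apply: emeasurable_funD => //; apply/measurable_EFinP/measurable_funX; exact: mgE.
  - move=> w _; rewrite -EFinD lee_fin; have := sqr_ge0 (g (E - w - x) - 1)%R; have := g0 (E - w - x)%R; nra.
rewrite ge0_integralD//; last 2 first.
  by move=> w _; rewrite lee_fin sqr_ge0.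
  by apply/measurable_EFinP/measurable_funX; exact: mgE.
rewrite prob_integral_cst lte_add_pinfty ?ltry//.
apply: le_lt_trans (dom_sqr1 E x) _.
by rewrite lte_mul_pinfty.
Qed.

Lemma avg_ge0 E x : (0 <= avg nu E g x)%R.
Proof. by apply: fine_ge0; apply: integral_ge0 => w _; rewrite lee_fin. Qed.

(** Jensen's inequality: integrate [2 m g <= g ^+ 2 + m ^+ 2] against [nu], with [m] the mean, and
    cancel one finite [m ^+ 2]. *)
Lemma avg_sqr E x : ((avg nu E g x) ^+ 2)%:E <= \int[nu]_w ((g (E - w - x)%R) ^+ 2)%:E.
Proof.
set m := avg nu E g x.
have H : (m * m + m * m)%:E <= \int[nu]_w ((g (E - w - x)%R) ^+ 2)%:E + (m ^+ 2)%:E.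
  rewrite -(prob_integral_cst (m ^+ 2)%:E) -ge0_integralD//; last 3 first.
    by move=> w _; rewrite lee_fin sqr_ge0.
    by apply/measurable_EFinP/measurable_funX; exact: mgE.
    by move=> w _; rewrite lee_fin sqr_ge0.
  rewrite -mulrDl EFinM avgE -ge0_integralZl_EFin//; last 3 first.
    by move=> w _; rewrite lee_fin.
    by apply/measurable_EFinP; exact: mgE.
    by rewrite addr_ge0 ?avg_ge0.
  apply: ge0_le_integral => //.
  - by move=> w _; rewrite -EFinM lee_fin mulr_ge0 ?addr_ge0 ?avg_ge0.
  - by apply: measurable_funeM; apply/measurable_EFinP; exact: mgE.
  - by apply: emeasurable_funD => //; apply/measurable_EFinP/measurable_funX; exact: mgE.
  - move=> w _; rewrite -EFinM -EFinD lee_fin; have := sqr_ge0 (g (E - w - x) - m)%R; lra.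
by move: H; rewrite -expr2 EFinD leeD2rE.
Qed.

Lemma avg_sqr_le E x : ((avg nu E g x) ^+ 2)%:E <= M%:E * sqn g.
Proof. exact: le_trans (avg_sqr E x) (dom_sqr1 E x). Qed.

Let mtriple E : measurable_fun [set: R * R] (fun z : R * R => g (E - z.2 - z.1)%R).
Proof.
apply: measurableT_comp => //; apply: measurable_funB => //.
by apply: measurable_funB => //.
Qed.

Lemma measurable_avg E : measurable_fun [set: R] (avg nu E g).
Proof.
apply: measurableT_comp => //=.
apply: (measurable_fun_fubini_tonelli_F (m2 := nu) (fun z : R * R => (g (E - z.2 - z.1)%R)%:E)).
  by apply/measurable_EFinP; exact: mtriple.
by move=> z; rewrite lee_fin.
Qed.

Lemma sqn_fubini E : \int[mu]_x \int[nu]_w ((g (E - w - x)%R) ^+ 2)%:E = sqn g.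
Proof.
rewrite (@fubini_tonelli _ _ _ _ _ mu nu (fun z => ((g (E - z.2 - z.1)%R) ^+ 2)%:E))//; last 2 first.
  by apply/measurable_EFinP/measurable_funX; exact: mtriple.
  by move=> z; rewrite lee_fin sqr_ge0.
transitivity (\int[nu]_w sqn g).
  apply: eq_integral => w _ /=; rewrite -(@sqn_affine (-1)%R (E - w)%R) ?normrN ?normr1//.
  by apply: eq_integral => x _; congr ((g _ ^+ 2)%:E); ring.
exact: prob_integral_cst.
Qed.

Lemma sqn_avg E : sqn (avg nu E g) <= sqn g.
Proof.
rewrite -(sqn_fubini E); apply: ge0_le_integral => //.
- by move=> x _; rewrite lee_fin sqr_ge0.
- by apply/measurable_EFinP/measurable_funX; exact: measurable_avg.
- apply: (measurable_fun_fubini_tonelli_F (m2 := nu) (fun z : R * R => ((g (E - z.2 - z.1)%R)^+2)%:E)).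
    by apply/measurable_EFinP/measurable_funX; exact: mtriple.
  by move=> z; rewrite lee_fin sqr_ge0.
- by move=> x _; exact: avg_sqr.
Qed.

End fixed.
End averaging.

(** * Norm lost by averaging and near-invariance under translations *)

Section near_invariance.
Context {R : realType}.
Notation mu := (@lebesgue_measure R).
Local Open Scope ereal_scope.

Variables (nu : probability (measurableTypeR R) R) (M : R).
Hypothesis M0 : (0 <= M)%R.
Hypothesis dom : forall B : set R, measurable B -> nu B <= M%:E * mu B.
Variable g : R -> R.
Hypothesis mg : measurable_fun [set: R] g.
Hypothesis g0 : forall x, (0 <= g x)%R.
Hypothesis gfin : sqn g < +oo.

Let D (u : R) := \int[mu]_x ((g (x + u) - g x) ^+ 2)%:E.

Let D0 u : 0 <= D u.
Proof. by apply: integral_ge0 => x _; rewrite lee_fin sqr_ge0. Qed.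

Let mgD d (T : measurableType d) (f : T -> R) : measurable_fun [set: T] f ->
  measurable_fun [set: T] (g \o f).
Proof. exact: measurableT_comp. Qed.

(** The increments of [n] successive translations by [u] telescope; Cauchy-Schwarz gives the factor
    [n ^+ 2]. *)
Lemma sqn_increment_mul n u : D (n%:R * u) <= (n%:R ^+ 2)%:E * D u.
Proof.
have mDi (v : R) : measurable_fun [set: R] (fun x => (((g (x + v) - g x) ^+ 2))%:E).
  apply/measurable_EFinP/measurable_funX/measurable_funB => //.
  by apply: mgD; exact: measurable_funD.
have key x : ((g (x + n%:R * u) - g x) ^+ 2 <=
    n%:R * \sum_(i < n) (g (x + i%:R * u + u) - g (x + i%:R * u)) ^+ 2)%R.
  apply: le_trans (sqr_sum_le (fun i => g (x + i%:R * u + u) - g (x + i%:R * u))%R n).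
  rewrite le_eqVlt; apply/orP; left; apply/eqP; congr (_ ^+ 2)%R.
  elim: n => [|m IH]; first by rewrite big_ord0 mul0r addr0 subrr.
  rewrite big_ord_recr/= -IH -natr1.
  have -> : (x + (m%:R + 1) * u = x + m%:R * u + u)%R by ring.
  by ring.
apply: (@le_trans _ _ (\int[mu]_x (n%:R%:E *
    \sum_(i < n) ((g (x + i%:R * u + u) - g (x + i%:R * u)) ^+ 2)%:E))).
  apply: ge0_le_integral => //.
  - by move=> x _; rewrite lee_fin sqr_ge0.
  - exact: mDi.
  - apply: measurable_funeM; apply: emeasurable_sum => i.
    apply/measurable_EFinP/measurable_funX/measurable_funB.
      by apply: mgD; apply: measurable_funD => //; exact: measurable_funD.
    by apply: mgD; exact: measurable_funD.
  - by move=> x _; rewrite sumEFin -EFinM lee_fin.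
rewrite ge0_integralZl_EFin//; last 2 first.
  by move=> x _; apply: sume_ge0 => i _; rewrite lee_fin sqr_ge0.
  apply: emeasurable_sum => i.
  apply/measurable_EFinP/measurable_funX/measurable_funB.
    by apply: mgD; apply: measurable_funD => //; exact: measurable_funD.
  by apply: mgD; exact: measurable_funD.
rewrite ge0_integral_sum//; last 2 first.
  move=> i; apply/measurable_EFinP/measurable_funX/measurable_funB.
    by apply: mgD; apply: measurable_funD => //; exact: measurable_funD.
  by apply: mgD; exact: measurable_funD.
  by move=> i x _; rewrite lee_fin sqr_ge0.
rewrite (eq_bigr (fun=> D u)); last first.
  move=> i _; rewrite [RHS]/D; have := @ge0_integral_affine R 1%R (i%:R * u)%R
    (fun x => ((g (x + u) - g x) ^+ 2)%:E) (oner_neq0 _) (mDi u).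
  rewrite normr1 invr1 mul1e => <-; last by move=> x; rewrite lee_fin sqr_ge0.
  by apply: eq_integral => x _; rewrite mul1r.
have -> : \sum_(i < n) D u = n%:R%:E * D u.
  rewrite mule_natl; elim: (n) => [|m IH]; first by rewrite big_ord0.
  by rewrite big_ord_recl IH -muleS.
by rewrite expr2 EFinM muleA.
Qed.

Let nu2 : probability (measurableTypeR R * measurableTypeR R)%type R := (nu \x nu)%E.

Let prob_nu2 (f : R -> \bar R) : measurable_fun [set: R] f -> (forall x, 0 <= f x) ->
  \int[nu2]_z f z.1 = \int[nu]_w f w.
Proof.
move=> mf f0; rewrite /nu2 fubini_tonelli1//; last exact: measurableT_comp.
by apply: eq_integral => w _; rewrite /fubini_F/= prob_integral_cst.
Qed.

Let prob_nu2' (f : R -> \bar R) : measurable_fun [set: R] f -> (forall x, 0 <= f x) ->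
  \int[nu2]_z f z.2 = \int[nu]_w f w.
Proof.
move=> mf f0; rewrite /nu2 fubini_tonelli1//; last exact: measurableT_comp.
by rewrite /fubini_F/= prob_integral_cst.
Qed.

Variable E : R.

Let k x (z : R * R) := ((g (E - z.1 - x) - g (E - z.2 - x)) ^+ 2)%R.

Let msub d (T : measurableType d) (f1 f2 : T -> R) :
  measurable_fun [set: T] f1 -> measurable_fun [set: T] f2 ->
  measurable_fun [set: T] (fun t => g (E - f1 t - f2 t)).
Proof.
move=> m1 m2; apply: mgD; apply: measurable_funB => //; exact: measurable_funB.
Qed.

Let mk d (T : measurableType d) (f1 : T -> R) (f2 f3 : T -> R) :
  measurable_fun [set: T] f1 -> measurable_fun [set: T] f2 -> measurable_fun [set: T] f3 ->
  measurable_fun [set: T] (fun t => (k (f1 t) (f2 t, f3 t))%:E).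
Proof.
move=> m1 m2 m3; apply/measurable_EFinP/measurable_funX/measurable_funB; exact: msub.
Qed.

(** Twice the variance is the mean squared difference of two independent copies: expand the square,
    and Tonelli turns the cross term into the squared mean. It is stated with sums because the terms
    are extended reals. *)
Lemma variance_identity x : \int[nu2]_z (k x z)%:E + (2 * avg nu E g x ^+ 2)%:E
  = 2%:E * \int[nu]_w ((g (E - w - x)) ^+ 2)%:E.
Proof.
pose f w := g (E - w - x)%R.
have mf : measurable_fun [set: R] f by exact: msub.
have f0 w : (0 <= f w)%R by exact: g0.
have avgf : \int[nu]_w (f w)%:E = (avg nu E g x)%:E by rewrite (avgE M0 dom).
have cross : \int[nu2]_z (2 * (f z.1 * f z.2))%:E = (2 * avg nu E g x ^+ 2)%:E.
  rewrite /nu2 fubini_tonelli1//; last 2 first.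
    apply/measurable_EFinP/measurable_funM => //; apply: measurable_funM => //.
      exact: measurableT_comp.
    exact: measurableT_comp.
    by move=> z; rewrite lee_fin !mulr_ge0.
  transitivity (\int[nu]_w ((2 * avg nu E g x)%:E * (f w)%:E)).
    apply: eq_integral => w _; rewrite /fubini_F/=.
    transitivity (\int[nu]_y ((2 * f w)%:E * (f y)%:E)).
      by apply: eq_integral => y _; rewrite -EFinM mulrA.
    rewrite ge0_integralZl_EFin//; last 3 first.
      by move=> y _; rewrite lee_fin.
      exact/measurable_EFinP.
      by rewrite mulr_ge0.
    by rewrite avgf -!EFinM; congr EFin; ring.
  rewrite ge0_integralZl_EFin//; last 3 first.
    by move=> y _; rewrite lee_fin.
    exact/measurable_EFinP.
    by rewrite mulr_ge0// avg_ge0.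
  by rewrite avgf -EFinM expr2 mulrA.
have mf2 : measurable_fun [set: R] (fun w => ((f w) ^+ 2)%:E).
  exact/measurable_EFinP/measurable_funX.
have mf1 : measurable_fun [set: R * R] (fun z : R * R => f z.1) by exact: measurableT_comp.
have mf2' : measurable_fun [set: R * R] (fun z : R * R => f z.2) by exact: measurableT_comp.
rewrite -cross -ge0_integralD//; last 4 first.
  by move=> z _; rewrite lee_fin sqr_ge0.
  by apply: (mk (f1 := cst x) (f2 := fst) (f3 := snd)).
  by move=> z _; rewrite lee_fin !mulr_ge0.
  by apply/measurable_EFinP/measurable_funM => //; exact: measurable_funM.
transitivity (\int[nu2]_z (((f z.1) ^+ 2)%:E + ((f z.2) ^+ 2)%:E)).
  by apply: eq_integral => z _; rewrite -!EFinD; congr EFin; rewrite /k /f; ring.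
rewrite ge0_integralD//; last 4 first.
  by move=> z _; rewrite lee_fin sqr_ge0.
  by apply/measurable_EFinP/measurable_funX.
  by move=> z _; rewrite lee_fin sqr_ge0.
  by apply/measurable_EFinP/measurable_funX.
rewrite (prob_nu2 mf2) ?(prob_nu2' mf2); try by move=> w; rewrite lee_fin sqr_ge0.
by rewrite -[in LHS](mul1e (\int[nu]_w _)) -ge0_muleDl.
Qed.

(** Integrate [variance_identity] over [x] and substitute [y = E - z.1 - x]: the norm lost by
    averaging is half the mean of the translation increment [D] at the difference of two independent
    draws. *)
Lemma deficit_identity :
  \int[nu2]_z D (z.1 - z.2)%R + 2%:E * sqn (avg nu E g) = 2%:E * sqn g.
Proof.
have mkk : measurable_fun [set: R * (R * R)] (fun p : R * (R * R) => (k p.1 p.2)%:E).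
  have := @mk _ (R * (R * R))%type fst (fst \o snd) (snd \o snd).
  by apply; [|exact: measurableT_comp|exact: measurableT_comp].
have k0 p : 0 <= (k p.1 p.2)%:E by rewrite lee_fin sqr_ge0.
have -> : \int[nu2]_z D (z.1 - z.2)%R = \int[mu]_x \int[nu2]_z (k x z)%:E.
  rewrite (@fubini_tonelli _ _ _ _ _ mu nu2 (fun p => (k p.1 p.2)%:E))//.
  apply: eq_integral => z _ /=.
  rewrite /D; have := @ge0_integral_affine R (-1)%R (E - z.1)%R
    (fun y => ((g (y + (z.1 - z.2)) - g y) ^+ 2)%:E).
  rewrite normrN normr1 invr1 mul1e => <-; last 3 first.
  - by rewrite oppr_eq0 oner_eq0.
  - apply/measurable_EFinP/measurable_funX/measurable_funB => //.
    by apply: mgD; exact: measurable_funD.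
  - by move=> y; rewrite lee_fin sqr_ge0.
  apply: eq_integral => x _; rewrite /k -sqrrN opprB; congr ((_ - _) ^+ 2)%:E; congr g; ring.
rewrite /sqn -ge0_integralZl_EFin//; last 2 first.
  by move=> x _; rewrite lee_fin sqr_ge0.
  by apply/measurable_EFinP/measurable_funX; exact: measurable_avg.
rewrite -ge0_integralD//; last 4 first.
  by move=> x _; apply: integral_ge0 => z _; rewrite lee_fin sqr_ge0.
  exact: (measurable_fun_fubini_tonelli_F (m2 := nu2) (fun p => (k p.1 p.2)%:E)).
  by move=> x _; rewrite -EFinM lee_fin mulr_ge0// sqr_ge0.
  by apply: measurable_funeM; apply/measurable_EFinP/measurable_funX; exact: measurable_avg.
under eq_integral do rewrite -EFinM variance_identity.
rewrite ge0_integralZl_EFin//; last 2 first.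
  by move=> x _; apply: integral_ge0 => w _; rewrite lee_fin sqr_ge0.
  apply: (measurable_fun_fubini_tonelli_F (m2 := nu) (fun z : R * R => ((g (E - z.2 - z.1)%R)^+2)%:E)).
    by apply/measurable_EFinP/measurable_funX; exact: msub.
  by move=> z; rewrite lee_fin sqr_ge0.
by rewrite sqn_fubini.
Qed.

(* Either averaging strictly shrinks the norm, or g is nearly invariant under
   translations of size about n times the width of nu, hence spread out. *)
Lemma local_mass_le (I : set R) n : measurable I -> (0 < n)%N ->
  \int[mu]_(x in I) ((g x) ^+ 2)%:E + (4 * n%:R ^+ 2)%:E * sqn (avg nu E g) <=
  (4 * n%:R ^+ 2)%:E * sqn g + (2 * (M / n%:R))%:E * sqn g * mu I.
Proof.
move=> mI n0.
(* With [y] the value of [g] at the point translated by [n (z.1 - z.2)], one has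
   [g x ^+ 2 <= 2 (y - g x) ^+ 2 + 2 y ^+ 2]. Below, [A] is the first square, controlled by the norm
   deficit, and [B] the second, controlled by smoothing. *)
have n0' : (0 < n%:R :> R)%R by rewrite ltr0n.
pose A (x : R) (z : R * R) := ((g (x + n%:R * (z.1 - z.2)) - g x) ^+ 2)%R : R.
pose B (x : R) (z : R * R) := (g (x + n%:R * (z.1 - z.2)) ^+ 2)%R : R.
have marg : measurable_fun [set: R * (R * R)]
    (fun p : R * (R * R) => g (p.1 + n%:R * (p.2.1 - p.2.2))%R).
  apply: mgD; apply: measurable_funD => //; apply: measurable_funM => //.
  by apply: measurable_funB; exact: measurableT_comp.
have mA : measurable_fun [set: R * (R * R)] (fun p : R * (R * R) => (A p.1 p.2)%:E).
  apply/measurable_EFinP/measurable_funX/measurable_funB => //.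
  exact: measurableT_comp.
have mB : measurable_fun [set: R * (R * R)] (fun p : R * (R * R) => (B p.1 p.2)%:E).
  exact/measurable_EFinP/measurable_funX.
have A0 p : 0 <= (A p.1 p.2)%:E by rewrite lee_fin sqr_ge0.
have B0 p : 0 <= (B p.1 p.2)%:E by rewrite lee_fin sqr_ge0.
have mDz : measurable_fun [set: R * R] (fun z : R * R => D (z.1 - z.2)%R).
  apply: (measurable_fun_fubini_tonelli_G (m1 := mu)
    (fun p : R * (R * R) => ((g (p.1 + (p.2.1 - p.2.2)) - g p.1) ^+ 2)%:E)); last first.
    by move=> p; rewrite lee_fin sqr_ge0.
  apply/measurable_EFinP/measurable_funX/measurable_funB => //; last exact: measurableT_comp.
  apply: mgD; apply: measurable_funD => //.
  by apply: measurable_funB; exact: measurableT_comp.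
have mFA := measurable_fun_fubini_tonelli_F (m2 := nu2) _ mA A0.
have mFB := measurable_fun_fubini_tonelli_F (m2 := nu2) _ mB B0.
have IA0 x : 0 <= \int[nu2]_z (A x z)%:E by apply: integral_ge0 => z _; rewrite lee_fin sqr_ge0.
have IB0 x : 0 <= \int[nu2]_z (B x z)%:E by apply: integral_ge0 => z _; rewrite lee_fin sqr_ge0.
have mAx x : measurable_fun [set: R * R] (fun z => (A x z)%:E).
  exact: (measurableT_comp mA (pair1_measurable x)).
have mBx x : measurable_fun [set: R * R] (fun z => (B x z)%:E).
  exact: (measurableT_comp mB (pair1_measurable x)).
have step1 : \int[mu]_(x in I) ((g x) ^+ 2)%:E <=
   2%:E * \int[mu]_x \int[nu2]_z (A x z)%:E + 2%:E * \int[mu]_(x in I) \int[nu2]_z (B x z)%:E.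
  apply: (@le_trans _ _ (\int[mu]_(x in I) (2%:E * \int[nu2]_z (A x z)%:E + 2%:E * \int[nu2]_z (B x z)%:E))).
    apply: ge0_le_integral => //.
    - by move=> x _; rewrite lee_fin sqr_ge0.
    - by apply: measurable_funTS; exact/measurable_EFinP/measurable_funX.
    - by apply: emeasurable_funD; apply: measurable_funeM; apply: measurable_funTS; [exact: mFA|exact: mFB].
    move=> x _; rewrite -!ge0_integralZl_EFin//; try by move=> z _; rewrite lee_fin sqr_ge0.
    rewrite -ge0_integralD//; try (by move=> z _; rewrite -EFinM lee_fin mulr_ge0// sqr_ge0);
      try exact: measurable_funeM.
    rewrite -[leLHS](prob_integral_cst nu) -(prob_nu2 (f := cst _))//=; last first.
      by move=> w; rewrite lee_fin sqr_ge0.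
    apply: ge0_le_integral => //.
    + by move=> z _; rewrite lee_fin sqr_ge0.
    + by apply: emeasurable_funD; apply: measurable_funeM; [exact: mAx|exact: mBx].
    + move=> z _; rewrite -!EFinM -EFinD lee_fin /A /B.
      set y := g (x + _)%R; have := sqr_ge0 (2 * y - g x)%R; lra.
    + by apply: measurable_funeM; exact: mAx.
    + by apply: measurable_funeM; exact: mBx.
    + exact: mBx.
    + exact: mAx.
  rewrite ge0_integralD//; last 4 first.
    by move=> x _; rewrite mule_ge0.
    by apply: measurable_funeM; apply: measurable_funTS; exact: mFA.
    by move=> x _; rewrite mule_ge0.
    by apply: measurable_funeM; apply: measurable_funTS; exact: mFB.
  rewrite !ge0_integralZl_EFin//; try (by apply: measurable_funTS; [exact: mFA]);
    try (by apply: measurable_funTS; [exact: mFB]).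
  apply: leeD => //; apply: lee_wpmul2l => //.
  by apply: ge0_subset_integral => //; exact: mFA.
have stepA : \int[mu]_x \int[nu2]_z (A x z)%:E <= (n%:R ^+ 2)%:E * \int[nu2]_z D (z.1 - z.2)%R.
  rewrite (@fubini_tonelli _ _ _ _ _ mu nu2 (fun p => (A p.1 p.2)%:E))//.
  rewrite -ge0_integralZl_EFin//.
  apply: ge0_le_integral => //.
  - by move=> z _; apply: integral_ge0 => x _; rewrite lee_fin sqr_ge0.
  - exact: (measurable_fun_fubini_tonelli_G (m1 := mu) _ mA A0).
  - by apply: measurable_funeM; exact: mDz.
  - by move=> z _; apply: le_trans (sqn_increment_mul n (z.1 - z.2)%R); rewrite /D.

(* For a draw [w'] from [nu], the law of [n w'] has density at most [M / n]. The averaged translate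
   thus has mass at most [M / n * sqn g] per unit length. *)
have stepB : \int[mu]_(x in I) \int[nu2]_z (B x z)%:E <= (M / n%:R)%:E * sqn g * mu I.
  have c0 : 0 <= (M / n%:R)%:E * sqn g by rewrite mule_ge0 ?sqn_ge0// lee_fin divr_ge0// ltW.
  rewrite -integral_cst//; apply: ge0_le_integral => //.
  - by apply: measurable_funTS; exact: mFB.
  - move=> x _; rewrite /nu2 fubini_tonelli1//=.
    rewrite -(prob_integral_cst nu ((M / n%:R)%:E * sqn g)).
    apply: ge0_le_integral => //.
    + by move=> w _; apply: integral_ge0 => w' _; rewrite lee_fin sqr_ge0.
    + apply: (measurable_fun_fubini_tonelli_F (m2 := nu) (fun z => (B x z)%:E)).
        exact: mBx.
      by move=> z; rewrite lee_fin sqr_ge0.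
    + move=> w _; rewrite /fubini_F/= /B/=.
      have := @dom_sqr R nu M M0 dom g mg (- n%:R)%R (x + n%:R * w)%R.
      rewrite normrN (gtr0_norm n0') oppr_eq0 (gt_eqF n0') => H; apply: le_trans (H isT).
      rewrite le_eqVlt; apply/orP; left; apply/eqP; apply: eq_integral => w' _.
      by congr ((g _ ^+ 2)%:E); ring.
    + exact: mBx.
    + by move=> z; rewrite lee_fin sqr_ge0.
set V := \int[nu2]_z D (z.1 - z.2)%R in stepA *.
have V0 : 0 <= V by apply: integral_ge0 => z _; exact: D0.
have n20 : (0 <= n%:R ^+ 2 :> R)%R by exact: sqr_ge0.
have S0 := sqn_ge0 (avg nu E g).
have HD : V + 2%:E * sqn (avg nu E g) = 2%:E * sqn g := deficit_identity.
move: S0 HD V0 step1 stepA stepB.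
move: (sqn (avg nu E g)) V => S V.
move: (\int[mu]_(x in I) ((g x) ^+ 2)%:E) (\int[mu]_x \int[nu2]_z (A x z)%:E)
  (\int[mu]_(x in I) \int[nu2]_z (B x z)%:E) => e1 e2 e3 S0 HD V0 step1 stepA stepB.
have -> : (4 * n%:R ^+ 2)%:E * sqn g = (2 * n%:R ^+ 2)%:E * V + (4 * n%:R ^+ 2)%:E * S.
  rewrite (_ : 4 * n%:R ^+ 2 = 2 * n%:R ^+ 2 * 2)%R; last by ring.
  rewrite [in LHS]EFinM -muleA -HD ge0_muleDr//; last by rewrite mule_ge0.
  by rewrite muleA -EFinM.
rewrite addeAC leeD2r//.
apply: le_trans step1 _; apply: leeD.
  by rewrite EFinM -muleA; exact: lee_wpmul2l.
by rewrite [X in _ <= X * _ * _]EFinM -!muleA; apply: lee_wpmul2l => //; rewrite muleA.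
Qed.

End near_invariance.

(** * The transfer operator of one site and the contraction of two *)

Section transfer.
Context {R : realType}.
Notation mu := (@lebesgue_measure R).
Local Open Scope ereal_scope.

(* The factor [a / `|y|] is the square root of the Jacobian of [y |-> a ^+ 2 / y]
   and makes this an isometry of L^2. *)
Definition inv_density (a : R) (f : R -> R) (y : R) : R := (a / `|y| * f (a ^+ 2 / y))%R.

Definition transfer (nu : probability (measurableTypeR R) R) (a E : R) (f : R -> R) :=
  avg nu E (inv_density a f).

Lemma measurable_inv_density d (T : measurableType d) a (f : T -> R -> R) (y : T -> R) :
  measurable_fun [set: T * R] (fun p => f p.1 p.2) -> measurable_fun [set: T] y ->
  measurable_fun [set: T] (fun t => inv_density a (f t) (y t)).
Proof.
move=> mf my; apply: measurable_funM.
  apply: measurable_funM => //; apply: measurable_funV.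
  exact: measurableT_comp.
have := @measurable_fun_pair _ _ _ T T R (fun t => t) (fun t => (a ^+ 2 / y t)%R).
move=> /(_ (@measurable_id _ _ _)) H.
apply: (measurableT_comp mf (H _)).
by apply: measurable_funM => //; exact: measurable_funV.
Qed.

Lemma inv_density_ge0 a f y : (0 < a)%R -> (forall x, 0 <= f x)%R ->
  (0 <= inv_density a f y)%R.
Proof. by move=> a0 f0; rewrite /inv_density mulr_ge0// divr_ge0// ltW. Qed.

Section fixed.
Variables (a : R) (f : R -> R).
Hypothesis a0 : (0 < a)%R.
Hypothesis mf : measurable_fun [set: R] f.
Hypothesis f0 : forall x, (0 <= f x)%R.

Lemma measurable_inv_density1 : measurable_fun [set: R] (inv_density a f).
Proof.
by apply: (@measurable_inv_density _ R a (fun=> f) id) => //; exact: measurableT_comp.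
Qed.

Lemma inv_density_sqr y : (inv_density a f y ^+ 2 = (a / y) ^+ 2 * f (a ^+ 2 / y) ^+ 2)%R.
Proof. by rewrite /inv_density !exprMn !exprVn real_normK ?num_real. Qed.

Lemma sqn_inv_density : sqn (inv_density a f) = sqn f.
Proof.
rewrite /sqn -(ge0_integral_inversion a0 (F := fun x => ((f x) ^+ 2)%:E)).
- by apply: eq_integral => y _; rewrite inv_density_sqr EFinM.
- exact/measurable_EFinP/measurable_funX.
- by move=> x; rewrite lee_fin sqr_ge0.
Qed.

(** Inversion exchanges the inside and the outside of [[-a, a]]: the mass of [inv_density a f]
    outside is mass of [f] inside. Hence [f] and its inversion cannot both live away from 0. *)
Lemma sqn_split_inversion : sqn f <=
  \int[mu]_(x in `[(- a)%R, a]) ((inv_density a f x) ^+ 2)%:E +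
  \int[mu]_(x in `[(- a)%R, a]) ((f x) ^+ 2)%:E.
Proof.
set I := `[(- a)%R, a]%classic.
have mI : measurable I by exact: measurable_itv.
have mf2 : measurable_fun [set: R] (fun x => ((f x) ^+ 2)%:E).
  exact/measurable_EFinP/measurable_funX.
have mi2 : measurable_fun [set: R] (fun x => ((inv_density a f x) ^+ 2)%:E).
  apply/measurable_EFinP/measurable_funX; exact: measurable_inv_density1.
have mF : measurable_fun [set: R] ((fun x => ((f x) ^+ 2)%:E) \_ I).
  by apply/(measurable_restrictT _ mI); exact: measurable_funTS.
have mG : measurable_fun [set: R] ((fun x => ((inv_density a f x) ^+ 2)%:E) \_ I).
  by apply/(measurable_restrictT _ mI); exact: measurable_funTS.
have F0 x : 0 <= ((fun x => ((f x) ^+ 2)%:E) \_ I) x.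
  by rewrite patchE; case: ifP; rewrite // lee_fin sqr_ge0.
have G0 x : 0 <= ((fun x => ((inv_density a f x) ^+ 2)%:E) \_ I) x.
  by rewrite patchE; case: ifP; rewrite // lee_fin sqr_ge0.
rewrite -sqn_inv_density [X in _ <= X + _]integral_mkcond [X in _ <= _ + X]integral_mkcond.
rewrite -(ge0_integral_inversion a0 mF)//.
have mH : measurable_fun [set: R]
    (fun y => ((a / y) ^+ 2)%:E * ((fun x => ((f x) ^+ 2)%:E) \_ I) (a ^+ 2 / y)%R).
  apply: emeasurable_funM.
    by apply/measurable_EFinP/measurable_funX/measurable_funM => //; exact: measurable_funV.
  apply: (measurableT_comp mF).
  by apply: measurable_funM => //; exact: measurable_funV.
have H0 y : 0 <= ((a / y) ^+ 2)%:E * ((fun x => ((f x) ^+ 2)%:E) \_ I) (a ^+ 2 / y)%R.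
  by rewrite mule_ge0 ?F0// lee_fin sqr_ge0.
rewrite -ge0_integralD//; apply: ge0_le_integral => //.
- by move=> x _; rewrite lee_fin sqr_ge0.
- exact: emeasurable_funD.
move=> y _; rewrite !patchE.
have [yI|yI] := boolP (y \in I).
  by rewrite leeDl// mule_ge0// ?lee_fin ?sqr_ge0//; case: ifP; rewrite // lee_fin sqr_ge0.
rewrite add0e ifT ?inv_density_sqr ?EFinM//; apply/mem_set.
have {}yI : (a < `|y|)%R.
  rewrite ltNge; apply/negP => ya; move/negP: yI; apply; apply/mem_set.
  by rewrite /I /= in_itv/= -ler_norml.
have y0 : (0 < `|y|)%R by apply: lt_trans yI.
rewrite /I /= in_itv/= -ler_norml normrM normfV ler_pdivrMr//.
by rewrite ger0_norm ?sqr_ge0// expr2 ler_pM2l// ltW.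
Qed.

End fixed.

Section average_local.
Variables (nu : probability (measurableTypeR R) R) (M : R).
Hypothesis M0 : (0 <= M)%R.
Hypothesis dom : forall B : set R, measurable B -> nu B <= M%:E * mu B.
Variable g : R -> R.
Hypothesis mg : measurable_fun [set: R] g.
Hypothesis g0 : forall x, (0 <= g x)%R.
Hypothesis gfin : sqn g < +oo.

(** Companion of [local_mass_le] with the local mass of the averaged function instead of [g]. By
    Jensen that mass is at most the mean over [w] of the mass of [g] in the reflected set [J w],
    which is as large as [I]; [local_mass_le] applies to each [J w]. *)
Lemma local_mass_avg_le E (I : set R) n : measurable I -> (0 < n)%N ->
  \int[mu]_(x in I) ((avg nu E g x) ^+ 2)%:E + (4 * n%:R ^+ 2)%:E * sqn (avg nu E g) <=
  (4 * n%:R ^+ 2)%:E * sqn g + (2 * (M / n%:R))%:E * sqn g * mu I.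
Proof.
move=> mI n0.
pose J w : set R := (fun y => E - w - y)%R @^-1` I.
have mJ w : measurable (J w).
  rewrite -[J w]setTI; apply: measurable_funB => //.
have muJ w : mu (J w) = mu I.
  have muE (A : set R) : measurable A -> mu A = \int[mu]_x (\1_A x)%:E.
    by move=> mA; rewrite integral_indic// setIT.
  rewrite !muE//.
  have := @ge0_integral_affine R (-1)%R (E - w)%R (fun x => (\1_I x)%:E).
  rewrite normrN normr1 invr1 mul1e => <-; last 3 first.
  - by rewrite oppr_eq0 oner_eq0.
  - exact/measurable_EFinP/measurable_indic.
  - by move=> x; rewrite lee_fin.
  apply: eq_integral => x _; rewrite !indicE; congr ((nat_of_bool _)%:R%:E).
  rewrite (_ : -1 * x + (E - w) = E - w - x)%R; last by ring.
  by apply/idP/idP => /set_mem h; apply/mem_set.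
have mbar : measurable_fun [set: R * R]
    (fun z : R * R => ((\1_I z.1 * (g (E - z.2 - z.1)) ^+ 2)%R)%:E).
  apply/measurable_EFinP/measurable_funM.
    exact: (measurableT_comp (measurable_indic mI)).
  apply: measurable_funX; apply: (measurableT_comp mg).
  by apply: measurable_funB => //; exact: measurable_funB.
have bar0 (z : R * R) : 0 <= ((\1_I z.1 * (g (E - z.2 - z.1)) ^+ 2)%R)%:E.
  by rewrite lee_fin mulr_ge0// sqr_ge0.
have c40 : (0 <= 4 * n%:R ^+ 2 :> R)%R by rewrite mulr_ge0// sqr_ge0.
have mav : measurable_fun [set: R] (fun x => ((avg nu E g x) ^+ 2)%:E).
  apply/measurable_EFinP/measurable_funX; exact: measurable_avg.
have avle : \int[mu]_(x in I) ((avg nu E g x) ^+ 2)%:E <=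
    \int[nu]_w \int[mu]_x ((\1_I x * (g (E - w - x)) ^+ 2)%R)%:E.
  rewrite -(@fubini_tonelli _ _ _ _ _ mu nu
    (fun z : R * R => ((\1_I z.1 * (g (E - z.2 - z.1)) ^+ 2)%R)%:E))//.
  rewrite integral_mkcond; apply: ge0_le_integral => //.
  - by move=> x _; rewrite patchE; case: ifP; rewrite // lee_fin sqr_ge0.
  - by apply/(measurable_restrictT _ mI); exact: measurable_funTS.
  - exact: (measurable_fun_fubini_tonelli_F (m2 := nu) _ mbar bar0).
  - move=> x _; rewrite patchE; case: ifPn => xI; last first.
      by apply: integral_ge0 => w _; exact: (bar0 (x, w)).
    apply: le_trans (avg_sqr M0 dom mg g0 gfin E x) _.
    rewrite le_eqVlt; apply/orP; left; apply/eqP; apply: eq_integral => w _.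
    by rewrite indicE xI mul1r.
have S0 := sqn_ge0 (avg nu E g).
rewrite -[X in _ <= X](prob_integral_cst nu).
rewrite -[X in _ + X <= _](prob_integral_cst nu).
apply: le_trans (leeD2r _ avle) _.
have mslice : measurable_fun [set: R]
    (fun w => \int[mu]_x ((\1_I x * (g (E - w - x)) ^+ 2)%R)%:E).
  exact: (measurable_fun_fubini_tonelli_G (m1 := mu) _ mbar bar0).
have slice0 w : 0 <= \int[mu]_x ((\1_I x * (g (E - w - x)) ^+ 2)%R)%:E.
  by apply: integral_ge0 => x _; exact: (bar0 (x, w)).
rewrite -ge0_integralD//; last by move=> w _; rewrite mule_ge0.
apply: ge0_le_integral => //.
- by move=> w _; rewrite adde_ge0// mule_ge0.
- by apply: emeasurable_funD.
move=> w _; rewrite -(muJ w); apply: le_trans _ (local_mass_le M0 dom mg g0 gfin E (mJ w) n0).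
apply: leeD2r; rewrite [leRHS]integral_mkcond.
have := @ge0_integral_affine R (-1)%R (E - w)%R ((fun x => ((g x) ^+ 2)%:E) \_ (J w)).
rewrite normrN normr1 invr1 mul1e => <-; last 3 first.
- by rewrite oppr_eq0 oner_eq0.
- apply/(measurable_restrictT _ (mJ w)); apply: measurable_funTS.
  exact/measurable_EFinP/measurable_funX.
- by move=> x; rewrite patchE; case: ifP; rewrite // lee_fin sqr_ge0.
rewrite le_eqVlt; apply/orP; left; apply/eqP; apply: eq_integral => x _.
rewrite patchE indicE (_ : -1 * x + (E - w) = E - w - x)%R; last by ring.
have -> : ((E - w - x)%R \in J w) = (x \in I).
  have e : (E - w - (E - w - x) = x)%R by ring.
  by apply/idP/idP => /set_mem h; apply/mem_set; move: h; rewrite /J /= e.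
by case: ifP; rewrite ?mul1r ?mul0r.
Qed.

End average_local.

Lemma transfer_ge0 nu a E f x : (0 < a)%R -> (forall x, 0 <= f x)%R ->
  (0 <= transfer nu a E f x)%R.
Proof. by move=> a0 f0; apply: avg_ge0 => y; exact: inv_density_ge0. Qed.

(** The parameter [t] is there because the function carried along one half-line depends on the state
    of the other half-line. *)
Lemma measurable_transfer d (T : measurableType d) (nu : probability (measurableTypeR R) R)
    a E (f : T -> R -> R) :
  (0 < a)%R -> (forall t x, 0 <= f t x)%R ->
  measurable_fun [set: T * R] (fun p => f p.1 p.2) ->
  measurable_fun [set: T * R] (fun p => transfer nu a E (f p.1) p.2).
Proof.
move=> a0 f0 mf; apply: measurableT_comp => //=.
apply: (measurable_fun_fubini_tonelli_F (m2 := nu)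
   (fun q : (T * R) * R => (inv_density a (f q.1.1) (E - q.2 - q.1.2)%R)%:E)); last first.
  by move=> q; rewrite lee_fin inv_density_ge0.
apply/measurable_EFinP.
apply: (@measurable_inv_density _ ((T * R) * R)%type a (fun q => f q.1.1)
  (fun q => E - q.2 - q.1.2)%R).
  apply: (measurableT_comp mf (f := fun p => f p.1 p.2) (g := fun q : (T * R * R) * R => (q.1.1.1, q.2))).
  by apply: measurable_fun_pair => //; do 2 apply: measurableT_comp => //.
by apply: measurable_funB; [exact: measurable_funB|exact: measurableT_comp].
Qed.

Section contraction.
Variables (nu1 nu2 : probability (measurableTypeR R) R) (M : R).
Hypothesis M0 : (0 <= M)%R.
Hypothesis dom1 : forall B : set R, measurable B -> nu1 B <= M%:E * mu B.
Hypothesis dom2 : forall B : set R, measurable B -> nu2 B <= M%:E * mu B.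
Variables (a1 a2 E : R).
Hypotheses (a10 : (0 < a1)%R) (a20 : (0 < a2)%R).
Variable f : R -> R.
Hypothesis mf : measurable_fun [set: R] f.
Hypothesis f0 : forall x, (0 <= f x)%R.
Hypothesis ffin : sqn f < +oo.

Lemma measurable_transfer1 nu a : (0 < a)%R -> measurable_fun [set: R] (transfer nu a E f).
Proof.
move=> a0; have := @measurable_transfer _ R nu a E (fun=> f) a0 (fun=> f0).
move=> /(_ (measurableT_comp mf measurable_snd)) H.
exact: (measurableT_comp (f := fun p : R * R => transfer nu a E f p.2) H
  (pair1_measurable (0%R : R))).
Qed.

Lemma sqn_transfer : sqn (transfer nu1 a1 E f) <= sqn f.
Proof.
rewrite -(sqn_inv_density a10 mf); apply: (sqn_avg M0 dom1).
- exact: measurable_inv_density1.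
- by move=> x; exact: inv_density_ge0.
- by rewrite sqn_inv_density.
Qed.

Lemma transfer_sqr_le x : ((transfer nu1 a1 E f x) ^+ 2)%:E <= M%:E * sqn f.
Proof.
rewrite -(sqn_inv_density a10 mf); apply: (avg_sqr_le M0 dom1).
- exact: measurable_inv_density1.
- by move=> y; exact: inv_density_ge0.
- by rewrite sqn_inv_density.
Qed.

End contraction.

Section two_steps.
Variables (nu1 nu2 : probability (measurableTypeR R) R) (M : R).
Hypothesis M0 : (0 <= M)%R.
Hypothesis dom1 : forall B : set R, measurable B -> nu1 B <= M%:E * mu B.
Hypothesis dom2 : forall B : set R, measurable B -> nu2 B <= M%:E * mu B.
Variables (a1 a2 E : R).
Hypotheses (a10 : (0 < a1)%R) (a20 : (0 < a2)%R).
Variable f : R -> R.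
Hypothesis mf : measurable_fun [set: R] f.
Hypothesis f0 : forall x, (0 <= f x)%R.
Hypothesis ffin : sqn f < +oo.

(* A spread-out function is contracted by averaging; a function concentrated near
   infinity is not, but its inversion is concentrated near 0.  Hence two steps. *)
Lemma sqn_transfer2 n : (0 < n)%N -> (16 * (a2 * M) <= n%:R)%R ->
  sqn (transfer nu2 a2 E (transfer nu1 a1 E f)) <=
  (1 - (8 * n%:R ^+ 2 + 2)^-1)%:E * sqn f.
Proof.
move=> n0 nM; set f1 := transfer nu1 a1 E f; set f2 := transfer nu2 a2 E f1.
have n0' : (0 < n%:R :> R)%R by rewrite ltr0n.
have mf1 : measurable_fun [set: R] f1 by exact: measurable_transfer1.
have f10 x : (0 <= f1 x)%R by exact: transfer_ge0.
have S10 : sqn f1 <= sqn f by exact: (sqn_transfer M0 dom1).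
have f1fin : sqn f1 < +oo by exact: le_lt_trans ffin.
have S21 : sqn f2 <= sqn f1 by exact: (sqn_transfer M0 dom2).
have mI : measurable `[(- a2)%R, a2]%classic by exact: measurable_itv.
have muI : mu `[(- a2)%R, a2] = (2 * a2)%:E.
  rewrite lebesgue_measure_itv/= lte_fin ifT; last by rewrite -subr_gt0 opprK addr_gt0.
  by rewrite -EFinB; congr EFin; ring.
(* [H1] bounds the mass of [f1] near 0 by the norm lost in the first step, [H2] the mass of its
   inversion near 0 by the loss in the second; by [H3] the two masses cannot both be small. *)
have H1 : \int[mu]_(x in `[(- a2)%R, a2]) ((f1 x) ^+ 2)%:E +
    (4 * n%:R ^+ 2)%:E * sqn f1 <=
    (4 * n%:R ^+ 2)%:E * sqn f + (2 * (M / n%:R))%:E * sqn f * (2 * a2)%:E.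
  rewrite -(sqn_inv_density a10 mf) -muI.
  apply: (local_mass_avg_le M0 dom1) => //.
  - exact: measurable_inv_density1.
  - by move=> y; exact: inv_density_ge0.
  - by rewrite sqn_inv_density.
have H2 : \int[mu]_(x in `[(- a2)%R, a2]) ((inv_density a2 f1 x) ^+ 2)%:E +
    (4 * n%:R ^+ 2)%:E * sqn f2 <=
    (4 * n%:R ^+ 2)%:E * sqn f1 + (2 * (M / n%:R))%:E * sqn f1 * (2 * a2)%:E.
  rewrite -(sqn_inv_density a20 mf1) -muI.
  apply: (local_mass_le M0 dom2) => //.
  - exact: measurable_inv_density1.
  - by move=> y; exact: inv_density_ge0.
  - by rewrite sqn_inv_density.
have H3 := sqn_split_inversion a20 mf1.
have P0 : 0 <= \int[mu]_(x in `[(- a2)%R, a2]) ((inv_density a2 f1 x) ^+ 2)%:E.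
  by apply: integral_ge0 => x _; rewrite lee_fin sqr_ge0.
have Q0 : 0 <= \int[mu]_(x in `[(- a2)%R, a2]) ((f1 x) ^+ 2)%:E.
  by apply: integral_ge0 => x _; rewrite lee_fin sqr_ge0.
have S0 := sqn_ge0 f; have S1 := sqn_ge0 f1; have S2 := sqn_ge0 f2.
(* The choice of [n] makes each error term at most a quarter of the corresponding squared norm. *)
have kM : (2 * (M / n%:R) * (2 * a2) <= 4^-1)%R.
  have -> : (2 * (M / n%:R) * (2 * a2) = (4 * (a2 * M)) / n%:R)%R by field; rewrite gt_eqF.
  rewrite ler_pdivrMr//; lra.
have k0 : (0 <= 2 * (M / n%:R) * (2 * a2))%R.
  by rewrite !mulr_ge0// ?invr_ge0 ltW.
move: Q0 P0 H1 H2 H3.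
move: (\int[mu]_(x in `[(- a2)%R, a2]) ((f1 x) ^+ 2)%:E)
  (\int[mu]_(x in `[(- a2)%R, a2]) ((inv_density a2 f1 x) ^+ 2)%:E).
move: (sqn f) (sqn f1) (sqn f2) S0 S1 S2 S10 S21 ffin f1fin.
move=> [s| |] [s1| |] [s2| |]//= s0 s10 s20 h1 h2 _ _.
move=> [q| |] [p| |]//= q0 p0; rewrite -?EFinM -?EFinD ?lee_fin// => H1 H2 H3.
(* With [N = 4 n ^+ 2], adding [H1], [H2] and [H3] gives [3/4 s1 + N s2 <= (N + 1/4) s]; then
   [s2 <= s1 <= s] yields [(N + 1) s2 <= (N + 1/2) s]. *)
have -> : (1 - (8 * n%:R ^+ 2 + 2)^-1 = (4 * n%:R ^+ 2 + 2^-1) / (4 * n%:R ^+ 2 + 1) :> R)%R.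
  by field; rewrite !gt_eqF// ?ltr_wpDl// ?mulr_ge0 ?sqr_ge0.
rewrite !lee_fin in s0 s10 s20 h1 h2 q0 p0.
set kk := (2 * (M / n%:R) * (2 * a2))%R in kM k0.
have e1 : (2 * (M / n%:R) * s * (2 * a2) = kk * s)%R by rewrite /kk; ring.
have e2 : (2 * (M / n%:R) * s1 * (2 * a2) = kk * s1)%R by rewrite /kk; ring.
rewrite e1 in H1; rewrite e2 in H2.
set N := (4 * n%:R ^+ 2)%R in H1 H2 *.
have N0 : (0 <= N)%R by rewrite /N mulr_ge0// sqr_ge0.
rewrite mulrAC ler_pdivlMr; last by rewrite ltr_wpDl.
have k1 : (kk * s <= 4^-1 * s)%R by apply: ler_wpM2r.
have k2 : (kk * s1 <= 4^-1 * s1)%R by apply: ler_wpM2r.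
lra.
Qed.

End two_steps.
End transfer.

(** * Independent coordinates *)

Definition law (R : realType) d (T : measurableType d) (P : probability T R) (X : T -> R)
    (mX : measurable_fun [set: T] X) : probability (measurableTypeR R) R :=
  distribution P (@mfun_Sub _ _ T (measurableTypeR R) X (mem_set mX)).

Section independence.
Context {R : realType} {d : measure_display} {T : measurableType d}.
Variables (P : probability T R) (X : int -> T -> R).
Hypothesis mX : forall n, measurable_fun [set: T] (X n).
Hypothesis iX : mutually_independent P X.
Local Open Scope ereal_scope.

Definition cylinders_off (j : int) : set (set T) :=
  [set A | exists S B, [/\ uniq S, j \notin S, forall n, measurable (B n) &
    A = \bigcap_(n in [set` S]) (X n @^-1` B n)]].

(* The space [T] with the sigma-algebra generated by the coordinates [X n], [n != j]. *)
Definition others (j : int) := g_sigma_algebraType (cylinders_off j).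

Let mpre n B : measurable B -> measurable (X n @^-1` B).
Proof. by move=> mB; rewrite -[X in measurable X]setTI; exact: mX. Qed.

Let mcyl (S : seq int) (B : int -> set R) : (forall n, measurable (B n)) ->
  measurable (\bigcap_(n in [set` S]) (X n @^-1` B n)).
Proof.
move=> mB; apply: fin_bigcap_measurable => // n _; exact: mpre.
Qed.

Let cyl_measurable j : cylinders_off j `<=` measurable.
Proof. by move=> A [S [B [_ _ mB ->]]]; exact: mcyl. Qed.

Lemma others_measurable j : <<s cylinders_off j >> `<=` measurable.
Proof. by apply: smallest_sub; [exact: sigma_algebra_measurable|exact: cyl_measurable]. Qed.

Let indep (S : seq int) (B : int -> set R) : uniq S -> (forall n, measurable (B n)) ->
  P (\bigcap_(n in [set` S]) (X n @^-1` B n)) = (\prod_(n <- S) fine (P (X n @^-1` B n)))%:E.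
Proof. by move=> uS mB; rewrite -(iX uS mB) fineK// fin_num_measure//; exact: mcyl. Qed.

Lemma indep_cylinder j B A : measurable B -> cylinders_off j A ->
  P (X j @^-1` B `&` A) = P (X j @^-1` B) * P A.
Proof.
move=> mB [S [C [uS jS mC ->]]].
pose C' n := if n == j then B else C n.
have mC' n : measurable (C' n) by rewrite /C'; case: ifP.
have eqS : \bigcap_(n in [set` S]) (X n @^-1` C n) = \bigcap_(n in [set` S]) (X n @^-1` C' n).
  apply: eq_bigcapr => n /= nS; rewrite /C'; case: eqP => // nj.
  by rewrite nj (negbTE jS) in nS.
have -> : X j @^-1` B `&` \bigcap_(n in [set` S]) (X n @^-1` C n) =
    \bigcap_(n in [set` j :: S]) (X n @^-1` C' n).
  rewrite eqS; apply/seteqP; split => t /=.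
    move=> [tB tS] n /=; rewrite inE => /orP[/eqP->|nS]; first by rewrite /C' eqxx.
    exact: tS.
  move=> H; split; first by have := H j (mem_head _ _); rewrite /= /C' eqxx.
  by move=> n /= nS; apply: H => /=; rewrite inE nS orbT.
rewrite indep//; last by rewrite /= jS.
rewrite big_cons EFinM -indep// -eqS /C' eqxx fineK// fin_num_measure//; exact: mpre.
Qed.

Lemma cylinders_offI j : setI_closed (cylinders_off j).
Proof.
move=> A1 A2 [S1 [B1 [u1 j1 m1 ->]]] [S2 [B2 [u2 j2 m2 ->]]].
exists (undup (S1 ++ S2)).
exists (fun n => (if n \in S1 then B1 n else setT) `&` (if n \in S2 then B2 n else setT)).
split.
- exact: undup_uniq.
- by rewrite mem_undup mem_cat negb_or j1.
- by move=> n; apply: measurableI; case: ifP.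
apply/seteqP; split => t /=.
  move=> [H1 H2] n /=; rewrite mem_undup mem_cat => _; split.
    by case: ifP => // nS; exact: H1.
  by case: ifP => // nS; exact: H2.
move=> H; split => n /= nS; have := H n; rewrite /= mem_undup mem_cat nS ?orbT => /(_ isT)[].
  by [].
by [].
Qed.

(** As functions of [A] both sides are finite measures that agree on the cylinders, a family closed
    under intersection that contains the whole space. *)
Lemma indep_others j B A : measurable B -> <<s cylinders_off j >> A ->
  P (X j @^-1` B `&` A) = P (X j @^-1` B) * P A.
Proof.
move=> mB GA.
have mjB := mpre j mB.
have pfin : P (X j @^-1` B) \is a fin_num by rewrite fin_num_measure.
have p0 : (0 <= fine (P (X j @^-1` B)))%R by rewrite fine_ge0.
pose m1 := mrestr P mjB.
pose k : {nonneg R} := NngNum p0.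
pose m2 := mscale k P.
have -> : P (X j @^-1` B `&` A) = m1 A by rewrite /m1 /mrestr setIC.
have -> : P (X j @^-1` B) * P A = m2 A by rewrite /m2 /mscale/= fineK.
have GT : cylinders_off j setT.
  exists [::], (fun=> setT); split => //.
  by apply/seteqP; split => t //= _ n.
apply: (@g_sigma_algebra_measure_unique _ _ _ (cylinders_off j) _ (fun=> setT)) => //.
- by apply/seteqP; split => // t _; exists 0%N.
- exact: cylinders_offI.
- move=> A' cA'; change (P (A' `&` (X j @^-1` B)) = (k%:num)%:E * P A'); rewrite setIC indep_cylinder//= fineK//.
- by move=> _; change (P (setT `&` (X j @^-1` B)) < +oo); rewrite setTI ltey_eq pfin.
Qed.

Let mid j : measurable_fun [set: T] (fun t : T => t : others j).
Proof. by move=> _ Y mY; rewrite setTI; exact: (@others_measurable j Y mY). Qed.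

Let P' j : probability (others j) R := distribution P (mfun_Sub (mem_set (@mid j))).

Let mW j : measurable_fun [set: T] (fun t : T => (X j t, t : others j)).
Proof. by apply: measurable_fun_pair; [exact: mX|exact: mid]. Qed.

Let PW j : probability (measurableTypeR R * others j)%type R :=
  distribution P (@mfun_Sub _ _ T (measurableTypeR R * others j)%type _ (mem_set (@mW j))).

(** The second component is the point [t] itself, seen through the sigma-algebra of the other
    coordinates. By [indep_others] the pair has a product law, so Tonelli replaces [X j t] by an
    integration variable while [t] stays in place. *)
Lemma integral_indep j (F : R * others j -> \bar R) :
  measurable_fun [set: R * others j] F -> (forall z, 0 <= F z) ->
  \int[P]_t F (X j t, t) = \int[P]_t \int[law P (mX j)]_w F (w, t).
Proof.
move=> mF F0.
transitivity (\int[PW j]_z F z).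
  by rewrite /PW /distribution ge0_integral_pushforward.
transitivity (\int[(law P (mX j) \x P' j)%E]_z F z).
  apply: eq_measure_integral => A mA _; apply/esym.
  apply: product_measure_unique => // B1 B2 mB1 mB2.
  rewrite /PW /law /P' /distribution /pushforward/=.
  transitivity (P (X j @^-1` B1 `&` B2)); first by congr (P _).
  by rewrite indep_others.
rewrite fubini_tonelli2//.
rewrite /P' /distribution ge0_integral_pushforward//.
  exact: (measurable_fun_fubini_tonelli_G (m1 := law P (mX j)) _ mF F0).
by move=> t _; apply: integral_ge0.
Qed.

Lemma measurable_others j n : n != j -> measurable_fun [set: others j] (X n : others j -> R).
Proof.
move=> nj _ B mB; rewrite setTI; apply: sub_sigma_algebra.
exists [:: n], (fun=> B); split => //.
  by rewrite inE eq_sym.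
by apply/seteqP; split => t /=; [move=> tB m /=; rewrite inE => /eqP->|apply; rewrite /= inE].
Qed.

End independence.

(** * The Riccati recursion and the decay estimate *)

(* For the solution u of the difference equation at energy [E] that vanishes at
   [j + n], this is [A j.-1 * u (j - 1) / u j]; the recursion starts at the end
   of the box thanks to the convention x / 0 = 0. *)
Fixpoint ric (R : realType) (A V : nat -> R) (E : R) (j n : nat) : R :=
  if n is n'.+1 then E - V j - (A j) ^+ 2 / ric A V E j.+1 n' else 0.

Lemma measurable_ric (R : realType) d (T : measurableType d) (A : nat -> R)
    (V : nat -> T -> R) (E : T -> R) j n :
  measurable_fun [set: T] E -> (forall k, (j <= k)%N -> measurable_fun [set: T] (V k)) ->
  measurable_fun [set: T] (fun t => ric A (V ^~ t) (E t) j n).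
Proof.
move=> mE; elim: n j => [|n IH] j mV //=.
apply: measurable_funB; first by apply: measurable_funB => //; exact: mV.
apply: measurable_funM => //; apply: measurable_funV; apply: IH => k jk.
by apply: mV; exact: ltnW.
Qed.

Section chain.
Context {R : realType} {d : measure_display} {T : measurableType d}.
Variables (P : probability T R) (X : int -> T -> R).
Hypothesis mX : forall n, measurable_fun [set: T] (X n).
Hypothesis iX : mutually_independent P X.
Variables (A : nat -> R) (E M : R).
Hypothesis A0 : forall j, 0 < A j.
Hypothesis M0 : 0 <= M.
Notation mu := (@lebesgue_measure R).
Local Open Scope ereal_scope.

(** Site [k] is the [k]-th to be integrated out after site 0: the function travels outwards, against
    the direction of the Riccati recursion. *)
Fixpoint iter_transfer (k : nat) (g : R -> R) : R -> R :=
  if k is k'.+1 then transfer (law P (mX k)) (A k') E (iter_transfer k' g) else g.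

Variable m : nat.
Hypothesis dom : forall j : nat, (j <= m)%N ->
  forall B : set R, measurable B -> law P (mX j) B <= M%:E * mu B.

Lemma iter_transfer_ge0 k g x : (forall x, 0 <= g x)%R -> (0 <= iter_transfer k g x)%R.
Proof. by move=> g0; elim: k x => [|k IH] x //=; exact: transfer_ge0. Qed.

Lemma measurable_iter_transfer d' (T' : measurableType d') (g : T' -> R -> R) k :
  (forall t x, 0 <= g t x)%R ->
  measurable_fun [set: T' * R] (fun p => g p.1 p.2) ->
  measurable_fun [set: T' * R] (fun p => iter_transfer k (g p.1) p.2).
Proof.
move=> g0 mg; elim: k => [//|k IH] /=.
apply: (@measurable_transfer _ _ _ _ _ _ (fun t => iter_transfer k (g t))) => // t x.
exact: iter_transfer_ge0.
Qed.

Section fixed.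
Variable g : R -> R.
Hypothesis mg : measurable_fun [set: R] g.
Hypothesis g0 : forall x, (0 <= g x)%R.
Hypothesis gfin : sqn g < +oo.

Lemma measurable_iter_transfer1 k : measurable_fun [set: R] (iter_transfer k g).
Proof.
elim: k => [//|k IH] /=; apply: measurable_transfer1 => // x.
exact: iter_transfer_ge0.
Qed.

Lemma sqn_iter_transfer_fin k : (k <= m)%N -> sqn (iter_transfer k g) < +oo.
Proof.
elim: k => [//|k IH] /= km; have IH' := IH (ltnW km).
apply: le_lt_trans IH'; apply: (sqn_transfer M0 (dom km)) => //.
- exact: measurable_iter_transfer1.
- by move=> x; exact: iter_transfer_ge0.
- exact: IH (ltnW km).
Qed.

(** Only pairs of consecutive operators contract, hence [k./2]; a single leftover operator does not
    expand. *)
Lemma sqn_iter_transfer n k : (0 < n)%N ->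
  (forall j, (j <= m)%N -> 16 * (A j * M) <= n%:R)%R -> (k <= m)%N ->
  sqn (iter_transfer k g) <= ((1 - (8 * n%:R ^+ 2 + 2)^-1) ^+ k./2)%:E * sqn g.
Proof.
move=> n0 nM.
have th0 : (0 <= 1 - (8 * n%:R ^+ 2 + 2)^-1 :> R)%R.
  rewrite subr_ge0 invf_le1; last by rewrite ltr_wpDl// mulr_ge0 ?sqr_ge0.
  by have := sqr_ge0 (n%:R : R); lra.
have [p] := ubnP k; elim: p k => // p IH [|[|k]] kp km.
- by rewrite expr0 mul1e.
- rewrite expr0 mul1e /=; exact: (sqn_transfer M0 (dom km)).
have km1 : (k.+1 <= m)%N by exact: ltnW.
have km' : (k <= m)%N by exact: ltnW.
have ite x : (0 <= iter_transfer k g x)%R by exact: iter_transfer_ge0.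
apply: (@le_trans _ _ ((1 - (8 * n%:R ^+ 2 + 2)^-1)%:E * sqn (iter_transfer k g))).
  apply: (sqn_transfer2 M0 (dom km1) (dom km)) => //.
  - exact: measurable_iter_transfer1.
  - exact: sqn_iter_transfer_fin.
  - exact: nM.
rewrite -[k.+2./2]/(k./2.+1) (exprS _ k./2) EFinM -muleA; apply: lee_wpmul2l; first by rewrite lee_fin.
by apply: IH => //; exact: ltnW.
Qed.

(** The last operator is spent on passing from L^2 to a pointwise bound, at the price of a factor
    [M], because the result gets evaluated at a random point. *)
Lemma iter_transfer_sqr_le n k x : (0 < n)%N ->
  (forall j, (j <= m)%N -> 16 * (A j * M) <= n%:R)%R -> (k < m)%N ->
  ((iter_transfer k.+1 g x) ^+ 2)%:E <=
    M%:E * (((1 - (8 * n%:R ^+ 2 + 2)^-1) ^+ k./2)%:E * sqn g).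
Proof.
move=> n0 nM km.
apply: (@le_trans _ _ (M%:E * sqn (iter_transfer k g))).
  apply: (transfer_sqr_le M0 (dom km)) => //.
  - exact: measurable_iter_transfer1.
  - by move=> y; exact: iter_transfer_ge0.
  - by apply: sqn_iter_transfer_fin; exact: ltnW.
apply: lee_wpmul2l; first by rewrite lee_fin.
by apply: sqn_iter_transfer => //; exact: ltnW.
Qed.

End fixed.

Variables (L : nat) (mL : (m <= L)%N).
Variable s : T -> R.
Hypothesis ms : forall j : nat, measurable_fun [set: others X j] (s : others X j -> R).

Definition yy (j : nat) (t : T) : R := ric A (fun k => X k%:Z t) E j (L.+1 - j).

(** Telescopes to [|u m / u k|]: for the solution [u] vanishing at [L.+1], when it has no other zero
    in the range, [A j / yy j.+1] is [u j.+1 / u j]. *)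
Definition ratio_prod (k : nat) (t : T) : R := (\prod_(k <= j < m) (A j / `|yy j.+1 t|))%R.

Let mthers (j k : nat) : (j < k)%N -> measurable_fun [set: others X j] (X k : others X j -> R).
Proof.
by move=> jk; apply: measurable_others; rewrite eqz_nat gtn_eqF.
Qed.

Let myy (j k : nat) : (j < k)%N -> measurable_fun [set: others X j] (yy k : others X j -> R).
Proof.
move=> jk; apply: (@measurable_ric R _ (others X j) A (fun k => X k) (cst E)) => //.
by move=> i ki; apply: mthers; exact: leq_trans ki.
Qed.

Lemma measurable_ratio_prod (j k : nat) : (j <= k)%N -> measurable_fun [set: others X j] (ratio_prod k : others X j -> R).
Proof.
move=> jk; rewrite /ratio_prod.
have [km|km] := leqP k m; last first.
  by rewrite (_ : (fun t => _) = cst 1%R) //; apply/funext => t; rewrite big_geq// ltnW.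
suff H : forall r : seq nat, all (fun i => (k <= i)%N) r ->
    measurable_fun [set: others X j] (fun t : others X j => (\prod_(i <- r) (A i / `|yy i.+1 t|))%R).
  by apply: H; apply/allP => i; rewrite mem_index_iota => /andP[].
elim=> [|i r IH] /=.
  by move=> _; rewrite (_ : (fun t => _) = cst 1%R) //; apply/funext => t; rewrite big_nil.
move=> /andP[ki ar].
rewrite (_ : (fun t => _) = (fun t => (A i / `|yy i.+1 t|) * (\prod_(i <- r) (A i / `|yy i.+1 t|)))%R); last first.
  by apply/funext => t; rewrite big_cons.
apply: measurable_funM; last exact: IH.
apply: measurable_funM => //; apply: measurable_funV; apply: measurableT_comp => //.
by apply: myy; rewrite ltnS (leq_trans jk).
Qed.

Lemma ratio_prod_ge0 k t : (0 <= ratio_prod k t)%R.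
Proof. by apply: prodr_ge0 => i _; rewrite divr_ge0// ltW. Qed.

Lemma yyE k t : (k < m)%N -> yy k.+1 t = (E - X k.+1%:Z t - (A k.+1) ^+ 2 / yy k.+2 t)%R.
Proof.
move=> km; rewrite /yy.
have -> : (L.+1 - k.+1 = (L.+1 - k.+2).+1)%N.
  by rewrite subSS subnSK//; exact: leq_trans km mL.
by [].
Qed.

(** Here [X k.+1] enters only through [yy k.+1], and affinely. The factor [A k / |yy k.+1|] split
    off from [ratio_prod] is the one in [inv_density]; everything else, [s] included, is a function
    of the other coordinates, so [integral_indep] averages over [X k.+1]. *)
Lemma chain_step (g : R -> R -> R) k : (k < m)%N ->
  (forall t x, 0 <= g t x)%R -> measurable_fun [set: R * R] (fun p => g p.1 p.2) ->
  (forall t, sqn (g t) < +oo) ->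
  \int[P]_t (g (s t) ((A k) ^+ 2 / yy k.+1 t) * ratio_prod k t)%:E =
  \int[P]_t (transfer (law P (mX k.+1)) (A k) E (g (s t)) ((A k.+1) ^+ 2 / yy k.+2 t)
     * ratio_prod k.+1 t)%:E.
Proof.
move=> km g0 mg gfin.
pose x t := ((A k.+1) ^+ 2 / yy k.+2 t)%R.
pose F (z : R * others X k.+1) :=
  (inv_density (A k) (g (s z.2)) (E - z.1 - x z.2) * ratio_prod k.+1 z.2)%:E.
transitivity (\int[P]_t F (X k.+1%:Z t, t)).
  apply: eq_integral => t _; rewrite /F /= /x -yyE//.
  rewrite {1}/ratio_prod big_ltn// /inv_density -/(ratio_prod k.+1 t).
  by congr EFin; ring.
have mx : measurable_fun [set: others X k.+1] (x : others X k.+1 -> R).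
  by apply: measurable_funM => //; apply: measurable_funV; exact: myy.
have msnd d' (U : measurableType d') (f : others X k.+1 -> U) : measurable_fun [set: others X k.+1] f ->
   measurable_fun [set: R * others X k.+1] (fun z => f z.2).
  by move=> mf; exact: measurableT_comp.
have mi : measurable_fun [set: R * others X k.+1]
    (fun z => inv_density (A k) (g (s z.2)) (E - z.1 - x z.2)%R).
  apply: (@measurable_inv_density _ _ (R * others X k.+1)%type (A k) (fun z => g (s z.2))
    (fun z => E - z.1 - x z.2)%R).
    apply: (measurableT_comp mg (f := fun p => g p.1 p.2)
      (g := fun q : (R * others X k.+1) * R => (s q.1.2, q.2))).
    apply: measurable_fun_pair => //.
    apply: (measurableT_comp (msnd _ _ _ (@ms k.+1)) (f := fun z : R * others X k.+1 => s z.2)).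
    exact: measurable_fst.
  apply: measurable_funB; first exact: measurable_funB.
  exact: (msnd _ _ _ mx).
have mF : measurable_fun [set: R * others X k.+1] F.
  by apply/measurable_EFinP/measurable_funM => //; apply: msnd; exact: measurable_ratio_prod.
have F0 z : 0 <= F z by rewrite lee_fin mulr_ge0 ?inv_density_ge0 ?ratio_prod_ge0.
rewrite (@integral_indep _ _ _ P X mX iX k.+1%:Z F mF F0).
apply: eq_integral => t _.
rewrite /F /= EFinM.
transitivity (\int[law P (mX k.+1)]_w ((ratio_prod k.+1 t)%:E *
    (inv_density (A k) (g (s t)) (E - w - x t))%:E)).
  by apply: eq_integral => w _; rewrite -EFinM mulrC.
have mgt : measurable_fun [set: R] (g (s t)).
  exact: (measurableT_comp (f := fun p => g p.1 p.2) mg (pair1_measurable (s t))).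
have mid : measurable_fun [set: R] (inv_density (A k) (g (s t))) by exact: measurable_inv_density1.
rewrite ge0_integralZl_EFin//; last 3 first.
- by move=> w _; rewrite lee_fin inv_density_ge0.
- apply/measurable_EFinP; apply: (measurableT_comp mid).
  by apply: measurable_funB => //; exact: measurable_funB.
- exact: ratio_prod_ge0.
rewrite muleC; congr (_ * _); rewrite /transfer (avgE M0 (dom km))//.
- by move=> w; exact: inv_density_ge0.
- by rewrite sqn_inv_density.
Qed.

Lemma chain_eq (g : R -> R -> R) k : (k <= m)%N ->
  (forall t x, 0 <= g t x)%R -> measurable_fun [set: R * R] (fun p => g p.1 p.2) ->
  (forall t, sqn (g t) < +oo) ->
  \int[P]_t (g (s t) ((A 0) ^+ 2 / yy 1 t) * ratio_prod 0 t)%:E =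
  \int[P]_t (iter_transfer k (g (s t)) ((A k) ^+ 2 / yy k.+1 t) * ratio_prod k t)%:E.
Proof.
move=> + g0 mg gfin; elim: k => [//|k IH] km.
rewrite IH ?(ltnW km)// (@chain_step (fun t => iter_transfer k (g t)))//.
- by move=> t x; exact: iter_transfer_ge0.
- exact: measurable_iter_transfer.
- move=> t; apply: sqn_iter_transfer_fin => //; last exact: ltnW.
  exact: (measurableT_comp (f := fun p => g p.1 p.2) mg (pair1_measurable t)).
Qed.

End chain.

Section smoothing.
Context {R : realType}.
Notation mu := (@lebesgue_measure R).
Local Open Scope ereal_scope.
Variables (nu : probability (measurableTypeR R) R) (M : R).
Hypothesis M0 : (0 <= M)%R.
Hypothesis dom : forall B : set R, measurable B -> nu B <= M%:E * mu B.
Variable k : R -> R.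
Hypothesis mk : measurable_fun [set: R] k.
Hypothesis k0 : forall x, (0 <= k x)%R.
Hypothesis k1 : \int[mu]_x (k x)%:E = 1.
Hypothesis kfin : sqn k < +oo.

Lemma integral_affineN (E : R) : \int[mu]_w (k (E - w))%:E = 1.
Proof.
rewrite -k1; have := @ge0_integral_affine R (-1)%R E (fun x => (k x)%:E).
rewrite normrN normr1 invr1 mul1e => <-.
- by apply: eq_integral => w _; congr ((k _)%:E); ring.
- by rewrite oppr_eq0 oner_eq0.
- exact/measurable_EFinP.
- by move=> x; rewrite lee_fin.
Qed.

Let mkE (E : R) : measurable_fun [set: R * R] (fun z : R * R => (k (E - z.2 - z.1))%:E).
Proof.
apply/measurable_EFinP; apply: (measurableT_comp mk).
by apply: measurable_funB => //; exact: measurable_funB.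
Qed.

Lemma avg_le (E x : R) : (avg nu E k x <= M)%R.
Proof.
rewrite -lee_fin (avgE M0 dom)//.
apply: le_trans (dom_integral M0 dom _ _) _.
- apply/measurable_EFinP; apply: (measurableT_comp mk).
  by apply: measurable_funB => //; exact: measurable_funB.
- by move=> w; rewrite lee_fin.
have := integral_affineN (E - x)%R.
under eq_integral do rewrite addrAC.
by move=> ->; rewrite mule1.
Qed.

Lemma integral_avg (E : R) : \int[mu]_x (avg nu E k x)%:E = 1.
Proof.
transitivity (\int[mu]_x \int[nu]_w (k (E - w - x)%R)%:E).
  by apply: eq_integral => x _; rewrite (avgE M0 dom).
rewrite (@fubini_tonelli _ _ _ _ _ mu nu (fun z => (k (E - z.2 - z.1)%R)%:E))//.
  transitivity (\int[nu]_w (1 : \bar R)); last by rewrite prob_integral_cst.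
  by apply: eq_integral => w _; rewrite /= integral_affineN.
  exact: mkE.
by move=> z; rewrite lee_fin.
Qed.

(** The averaged function has integral 1 and is at most [M] pointwise. The bound is the same for
    every [k], so the width of the window disappears from the estimates. *)
Lemma sqn_avg_le (E : R) : sqn (avg nu E k) <= M%:E.
Proof.
have mav : measurable_fun [set: R] (avg nu E k) by exact: measurable_avg.
have av0 x : (0 <= avg nu E k x)%R by exact: avg_ge0.
apply: (@le_trans _ _ (\int[mu]_x (M%:E * (avg nu E k x)%:E))).
  apply: ge0_le_integral => //.
  - by move=> x _; rewrite lee_fin sqr_ge0.
  - exact/measurable_EFinP/measurable_funX.
  - by apply: measurable_funeM; exact/measurable_EFinP.
  - by move=> x _; rewrite -EFinM lee_fin expr2 ler_wpM2r// avg_le.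
rewrite ge0_integralZl_EFin//.
- by rewrite integral_avg mule1.
- by move=> x _; rewrite lee_fin.
- exact/measurable_EFinP.
Qed.

End smoothing.

Section window.
Context {R : realType}.
Notation mu := (@lebesgue_measure R).
Variable e : R.
Hypothesis e0 : 0 < e.
Local Open Scope ereal_scope.

Definition window (u : R) : R := ((2 * e)^-1 * (Num.norm u < e)%R%:R)%R.

Lemma window_ge0 u : (0 <= window u)%R.
Proof. by rewrite mulr_ge0// invr_ge0 mulr_ge0// ltW. Qed.

Lemma windowE : window = (fun u => (2 * e)^-1 * \1_(`](- e)%R, e[%classic) u)%R.
Proof.
apply/funext => u; rewrite /window indicE; congr (_ * (nat_of_bool _)%:R)%R.
rewrite ltr_norml; apply/idP/idP => [h|/set_mem]; last by rewrite /= in_itv.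
by apply/mem_set; rewrite /= in_itv.
Qed.

Lemma measurable_window : measurable_fun [set: R] window.
Proof. by rewrite windowE; apply: measurable_funM => //; exact: measurable_indic. Qed.

Lemma integral_window : \int[mu]_x (window x)%:E = 1.
Proof.
rewrite windowE; under eq_integral do rewrite EFinM.
rewrite ge0_integralZl_EFin//.
- have -> : \int[mu]_x (\1_(`](- e)%R, e[%classic) x)%:E = mu `](- e)%R, e[%classic.
    by rewrite integral_indic ?setIT//; exact: measurable_itv.
  rewrite lebesgue_measure_itv/= lte_fin ifT; last first.
    by rewrite -subr_gt0 opprK addr_gt0.
  by rewrite -EFinB -EFinM; congr EFin; field; rewrite gt_eqF.
- exact/measurable_EFinP/measurable_indic.
- by rewrite invr_ge0 mulr_ge0// ltW.
Qed.

Lemma sqn_window : sqn window < +oo.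
Proof.
have H x : (window x ^+ 2 = (2 * e)^-1 * window x)%R.
  by rewrite /window; case: ltP => _; rewrite ?mulr0 ?expr0n//= !mulr1.
rewrite /sqn; under eq_integral do rewrite H EFinM.
rewrite ge0_integralZl_EFin//.
- by rewrite integral_window mule1 ltry.
- by move=> x _; rewrite lee_fin window_ge0.
- by apply/measurable_EFinP; exact: measurable_window.
- by rewrite invr_ge0 mulr_ge0// ltW.
Qed.

End window.

Section estimate.
Context {R : realType} {d : measure_display} {T : measurableType d}.
Variables (P : probability T R) (X : int -> T -> R).
Hypothesis mX : forall n, measurable_fun [set: T] (X n).
Hypothesis iX : mutually_independent P X.
Variables (A : nat -> R) (E M : R).
Hypothesis A0 : forall j, 0 < A j.
Hypothesis M0 : 0 <= M.
Notation mu := (@lebesgue_measure R).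
Local Open Scope ereal_scope.
Variable m : nat.
Hypothesis dom : forall j : nat, (j <= m)%N ->
  forall B : set R, measurable B -> law P (mX j) B <= M%:E * mu B.
Variables (L : nat) (mL : (m <= L)%N) (m0 : (0 < m)%N).
Variable s : T -> R.
Hypothesis ms : forall j : nat, measurable_fun [set: others X j] (s : others X j -> R).
Variable e : R.
Hypothesis e0 : (0 < e)%R.

(** Integrating [X 0] first turns the window into a function of squared norm at most [M]. The last
    site gives a second factor [M] through the pointwise bound, and the [m.-1] sites between them
    contract. The bound is uniform in [E], [e], [L] and in [s], which stands for the opposite
    half-line. *)
Theorem decay_estimate n (b : R) : (0 < n)%N ->
  (forall j, (j <= m)%N -> 16 * (A j * M) <= n%:R)%R -> (0 <= b)%R ->
  (M ^+ 2 * (1 - (8 * n%:R ^+ 2 + 2)^-1) ^+ m.-1./2 <= b ^+ 2)%R ->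
  \int[P]_t (window e (E - (A 0) ^+ 2 / yy X A E L 1 t - s t - X (Posz 0) t)
     * ratio_prod X A E m L 0 t)%:E <= b%:E.
Proof.
move=> n0 nM b0 hb.
have mw := measurable_window e.
have w0 := window_ge0 e0.
have w1 := integral_window e0.
have wfin := sqn_window e0.
pose g (u x : R) := avg (law P (mX (Posz 0))) (E - u) (window e) x.
have g0 u x : (0 <= g u x)%R by exact: avg_ge0.
have mg : measurable_fun [set: R * R] (fun p => g p.1 p.2).
  apply: measurableT_comp => //=.
  apply: (measurable_fun_fubini_tonelli_F (m2 := law P (mX (Posz 0)))
    (fun q : (R * R) * R => (window e (E - q.1.1 - q.2 - q.1.2)%R)%:E)); last first.
    by move=> q; rewrite lee_fin.
  apply/measurable_EFinP; apply: (measurableT_comp mw).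
  apply: measurable_funB; last exact: measurableT_comp.
  apply: measurable_funB => //; apply: measurable_funB => //.
  exact: measurableT_comp.
have gM u : sqn (g u) <= M%:E by exact: (sqn_avg_le M0 (dom (leq0n m))).
have gfin u : sqn (g u) < +oo by apply: le_lt_trans (gM u) _; rewrite ltry.
pose x t := ((A 0) ^+ 2 / yy X A E L 1 t)%R.
pose F (z : R * others X (Posz 0)) :=
  (window e (E - x z.2 - s z.2 - z.1) * ratio_prod X A E m L 0 z.2)%:E.
have mthers (k : nat) : (0 < k)%N -> measurable_fun [set: others X (Posz 0)] (X k : others X (Posz 0) -> R).
  by move=> jk; apply: measurable_others; rewrite eqz_nat gtn_eqF.
have myy (k : nat) : (0 < k)%N -> measurable_fun [set: others X (Posz 0)] (yy X A E L k : others X (Posz 0) -> R).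
  move=> jk; apply: (@measurable_ric R _ (others X (Posz 0)) A (fun k => X k) (cst E)) => //.
  by move=> i ki; apply: mthers; exact: leq_trans ki.
have mx : measurable_fun [set: others X (Posz 0)] (x : others X (Posz 0) -> R).
  by apply: measurable_funM => //; apply: measurable_funV; exact: myy.
have msnd d' (U : measurableType d') (f : others X (Posz 0) -> U) : measurable_fun [set: others X (Posz 0)] f ->
   measurable_fun [set: R * others X (Posz 0)] (fun z => f z.2).
  by move=> mf; exact: measurableT_comp.
have mF : measurable_fun [set: R * others X (Posz 0)] F.
  apply/measurable_EFinP/measurable_funM; last by apply: msnd; exact: measurable_ratio_prod.
  apply: (measurableT_comp mw); apply: measurable_funB => //.
  apply: measurable_funB; last first.
    exact: (msnd _ _ _ (@ms 0%N)).
  by apply: measurable_funB => //; exact: (msnd _ _ _ mx).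
have F0 z : 0 <= F z by rewrite lee_fin mulr_ge0 ?ratio_prod_ge0.
rewrite (@integral_indep _ _ _ P X mX iX (Posz 0) F mF F0).
rewrite (_ : (fun t => _) = (fun t => (g (s t) (x t) * ratio_prod X A E m L 0 t)%:E)); last first.
  apply/funext => t.
  transitivity (\int[law P (mX (Posz 0))]_w ((ratio_prod X A E m L 0 t)%:E *
      (window e (E - s t - w - x t))%:E)).
    by apply: eq_integral => w _; rewrite -EFinM [in RHS]mulrC /F /=; congr ((window e _ * _)%:E); ring.
  rewrite ge0_integralZl_EFin//.
  - by rewrite EFinM muleC (avgE M0 (dom (leq0n m))).
  - by move=> w _; rewrite lee_fin.
  - apply/measurable_EFinP; apply: (measurableT_comp mw).
    by apply: measurable_funB => //; exact: measurable_funB.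
  - exact: ratio_prod_ge0.
rewrite (chain_eq iX E A0 M0 dom mL ms (leqnn m) g0 mg gfin).
have kt t y : (iter_transfer P mX A E m (g (s t)) y <= b)%R.
  rewrite -(prednK m0) -(ler_pXn2r (n := 2))// ?nnegrE//; last first.
    exact: iter_transfer_ge0.
  rewrite -lee_fin.
  apply: le_trans (iter_transfer_sqr_le E A0 M0 dom _ (g0 (s t)) (gfin (s t)) y n0 nM _) _.
  - exact: (measurableT_comp (f := fun p => g p.1 p.2) mg (pair1_measurable (s t))).
  - by rewrite prednK.
  apply: (@le_trans _ _ (M%:E * (((1 - (8 * n%:R ^+ 2 + 2)^-1) ^+ m.-1./2)%:E * M%:E))).
    apply: lee_wpmul2l; first by rewrite lee_fin.
    apply: lee_wpmul2l => //; rewrite lee_fin exprn_ge0// subr_ge0 invf_le1; last first.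
      by rewrite ltr_wpDl// mulr_ge0 ?sqr_ge0.
    by have := sqr_ge0 (n%:R : R); lra.
  by rewrite -!EFinM lee_fin; apply: le_trans hb; rewrite expr2 mulrCA mulrC mulrA.
rewrite (_ : b%:E = \int[P]_t b%:E); last first.
  by rewrite (integral_cst P measurableT) -[LHS]mule1; congr (_ * _); rewrite -(probability_setT P).
have msT : measurable_fun [set: T] s.
  by move=> _ Y mY; apply: (others_measurable mX (j := Posz 0)); exact: (@ms 0%N).
have myT k : measurable_fun [set: T] (yy X A E L k).
  by apply: (@measurable_ric R _ T A (fun k => X k) (cst E)).
have mrT : measurable_fun [set: T] (ratio_prod X A E m L m).
  rewrite (_ : ratio_prod X A E m L m = cst 1%R)//.
  by apply/funext => t; rewrite /ratio_prod big_geq.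
apply: ge0_le_integral => //.
- by move=> t _; rewrite lee_fin mulr_ge0 ?ratio_prod_ge0// iter_transfer_ge0.
- apply/measurable_EFinP/measurable_funM => //.
  have mit := measurable_iter_transfer P mX E A0 m g0 mg.
  apply: (measurableT_comp (f := fun p : R * R => iter_transfer P mX A E m (g p.1) p.2)
    (g := fun t => (s t, A m ^+ 2 / yy X A E L m.+1 t)%R) mit).
  apply: measurable_fun_pair => //; apply: measurable_funM => //.
  exact: measurable_funV.
- by move=> t _; rewrite lee_fin /ratio_prod big_geq// mulr1.
Qed.

End estimate.

(** * Jacobi matrices on finite boxes *)

Section jacobi_spectral.
Context {R : realType}.
Variables (al b : nat -> R) (N : nat).
Hypothesis al0 : forall j, 0 < al j.
Local Notation C := R[i].
Local Open Scope complex_scope.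

Let Hn (i j : nat) : R :=
  (i == j)%:R * b j + (j == i.+1)%:R * al i + (i == j.+1)%:R * al j.
Let H : 'M[C]_N := \matrix_(i, j) (Hn i j)%:C.

Let HnC i j : Hn i j = Hn j i.
Proof.
rewrite /Hn (eq_sym j i); have [->|ij] := eqVneq i j; first by ring.
by rewrite !mul0r; ring.
Qed.

Let Hherm : H \is hermsymmx.
Proof.
apply: realsym_hermsym.
  apply/is_hermitianmxP; rewrite expr0 scale1r; apply/matrixP => i j.
  by rewrite !mxE /= HnC.
by apply/mxOverP => i j; rewrite mxE complex_real.
Qed.

Let P := spectralmx H.
Let D := spectral_diag H.
Let lam (k : 'I_N) : R := complex.Re (D 0 k).

Let lamE k : D 0 k = (lam k)%:C.
Proof.
by have /mxOverP/(_ 0 k) := hermitian_spectral_diag_real Hherm => h; rewrite /lam RRe_real.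
Qed.

Let PP : P *m (P ^t*)%sesqui = 1%:M.
Proof. by have /unitarymxP := spectral_unitarymx H. Qed.

Let PH : P *m H = diag_mx D *m P.
Proof.
have h : H = invmx P *m diag_mx D *m P by apply/orthomx_spectralP; exact: hermitian_normalmx.
rewrite [X in P *m X]h.
by rewrite !mulmxA mulmxV ?mul1mx// spectral_unit.
Qed.

Let v (k : 'I_N) (j : nat) : C := if insub j is Some i then P k i else 0.

Let vE k (i : 'I_N) : v k i = P k i.
Proof. by rewrite /v valK. Qed.

Let v0 k j : (N <= j)%N -> v k j = 0.
Proof. by move=> Nj; rewrite /v insubF// ltnNge Nj. Qed.

Let vpred k j : C := if j is j'.+1 then (al j')%:C * v k j' else 0.

Let pick_sum (F : nat -> C) (j : nat) :
  \sum_(i < N) F i * (nat_of_ord i == j)%:R = if (j < N)%N then F j else 0.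
Proof.
case: ifPn => jN; last first.
  rewrite big1// => i _; rewrite (_ : (_ == _) = false) ?mulr0//.
  by apply/negbTE; apply: contra jN => /eqP <-.
rewrite (bigD1 (Ordinal jN))//= eqxx mulr1 big1 ?addr0// => i ij.
by rewrite (_ : (_ == _) = false) ?mulr0//; apply/negbTE.
Qed.

Let veq k j : (j < N)%N ->
  (al j)%:C * v k j.+1 + vpred k j + (b j)%:C * v k j = (lam k)%:C * v k j.
Proof.
move=> jN; have /matrixP/(_ k (Ordinal jN)) := PH.
rewrite !mxE.
have -> : \sum_j0 P k j0 * H j0 (Ordinal jN) =
   \sum_(i < N) ((b j)%:C * v k i) * (nat_of_ord i == j)%:R
   + \sum_(i < N) (al i)%:C * v k i * (j == i.+1)%:R
   + \sum_(i < N) ((al j)%:C * v k i) * (nat_of_ord i == j.+1)%:R.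
  rewrite -!big_split/=; apply: eq_bigr => i _; rewrite mxE -vE /Hn /=.
  by rewrite !rmorphD !rmorphM !rmorph_nat; ring.
rewrite (pick_sum (fun i => (b j)%:C * v k i)) (pick_sum (fun i => (al j)%:C * v k i)) jN.
have -> : \sum_(i < N) (al i)%:C * v k i * (j == i.+1)%:R = vpred k j.
  rewrite /vpred; case: j jN => [|j] jN.
    by rewrite big1// => i _; rewrite mulr0.
  have := pick_sum (fun i => (al i)%:C * v k i) j; rewrite (ltnW jN) => <-.
  by apply: eq_bigr => i _; rewrite eqSS eq_sym.
have -> : (if (j.+1 < N)%N then (al j)%:C * v k j.+1 else 0) = (al j)%:C * v k j.+1.
  by case: ltnP => // Nj; rewrite v0// mulr0.
rewrite (bigD1 k)//= big1 ?addr0; last first.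
  by move=> i ik; rewrite mxE eq_sym (negbTE ik) mulr0n mul0r.
rewrite mxE eqxx mulr1n lamE -vE /= => <-; ring.
Qed.

(** The orthogonal polynomials of the Jacobi matrix, evaluated at [l]. *)
Let q (l : R) : nat -> R := fix q (j : nat) :=
  match j with
  | 0 => 1
  | j'.+1 => (match j' with
              | 0 => (l - b 0) / al 0
              | j''.+1 => ((l - b j') * q j' - al j'' * q j'') / al j'
              end)
  end.

Let qpred l j : R := if j is j'.+1 then al j' * q l j' else 0.

Let qS l j : al j * q l j.+1 = (l - b j) * q l j - qpred l j.
Proof.
have a0 : al j != 0 by rewrite gt_eqF.
by case: j a0 => [|j] a0 /=; [rewrite mulr1 subr0|]; rewrite mulrCA divff// mulr1.
Qed.

(* The eigenvector equation determines v from its first entry through real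
   coefficients, so a complex eigenbasis can be rotated into a real one. *)
Let vq k j : (j < N)%N -> v k j = v k 0 * (q (lam k) j)%:C.
Proof.
have [p] := ubnP j; elim: p j => // p IH [|j] jp jN; first by rewrite mulr1.
have a0 : (al j)%:C != 0 by rewrite fmorph_eq0 gt_eqF.
apply: (mulfI a0).
have jN' := ltnW jN.
have -> : (al j)%:C * v k j.+1 = (lam k)%:C * v k j - (b j)%:C * v k j - vpred k j.
  by rewrite -(veq k jN'); ring.
rewrite mulrCA -rmorphM qS rmorphB rmorphM rmorphB IH//.
have -> : vpred k j = v k 0 * (qpred (lam k) j)%:C.
  rewrite /vpred /qpred; case: j jp jN jN' {a0} => [|j] jp jN jN'; first by rewrite mulr0.
  by rewrite IH ?(ltnW jN')// 1?ltnW// rmorphM; ring.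
ring.
Qed.

Let c k : R := Num.sqrt (complex.Re (v k 0) ^+ 2 + complex.Im (v k 0) ^+ 2).

Let c2 k : (c k ^+ 2)%:C = v k 0 * Num.conj (v k 0).
Proof.
by rewrite /c sqr_sqrtr ?addr_ge0 ?sqr_ge0// add_Re2_Im2 normCK.
Qed.

Let c_eq0 k : v k 0 = 0 -> c k = 0.
Proof. by move=> h; rewrite /c h /= expr0n addr0 sqrtr0. Qed.

Let q' l j := if (j < N)%N then q l j else 0.

Let phi k j := c k * q' (lam k) j.

Let vq' k j : v k j = v k 0 * (q' (lam k) j)%:C.
Proof.
rewrite /q'; case: ltnP => jN; first exact: vq.
by rewrite v0// mulr0.
Qed.

Let phi_complete i j : (i < N)%N -> (j < N)%N ->
  \sum_(k < N) phi k i * phi k j = (i == j)%:R.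
Proof.
move=> iN jN.
have /matrixP/(_ (Ordinal jN) (Ordinal iN)) := mulmx1C PP.
rewrite !mxE => PPij.
apply: (@complexI R).
rewrite rmorph_sum rmorph_nat.
rewrite (_ : i == j = (Ordinal jN == Ordinal iN)); last by rewrite eq_sym.
rewrite -PPij; apply: eq_bigr => k _.
rewrite !mxE -[P k _]vE -[P k (Ordinal iN)]vE /= [v k i]vq' [v k j]vq'.
rewrite /phi rmorphM !rmorphM /=.
have := c2 k; rewrite rmorphXn expr2 => c2k.
rewrite [Num.conj (_%:C)]conj_Creal; last by rewrite complex_real.
transitivity ((c k)%:C * (c k)%:C * (q' (lam k) i)%:C * (q' (lam k) j)%:C); first by ring.
by rewrite c2k; ring.
Qed.

(** Replacing the first entry [v k 0] by its modulus [c k] keeps all products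
    [v k i * conj (v k j)], hence the completeness relation of the unitary eigenbasis.
    Orthonormality follows because a left inverse of a square matrix is a right inverse. *)
Lemma jacobi_spectral : exists (lam : 'I_N -> R) (phi : 'I_N -> nat -> R),
  [/\ forall k j, (N <= j)%N -> phi k j = 0,
     forall k j, (j < N)%N -> al j * phi k j.+1 +
       (if j is j'.+1 then al j' * phi k j' else 0) + b j * phi k j = lam k * phi k j,
     forall i j, (i < N)%N -> (j < N)%N -> \sum_(k < N) phi k i * phi k j = (i == j)%:R &
     forall k l, \sum_(j < N) phi k j * phi l j = (k == l)%:R].
Proof.
exists lam, phi; split.
- by move=> k j Nj; rewrite /phi /q' ltnNge Nj mulr0.
- move=> k j jN; have := veq k jN.
  have -> : vpred k j = v k 0 * (if j is j'.+1 then al j' * q' (lam k) j' else 0)%:C.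
    by rewrite /vpred; case: (j) => [|j']; rewrite ?mulr0// vq' rmorphM; ring.
  rewrite [v k j.+1]vq' [v k j]vq' => E.
  have {}E : v k 0 * (al j * q' (lam k) j.+1 + (if j is j'.+1 then al j' * q' (lam k) j' else 0)
      + b j * q' (lam k) j - lam k * q' (lam k) j)%:C = 0.
    by rewrite rmorphB !rmorphD !rmorphM; apply/eqP; rewrite mulrBr subr_eq0; apply/eqP; rewrite -[RHS]mulrCA -E; ring.
  move/eqP: E; rewrite mulf_eq0 fmorph_eq0 => /orP[/eqP/c_eq0 ck|/eqP E].
    by rewrite /phi ck !mul0r; case: (j) => [|j']; rewrite ?ck ?mul0r; ring.
  apply/eqP; rewrite -subr_eq0; apply/eqP.
  transitivity (c k * (al j * q' (lam k) j.+1 + (if j is j'.+1 then al j' * q' (lam k) j' else 0)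
      + b j * q' (lam k) j - lam k * q' (lam k) j)); last by rewrite E mulr0.
  by rewrite /phi; case: (j) => [|j']; ring.
- exact: phi_complete.
- move=> k l.
  pose F : 'M[R]_N := \matrix_(k, i) phi k i.
  have FF : F^T *m F = 1%:M.
    apply/matrixP => i j; rewrite !mxE -[RHS](phi_complete (ltn_ord i) (ltn_ord j)).
    by apply: eq_bigr => r _; rewrite !mxE.
  have /matrixP/(_ k l) := mulmx1C FF; rewrite !mxE => <-.
  by apply: eq_bigr => r _; rewrite !mxE.
Qed.

End jacobi_spectral.

Definition box_sum (R : realType) (L : nat) (f : int -> R) : R :=
  f 0 + \sum_(j < L) f (j.+1)%:Z + \sum_(j < L) f (- (j.+1)%:Z).

Lemma box_sumE (R : realType) (f : int -> R) L :
  \sum_(j < L.*2.+1) f (j%:Z - L%:Z) = box_sum L f.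
Proof.
elim: L f => [|L IH] f.
  by rewrite /box_sum big_ord_recl !big_ord0 !addr0.
rewrite doubleS big_ord_recl big_ord_recr/=.
have -> : \sum_(i < L.*2.+1) f ((bump 0 i)%:Z - (L.+1)%:Z) = box_sum L f.
  rewrite -IH; apply: eq_bigr => i _; congr f; rewrite /bump /=; lia.
rewrite /box_sum !big_ord_recr/=.
have -> : (bump 0 L.*2.+1)%:Z - L.+1%:Z = L.+1%:Z by rewrite /bump /=; lia.
have -> : 0%:Z - L.+1%:Z = - L.+1%:Z by lia.
ring.
Qed.

Section box.
Context {R : realType}.
Variables (a om : int -> R).
Hypothesis a0 : forall n, 0 < a n.

(** Since [phi k] is extended by zero, the operator of the whole line acts on it, at the sites of
    the box, as the finite matrix does. *)
Record box_eigen (L : nat) (I : finType) (lam : I -> R) (phi : I -> int -> R) : Prop := BoxEigen {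
  box_zero : forall k n, (L < `|n|)%N -> phi k n = 0;
  box_eq : forall k n, (`|n| <= L)%N -> Jop a om (phi k) n = lam k * phi k n;
  box_complete : forall n m, (`|n| <= L)%N -> (`|m| <= L)%N ->
     \sum_k phi k n * phi k m = (n == m)%:R;
  box_ortho : forall k l, box_sum L (fun n => phi k n * phi l n) = (k == l)%:R
}.

Lemma box_spectral L : exists (lam : 'I_(L.*2.+1) -> R) (phi : 'I_(L.*2.+1) -> int -> R),
  box_eigen L lam phi.
Proof.
have [lam [phi [z e c o]]] := @jacobi_spectral R (fun j => a (j%:Z - L%:Z))
  (fun j => om (j%:Z - L%:Z)) L.*2.+1 (fun j => a0 _).
pose psi k (n : int) := if (`|n| <= L)%N then phi k `|(n + L%:Z)%R|%N else 0.
have psiE k (n : int) : (- L%:Z <= n)%R -> psi k n = phi k `|(n + L%:Z)%R|%N.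
  move=> Ln; rewrite /psi; case: ifPn => // nL; rewrite z//; lia.
exists lam, psi; split.
- by move=> k n Ln; rewrite /psi leqNgt Ln.
- move=> k n nL; rewrite /Jop.
  have jN : (`|(n + L%:Z)%R| < L.*2.+1)%N by lia.
  have := e k _ jN.
  rewrite (_ : `|(n + L%:Z)%R|%N%:Z - L%:Z = n); last by lia.
  rewrite (psiE k (n + 1)); last by lia.
  rewrite (psiE k n); last by lia.
  rewrite (_ : `|(n + 1 + L%:Z)%R|%N = `|(n + L%:Z)%R|.+1%N); last by lia.
  move=> <-; congr (_ + _ + _).
  case E : `|(n + L%:Z)%R|%N => [|j].
    by rewrite /psi ifF ?mulr0//; lia.
  rewrite psiE; last by lia.
  by congr (a _ * phi _ _); lia.
- move=> n m nL mL; have nN : (`|(n + L%:Z)%R| < L.*2.+1)%N by lia.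
  have mN : (`|(m + L%:Z)%R| < L.*2.+1)%N by lia.
  rewrite (_ : n == m = (`|(n + L%:Z)%R| == `|(m + L%:Z)%R|)%N); last by lia.
  rewrite -(c _ _ nN mN); apply: eq_bigr => k _; rewrite !psiE//; lia.
- move=> k l; rewrite -o -box_sumE; apply: eq_bigr => j _.
  rewrite !psiE; [|lia|lia].
  by rewrite (_ : `|(j%:Z - L%:Z + L%:Z)%R|%N = j)//; lia.
Qed.

End box.

(** * Solutions on a half-line and their Riccati variables *)

Section half_line.
Context {R : realType}.
Variables (A V : nat -> R).
Hypothesis A0 : forall j, 0 < A j.

(* As a polynomial in the energy, the value at [j] of the solution that is 0 at
   [j + n] and 1 at [j + n - 1]. *)
Fixpoint usol (j n : nat) {struct n} : {poly R} :=
  if n is n'.+1 then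
    (if n' is n''.+1 then
      (A j)^-1 *: (('X - (V j.+1)%:P) * usol j.+1 n' - A j.+1 *: usol j.+2 n'')
     else 1)
  else 0.

Arguments usol : simpl never.

Lemma usol0 j : usol j 0 = 0. Proof. by []. Qed.
Lemma usol1 j : usol j 1 = 1. Proof. by []. Qed.

Lemma usolSS j n : usol j n.+2 =
  (A j)^-1 *: (('X - (V j.+1)%:P) * usol j.+1 n.+1 - A j.+1 *: usol j.+2 n).
Proof. by []. Qed.

(** The recursion adds one linear factor per step. What matters is that the polynomial is nonzero
    for [n > 0], so that it vanishes at finitely many energies only. *)
Lemma size_usol j n : size (usol j n) = n.
Proof.
have [p] := ubnP n; elim: p n j => // p IH [|[|n]] j np.
- by rewrite usol0 size_poly0.
- by rewrite usol1 size_poly1.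
rewrite usolSS size_scale ?invr_eq0 ?gt_eqF//.
have s1 : size (('X - (V j.+1)%:P) * usol j.+1 n.+1) = n.+2.
  have u0 : usol j.+1 n.+1 != 0 by rewrite -size_poly_eq0 IH.
  by rewrite mulrC (size_Mmonic u0 (monicXsubC _)) size_XsubC addn2 IH//=; lia.
rewrite size_polyDl s1// size_polyN (leq_ltn_trans (size_scale_leq _ _))// IH//.
by lia.
Qed.

Lemma usol_rec j n E : A j * (usol j n.+2).[E] + A j.+1 * (usol j.+2 n).[E]
   + V j.+1 * (usol j.+1 n.+1).[E] = E * (usol j.+1 n.+1).[E].
Proof.
rewrite usolSS hornerZ hornerD hornerN hornerM hornerXsubC hornerZ.
by field; rewrite gt_eqF.
Qed.

(** The three-term recursion divided by its middle term is the Riccati recursion. A zero of the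
    solution on the way would make [ric] fall back on [x / 0 = 0], where this reading fails. *)
Lemma ric_usol E j n : (forall i, (i <= n)%N -> (usol (j.+1 + i) (n.+1 - i)).[E] != 0) ->
  ric A V E j.+1 n.+1 = A j * (usol j n.+2).[E] / (usol j.+1 n.+1).[E].
Proof.
elim: n j => [|n IH] j H.
  have := usol_rec j 0 E; rewrite usol0 usol1 horner0 hornerC => E1.
  by rewrite /= invr0 mulr0 divr1; lra.
have H0 := H 0%N isT; rewrite addn0 subn0 in H0.
rewrite -[LHS]/(E - V j.+1 - (A j.+1) ^+ 2 / ric A V E j.+2 n.+1) IH; last first.
  by move=> i ni; have := H i.+1 ni; rewrite addnS addSn subSS.
have Aj : A j.+1 != 0 by rewrite gt_eqF.
have H1 := H 1%N isT; rewrite addn1 subSS subn0 in H1.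
have := usol_rec j n.+1 E.
set u := (usol j.+1 n.+2).[E] in H0 *; set u1 := (usol j.+2 n.+1).[E] in H1 *.
set u2 := (usol j _).[E] => E1.
have -> : A j * u2 = (E - V j.+1) * u - A j.+1 * u1 by lra.
by field; rewrite H0 H1.
Qed.

Variables (L : nat).
Definition uu (E : R) (j : nat) : R := (usol j (L.+1 - j)).[E].

Lemma uu_end E : uu E L.+1 = 0. Proof. by rewrite /uu subnn usol0 horner0. Qed.
Lemma uu_L E : uu E L = 1. Proof. by rewrite /uu subSnn usol1 hornerC. Qed.

Lemma uu_rec E j : (j < L)%N ->
  A j * uu E j + A j.+1 * uu E j.+2 + V j.+1 * uu E j.+1 = E * uu E j.+1.
Proof.
move=> jL; rewrite /uu.
have -> : (L.+1 - j = (L - j.+1).+2)%N by lia.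
have -> : (L.+1 - j.+1 = (L - j.+1).+1)%N by lia.
have -> : (L.+1 - j.+2 = (L - j.+1))%N by lia.
exact: usol_rec.
Qed.

Lemma uu_ric E j : (j < L)%N -> (forall i, (i <= L)%N -> uu E i != 0) ->
  ric A V E j.+1 (L.+1 - j.+1) = A j * uu E j / uu E j.+1.
Proof.
move=> jL H; rewrite /uu.
have -> : (L.+1 - j = (L - j.+1).+2)%N by lia.
have -> : (L.+1 - j.+1 = (L - j.+1).+1)%N by lia.
apply: ric_usol => i ij; have := H (j.+1 + i)%N; rewrite /uu.
have -> : (L.+1 - (j.+1 + i) = (L - j.+1).+1 - i)%N by lia.
by apply; lia.
Qed.

Variables (phi : nat -> R) (lam : R).
Hypothesis phi_end : phi L.+1 = 0.
Hypothesis phi_rec : forall j, (j < L)%N ->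
  A j * phi j + A j.+1 * phi j.+2 + V j.+1 * phi j.+1 = lam * phi j.+1.

(** Discrete Green formula: the summands are the decrements of the Wronskian [w], which is zero at
    [L] because both functions vanish at [L.+1]. *)
Lemma wronskian E :
  (E - lam) * \sum_(j < L) uu E j.+1 * phi j.+1 =
  A 0%N * (uu E 0%N * phi 1%N - uu E 1%N * phi 0%N).
Proof.
pose w j := A j * (uu E j * phi j.+1 - uu E j.+1 * phi j).
have w_step j : (j < L)%N -> (E - lam) * (uu E j.+1 * phi j.+1) = w j - w j.+1.
  move=> jL; rewrite /w mulrBl.
  have -> : E * (uu E j.+1 * phi j.+1) = (E * uu E j.+1) * phi j.+1 by ring.
  have -> : lam * (uu E j.+1 * phi j.+1) = (lam * phi j.+1) * uu E j.+1 by ring.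
  by rewrite -uu_rec// -phi_rec//; ring.
have tel n : (n <= L)%N -> \sum_(j < n) (E - lam) * (uu E j.+1 * phi j.+1) = w 0%N - w n.
  elim: n => [|n IH] nL; first by rewrite big_ord0 subrr.
  by rewrite big_ord_recr/= IH ?(ltnW nL)// w_step//; ring.
by rewrite mulr_sumr tel// /w uu_end phi_end mulr0 mul0r subrr mulr0 subr0.
Qed.

(** The two sides agree at [L.+1] and at [L], and the three-term recursion can be solved
    backwards. *)
Lemma proportional j : (j <= L.+1)%N -> phi j = phi L * uu lam j.
Proof.
have H k : (k <= L)%N -> phi (L - k)%N = phi L * uu lam (L - k)%N /\
    phi (L - k).+1 = phi L * uu lam (L - k).+1.
  elim: k => [|k IH] kL; first by rewrite subn0 uu_L uu_end phi_end mulr1 mulr0.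
  have [h1 h2] := IH (ltnW kL).
  have e : (L - k = (L - k.+1).+1)%N by lia.
  rewrite e in h1 h2; split => //.
  have jL : (L - k.+1 < L)%N by lia.
  have Aj : A (L - k.+1)%N != 0 by rewrite gt_eqF.
  apply: (mulfI Aj).
  have := phi_rec jL; have := uu_rec lam jL.
  rewrite h1 h2; set x := uu _ _; set y := uu _ _.+2; set z := uu _ _.+1 => e1 e2.
  have -> : A (L - k.+1)%N * phi (L - k.+1)%N =
    lam * (phi L * z) - V (L - k.+1).+1 * (phi L * z) - A (L - k.+1).+1 * (phi L * y) by lra.
  have -> : A (L - k.+1)%N * (phi L * x) = phi L * (A (L - k.+1)%N * x) by ring.
  have -> : A (L - k.+1)%N * x = lam * z - V (L - k.+1).+1 * z - A (L - k.+1).+1 * y by lra.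
  ring.
rewrite leq_eqVlt => /orP[/eqP->|]; first by rewrite uu_end phi_end mulr0.
rewrite ltnS => jL; have := H (L - j)%N (leq_subr _ _).
by rewrite subKn// => -[].
Qed.

End half_line.

Lemma finite_poly_roots (R : realType) (p : {poly R}) : p != 0 ->
  finite_set [set x | p.[x] = 0].
Proof.
have [n] := ubnP (size p); elim: n p => // n IH p pn p0.
have [[x rx]|nx] := pselect (exists x, root p x); last first.
  rewrite (_ : [set _ | _] = set0)//; apply/seteqP; split => // x /= px.
  by apply: nx; exists x; apply/rootP.
have /factor_theorem[q pq] := rx.
have q0 : q != 0 by apply: contraNneq p0 => q0; rewrite pq q0 mul0r.
have sq : (size q < n)%N.
  by move: pn; rewrite pq size_Mmonic ?monicXsubC// size_XsubC addn2.
apply: (@sub_finite_set _ _ ([set x] `|` [set x | q.[x] = 0])).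
  move=> y /=; rewrite pq hornerM !hornerE => /eqP; rewrite mulf_eq0 subr_eq0.
  by move=> /orP[/eqP|/eqP]; [right|left].
by rewrite finite_setU; split; [exact: finite_set1|exact: IH].
Qed.

Lemma continuous_horner (R : realType) (p : {poly R}) : continuous (fun x : R => p.[x]).
Proof.
elim/poly_ind: p => [|p c IH] x.
  by rewrite (_ : (fun _ => _) = cst 0); [exact: cst_continuous|apply/funext => y; rewrite horner0].
rewrite (_ : (fun _ => _) = (fun y => p.[y] * y + c)); last first.
  by apply/funext => y; rewrite hornerMXaddC.
by apply: cvgD; [apply: cvgM; [exact: IH|exact: cvg_id]|exact: cvg_cst].
Qed.

Lemma continuous_at_sum (R : realType) (f : nat -> R -> R) (x : R) n :
  (forall j, (j < n)%N -> {for x, continuous (f j)}) ->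
  {for x, continuous (fun y => \sum_(j < n) f j y)}.
Proof.
elim: n => [|n IH] cf.
  rewrite (_ : (fun y => _) = cst 0); first exact: cst_continuous.
  by apply/funext => y; rewrite big_ord0.
rewrite (_ : (fun y => _) = (fun y => \sum_(j < n) f j y + f n y)); last first.
  by apply/funext => y; rewrite big_ord_recr.
by apply: continuousD; [apply: IH => j jn; apply: cf; exact: ltnW|exact: cf].
Qed.

Section half_eigen.
Context {R : realType}.
Variables (A V : nat -> R) (L : nat).
Hypothesis A0 : forall j, 0 < A j.
Notation u := (uu A V L).

(** The weighted sum of the ratios [|u m / u 0|], in the Riccati form to which the decay estimate
    applies; [rsum_good] gives the reading in terms of solutions, valid off a finite set of
    energies. *)
Definition rsum (E : R) : R :=
  \sum_(m < L) m.+1%:R * \prod_(0 <= j < m.+1) (A j / `|ric A V E j.+1 (L.+1 - j.+1)|).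

Definition good (E : R) : Prop := forall i, (i <= L)%N -> u E i != 0.

Lemma rsum_ge0 E : 0 <= rsum E.
Proof.
apply: sumr_ge0 => m _; rewrite mulr_ge0// prodr_ge0// => j _.
by rewrite divr_ge0// ltW.
Qed.

Lemma rsum_good E : good E -> rsum E = \sum_(m < L) m.+1%:R * `|u E m.+1 / u E 0%N|.
Proof.
move=> gE; apply: eq_bigr => m _; congr (_ * _).
have : (m.+1 <= L)%N by [].
elim: (m.+1) => [|n IH] nL.
  by rewrite big_geq// divff ?normr1// gE.
rewrite big_nat_recr//= IH ?(ltnW nL)// uu_ric//.
have g0 := gE 0%N (leq0n _); have g1 := gE n (ltnW nL); have g2 := gE n.+1 nL.
have An : A n != 0 by rewrite gt_eqF.
rewrite !normrM !normfV (gtr0_norm (A0 n)).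
by field; rewrite !normr_eq0 g0 g1 g2 An.
Qed.

Lemma ric_good E : (0 < L)%N -> good E ->
  A 0%N ^+ 2 / ric A V E 1 (L.+1 - 1) = A 0%N * u E 1%N / u E 0%N.
Proof.
move=> L0 gE; rewrite uu_ric//.
have g0 := gE 0%N (leq0n _); have g1 := gE 1%N L0.
have A00 : A 0%N != 0 by rewrite gt_eqF.
by field; rewrite g0 g1 A00.
Qed.

Lemma finite_bad : finite_set [set E | ~ good E].
Proof.
apply: (@sub_finite_set _ _ (\bigcup_(i in `I_L.+1) [set E | u E i = 0])).
  move=> E /= nE; apply: contrapT => H; apply: nE => i iL.
  by apply/eqP => ui; apply: H; exists i.
apply: bigcup_finite => // i /= iL; apply: finite_poly_roots.
by rewrite -size_poly_eq0 size_usol// subn_eq0 -ltnNge.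
Qed.

Lemma continuous_uu j : continuous (u ^~ j).
Proof. exact: continuous_horner. Qed.

Variables (phi : nat -> R) (lam : R).
Hypothesis phi_end : phi L.+1 = 0.
Hypothesis phi_rec : forall j, (j < L)%N ->
  A j * phi j + A j.+1 * phi j.+2 + V j.+1 * phi j.+1 = lam * phi j.+1.
Hypothesis phi0 : phi 0%N != 0.

Lemma uu0_neq0 : u lam 0 != 0.
Proof.
by apply: contraNneq phi0 => u0; rewrite (proportional A0 phi_end phi_rec)// u0 mulr0.
Qed.

Lemma uu_ratio j : (j <= L.+1)%N -> u lam j / u lam 0%N = phi j / phi 0%N.
Proof.
move=> jL; have := uu0_neq0.
rewrite (proportional A0 phi_end phi_rec jL) (proportional A0 phi_end phi_rec (leq0n _)) => u0.
have pL : phi L != 0.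
  by apply: contraNneq phi0 => pL; rewrite (proportional A0 phi_end phi_rec)// pL mul0r.
by field; rewrite u0 pL.
Qed.

Lemma continuous_ratio j : {for lam, continuous (fun E => u E j / u E 0%N)}.
Proof.
apply: continuousM; first exact: continuous_uu.
by apply: continuousV; [exact: uu0_neq0|exact: continuous_uu].
Qed.

Definition rsumu (E : R) : R := \sum_(m < L) m.+1%:R * `|u E m.+1 / u E 0%N|.
Definition dotu (E : R) : R := \sum_(j < L) (u E j.+1 / u E 0%N) * phi j.+1.

Lemma continuous_rsumu : {for lam, continuous rsumu}.
Proof.
apply: (@continuous_at_sum _ (fun m E => m.+1%:R * `|u E m.+1 / u E 0%N|)) => j _.
apply: continuousM; first exact: cst_continuous.
by apply: (continuous_comp (continuous_ratio (j := j.+1))); exact: norm_continuous.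
Qed.

Lemma continuous_dotu : {for lam, continuous dotu}.
Proof.
apply: (@continuous_at_sum _ (fun j E => (u E j.+1 / u E 0%N) * phi j.+1)) => j _.
by apply: continuousM; [exact: continuous_ratio|exact: cst_continuous].
Qed.

Lemma dotu_wronskian E : u E 0%N != 0 ->
  (E - lam) * dotu E = A 0%N * phi 1%N - A 0%N * u E 1%N / u E 0%N * phi 0%N.
Proof.
move=> u0; have := wronskian A0 phi_end phi_rec E => W.
have -> : dotu E = (u E 0%N)^-1 * \sum_(j < L) u E j.+1 * phi j.+1.
  by rewrite mulr_sumr; apply: eq_bigr => j _; ring.
by rewrite mulrCA W; field.
Qed.

Lemma rsumu_lam : rsumu lam * `|phi 0%N| = \sum_(m < L) m.+1%:R * `|phi m.+1|.
Proof.
rewrite mulr_suml; apply: eq_bigr => m _.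
rewrite uu_ratio; last by rewrite ltnW// ltnS.
by rewrite normrM normfV -!mulrA mulVf ?mulr1 ?normr_eq0.
Qed.

Lemma dotu_lam : dotu lam * phi 0%N = \sum_(j < L) phi j.+1 ^+ 2.
Proof.
rewrite mulr_suml; apply: eq_bigr => m _.
rewrite uu_ratio; last by rewrite ltnW// ltnS.
by field.
Qed.

End half_eigen.

(** * Eigenvectors of a box bounded by an integral over energies *)

Section lower_bound.
Context {R : realType}.
Notation mu := (@lebesgue_measure R).
Variables (a om : int -> R) (L : nat).
Hypothesis a0 : forall n, 0 < a n.
Hypothesis L0 : (0 < L)%N.

Definition Ar (j : nat) : R := a j%:Z.
Definition Vr (j : nat) : R := om j%:Z.
Definition Al (j : nat) : R := a (- (j.+1)%:Z).
Definition Vl (j : nat) : R := om (- j%:Z).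

(* The Schur complement at site 0 of [E - J] on the box; its zeros are eigenvalues. *)
Definition spec_fun (E : R) : R :=
  E - Ar 0%N ^+ 2 / ric Ar Vr E 1 (L.+1 - 1) - Al 0%N ^+ 2 / ric Al Vl E 1 (L.+1 - 1) - om 0.

Definition weight_sum (E : R) : R := rsum Ar Vr L E + rsum Al Vl L E.

Variables (I : finType) (lam : I -> R) (phi : I -> int -> R).
Hypothesis be : box_eigen a om L lam phi.

Let pr k (j : nat) := phi k j%:Z.
Let pl k (j : nat) := phi k (- j%:Z).

Let pr_end k : pr k L.+1 = 0. Proof. by apply: (box_zero be). Qed.
Let pl_end k : pl k L.+1 = 0. Proof. by apply: (box_zero be); lia. Qed.

Let pr_rec k j : (j < L)%N ->
  Ar j * pr k j + Ar j.+1 * pr k j.+2 + Vr j.+1 * pr k j.+1 = lam k * pr k j.+1.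
Proof.
move=> jL; rewrite -(box_eq be k (n := j.+1%:Z)) ?absz_nat// /Jop /Ar /Vr /pr.
have -> : (j.+1%:Z + 1 = j.+2%:Z :> int) by lia.
have -> : (j.+1%:Z - 1 = j%:Z :> int) by lia.
ring.
Qed.

Let pl_rec k j : (j < L)%N ->
  Al j * pl k j + Al j.+1 * pl k j.+2 + Vl j.+1 * pl k j.+1 = lam k * pl k j.+1.
Proof.
move=> jL; rewrite -(box_eq be k (n := - j.+1%:Z)); last by lia.
rewrite /Jop /Al /Vl /pl.
have -> : (- j.+1%:Z + 1 = - j%:Z :> int) by lia.
have -> : (- j.+1%:Z - 1 = - j.+2%:Z :> int) by lia.
ring.
Qed.

Let Ar0 j : 0 < Ar j. Proof. exact: a0. Qed.
Let Al0 j : 0 < Al j. Proof. exact: a0. Qed.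

Definition wmass k : R := \sum_(m < L) m.+1%:R * (`|phi k m.+1%:Z| + `|phi k (- m.+1%:Z)|).

Definition good2 E := good Ar Vr L E /\ good Al Vl L E.

Lemma weight_sum_ge0 E : 0 <= weight_sum E.
Proof. by rewrite addr_ge0// rsum_ge0. Qed.

(** On each half-line both eigenvectors would be multiples of the same solution; sharing the site 0,
    they would be proportional, against orthogonality. *)
Lemma lam_inj k l : phi k 0 != 0 -> phi l 0 != 0 -> k != l -> lam k != lam l.
Proof.
move=> k0 l0; apply: contra => /eqP kl.
have rk j : (j <= L.+1)%N -> pr k j * phi l 0 = pr l j * phi k 0.
  move=> jL; have := uu_ratio Ar0 (pr_end k) (@pr_rec k) k0 jL.
  rewrite kl (uu_ratio Ar0 (pr_end l) (@pr_rec l) l0 jL) => E.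
  by move: E; rewrite /pr /= => /eqP; rewrite eqr_div// => /eqP.
have rl j : (j <= L.+1)%N -> pl k j * phi l 0 = pl l j * phi k 0.
  move=> jL; have := uu_ratio Al0 (pl_end k) (@pl_rec k) k0 jL.
  rewrite kl (uu_ratio Al0 (pl_end l) (@pl_rec l) l0 jL) => E.
  by move: E; rewrite /pl /= => /eqP; rewrite eqr_div// => /eqP.
apply: contraT => nkl.
have := box_ortho be k l; rewrite (negbTE nkl) => o0.
have := box_ortho be l l; rewrite eqxx => o1.
have : box_sum L (fun n => phi k n * phi l n) * phi l 0 =
       box_sum L (fun n => phi l n * phi l n) * phi k 0.
  rewrite /box_sum !mulrDl !mulr_suml; congr (_ + _ + _); first by ring.
    by apply: eq_bigr => j _; rewrite mulrAC [phi k _ * _]rk; [rewrite /pr; ring|rewrite ltnW// ltnS].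
  by apply: eq_bigr => j _; rewrite mulrAC [phi k _ * _]rl; [rewrite /pl; ring|rewrite ltnW// ltnS].
by rewrite o0 o1 mul0r mul1r => /esym/eqP; rewrite (negbTE k0).
Qed.

(* By the Wronskian identity, [spec_fun E * phi k 0] is [E - lam k] times a scalar
   product which at [E = lam k] equals [(phi k 0)^-1]. *)
Lemma local_bound k : phi k 0 != 0 ->
  \forall E \near lam k, good2 E ->
    `|spec_fun E| <= 2 * `|E - lam k| / phi k 0 ^+ 2 /\
    wmass k / `|phi k 0| / 2 <= weight_sum E.
Proof.
move=> k0.
(* [G E] pairs [phi k] with the vector formed by the two half-line solutions at energy [E],
   normalised to 1 at site 0, and [h E] is the weight of that vector. Both are continuous at
   [lam k]; the factors 2 in the claim leave room for [E] near [lam k]. *)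
pose G E := phi k 0 + dotu Ar Vr L (pr k) E + dotu Al Vl L (pl k) E.
pose h E := rsumu Ar Vr L E + rsumu Al Vl L E.
have k0r : pr k 0 != 0 by [].
have k0l : pl k 0 != 0 by [].
have Glam : G (lam k) = (phi k 0)^-1.
  apply: (mulIf k0); rewrite mulVf// /G !mulrDl.
  rewrite (dotu_lam Ar0 (pr_end k) (@pr_rec k) k0r) (dotu_lam Al0 (pl_end k) (@pl_rec k) k0l).
  have := box_ortho be k k; rewrite eqxx => h1; rewrite -[RHS]h1.
  by rewrite /box_sum; congr (_ + _ + _); apply: eq_bigr => j _; rewrite expr2.
have hlam : h (lam k) = wmass k / `|phi k 0|.
  apply: (mulIf (x := `|phi k 0|)); first by rewrite normr_eq0.
  rewrite mulfVK ?normr_eq0// /h mulrDl.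
  rewrite (rsumu_lam Ar0 (pr_end k) (@pr_rec k) k0r) (rsumu_lam Al0 (pl_end k) (@pl_rec k) k0l).
  by rewrite -big_split; apply: eq_bigr => j _; rewrite mulrDr.
have cG : {for lam k, continuous G}.
  apply: continuousD; last exact: (continuous_dotu Al0 (pl_end k) (@pl_rec k) k0l).
  apply: continuousD; first exact: cst_continuous.
  exact: (continuous_dotu Ar0 (pr_end k) (@pr_rec k) k0r).
have ch : {for lam k, continuous h}.
  apply: continuousD; first exact: (continuous_rsumu Ar0 (pr_end k) (@pr_rec k) k0r).
  exact: (continuous_rsumu Al0 (pl_end k) (@pl_rec k) k0l).
have nG : \forall E \near lam k, `|G E| < 2 / `|phi k 0|.
  have cn : `|G E| @[E --> lam k] --> `|G (lam k)|.
    exact: (continuous_comp cG (@norm_continuous _ _ _)).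
  apply: (cvgr_lt _ cn).
  rewrite Glam normfV ltr_pMl ?ltr1n// invr_gt0 normr_gt0//.
have hge0 E : 0 <= h E.
  by rewrite addr_ge0// sumr_ge0// => m _; rewrite mulr_ge0.
have nh : \forall E \near lam k, h (lam k) / 2 <= h E.
  have [h0|h0] := leP (h (lam k)) 0.
    near=> E; apply: le_trans (hge0 E); rewrite pmulr_lle0// invr_gt0//.
  have : \forall E \near lam k, h (lam k) / 2 < h E.
    by apply: (cvgr_gt _ ch); lra.
  by apply: filterS => E /ltW.
near=> E => -[gr gl]; split.
  have GE : (E - lam k) * G E = spec_fun E * phi k 0.
    rewrite /G !mulrDr (dotu_wronskian Ar0 (pr_end k) (@pr_rec k))//; last exact: gr.
    rewrite (dotu_wronskian Al0 (pl_end k) (@pl_rec k))//; last exact: gl.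
    rewrite /spec_fun !ric_good//.
    have := box_eq be k (n := 0) (leq0n _); rewrite /Jop add0r sub0r => e.
    have -> : pr k 0%N = phi k 0 by [].
    have -> : pl k 0%N = phi k 0 by [].
    set x := Ar 0%N * _ / _; set y := Al 0%N * _ / _.
    have e' : Ar 0%N * pr k 1%N + Al 0%N * pl k 1%N + om 0 * phi k 0 = lam k * phi k 0 by exact: e.
    rewrite (_ : Ar 0%N * pr k 1%N = lam k * phi k 0 - Al 0%N * pl k 1%N - om 0 * phi k 0); last by lra.
    ring.
  have : `|G E| < 2 / `|phi k 0| by near: E.
  have -> : spec_fun E = (E - lam k) * G E / phi k 0 by rewrite GE; field.
  rewrite !normrM normfV => GE2.
  have n0 : 0 < `|phi k 0| by rewrite normr_gt0.
  rewrite ler_pdivrMr// -(real_normK (num_real (phi k 0))).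
  have -> : 2 * `|E - lam k| / `|phi k 0| ^+ 2 * `|phi k 0| = `|E - lam k| * (2 / `|phi k 0|).
    by field; rewrite gt_eqF.
  by apply: ler_wpM2l => //; exact: ltW.
by rewrite /weight_sum !rsum_good//= -hlam; near: E.
Unshelve. all: by end_near.
Qed.

End lower_bound.

Lemma measurable_rsum (R : realType) d (T : measurableType d) (A : nat -> R) (V : nat -> T -> R)
    L (E : T -> R) :
  measurable_fun [set: T] E -> (forall k, measurable_fun [set: T] (V k)) ->
  measurable_fun [set: T] (fun t => rsum A (V ^~ t) L (E t)).
Proof.
move=> mE mV.
apply: measurable_sum => m.
apply: measurable_funM => //; apply: measurable_prod => j _.
apply: measurable_funM => //; apply: measurable_funV; apply: measurableT_comp => //.
exact: measurable_ric.
Qed.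

Section integral_lower_bound.
Context {R : realType}.
Notation mu := (@lebesgue_measure R).
Variables (a om : int -> R) (L : nat).
Hypothesis a0 : forall n, 0 < a n.
Hypothesis L0 : (0 < L)%N.
Variables (I : finType) (lam : I -> R) (phi : I -> int -> R).
Hypothesis be : box_eigen a om L lam phi.
Variable R1 : R.
Hypothesis lamR : forall k, `|lam k| < R1.

Let f e E := (window e (spec_fun a om L E) * weight_sum a om L E).

Let f_ge0 e E : 0 < e -> 0 <= f e E.
Proof. by move=> e0; rewrite /f mulr_ge0 ?window_ge0// weight_sum_ge0. Qed.

Let mf e : measurable_fun [set: R] (f e).
Proof.
have mric A V j n : measurable_fun [set: R] (fun E : R => ric A V E j n).
  by apply: (@measurable_ric R _ R A (fun k _ => V k) id).
apply: measurable_funM.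
  apply: (measurableT_comp (measurable_window e)).
  apply: measurable_funB => //; apply: measurable_funB.
    apply: measurable_funB => //; apply: measurable_funM => //.
    by apply: measurable_funV; exact: mric.
  by apply: measurable_funM => //; apply: measurable_funV; exact: mric.
apply: measurable_funD.
  by apply: (@measurable_rsum R _ R (Ar a) (fun k _ => Vr om k) L id).
by apply: (@measurable_rsum R _ R (Al a) (fun k _ => Vl om k) L id).
Qed.

Lemma negligible_bad (P : R -> Prop) :
  (forall E, good2 a om L E -> P E) -> \forall E \ae mu, P E.
Proof.
move=> H.
have fb : finite_set [set E | ~ good2 a om L E].
  apply: (@sub_finite_set _ _ ([set E | ~ good (Ar a) (Vr om) L E] `|`
      [set E | ~ good (Al a) (Vl om) L E])).
    move=> E /= nE; apply: contrapT => /not_orP[/contrapT h1 /contrapT h2]; exact: nE.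
  rewrite finite_setU; split; apply: finite_bad => j; exact: a0.
exists [set E | ~ good2 a om L E]; split.
- by apply: countable_measurable => //; exact: finite_set_countable.
- by apply: countable_lebesgue_measure0; exact: finite_set_countable.
- by move=> E /= nP gE; apply: nP; exact: H.
Qed.

(** For small [e], [local_bound] makes the integrand at least [(2 e)^-1 * wmass / (2 |phi k 0|)]
    almost everywhere on the interval of radius [e * phi k 0 ^+ 2 / 2] around [lam k]. These
    intervals are disjoint and lie in [[-R1, R1]]; each contributes [|phi k 0| * wmass / 4]. *)
Lemma integral_lower_bound :
  \forall e \near 0^'+, ((4^-1 * \sum_k `|phi k 0| * wmass L phi k)%:E <=
    \int[mu]_(E in `[(- R1)%R, R1]) (f e E)%:E)%E.
Proof.
have H1 : \forall e \near 0^'+, forall k, phi k 0 != 0 -> forall E : R,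
    `|lam k - E| < e * phi k 0 ^+ 2 / 2 ->
    (- R1 <= E <= R1) /\ (good2 a om L E ->
    `|spec_fun a om L E| < e /\ wmass L phi k / `|phi k 0| / 2 <= weight_sum a om L E).
  apply: filter_forall => k.
  have [->|k0] := eqVneq (phi k 0) 0; first by near=> e.
  have p2 : 0 < phi k 0 ^+ 2 by rewrite exprn_even_gt0.
  have : \forall E \near lam k, (- R1 <= E <= R1) /\ (good2 a om L E ->
     `|spec_fun a om L E| <= 2 * `|E - lam k| / phi k 0 ^+ 2 /\
      wmass L phi k / `|phi k 0| / 2 <= weight_sum a om L E).
    near=> E; split; last by near: E; exact: (local_bound a0 L0 be k0).
    rewrite -ler_norml; apply: ltW; near: E.
    have cn : `|E| @[E --> lam k] --> `|lam k| by exact: norm_continuous.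
    exact: (cvgr_lt _ cn _ (lamR k)).
  move=> /nbhs_ballP[r /= r0 Hr].
  have d0 : 0 < 2 * r / phi k 0 ^+ 2 by rewrite divr_gt0// mulr_gt0.
  near=> e => _ E Ek.
  have e0 : 0 < e by near: e; exact: nbhs_right_gt.
  have er : e < 2 * r / phi k 0 ^+ 2 by near: e; exact: nbhs_right_lt.
  have Er : ball (lam k) r E.
    rewrite /ball /=; apply: lt_trans Ek _.
    by move: er; rewrite ltr_pdivlMr// => er; lra.
  have [h1 h2] := Hr E Er; split => // /h2[h3 h4]; split => //.
  apply: le_lt_trans h3 _; rewrite ltr_pdivrMr// distrC; lra.
(* Disjointness of the intervals: the eigenvalues concerned are distinct by [lam_inj], and finite in
   number. *)
have H2 : \forall e \near 0^'+, forall k l, phi k 0 != 0 -> phi l 0 != 0 -> k != l ->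
    e * phi k 0 ^+ 2 / 2 + e * phi l 0 ^+ 2 / 2 < `|lam k - lam l|.
  apply: filter_forall => k; apply: filter_forall => l.
  have [->|k0] := eqVneq (phi k 0) 0; first by near=> e.
  have [->|l0] := eqVneq (phi l 0) 0; first by near=> e.
  have [->|kl] := eqVneq k l; first by near=> e.
  have p2 : 0 < phi k 0 ^+ 2 + phi l 0 ^+ 2.
    by rewrite addr_gt0// exprn_even_gt0.
  have dl : 0 < `|lam k - lam l|.
    rewrite normr_gt0 subr_eq0.
    exact: (lam_inj a0 L0 be k0 l0 kl).
  have d0 : 0 < 2 * `|lam k - lam l| / (phi k 0 ^+ 2 + phi l 0 ^+ 2).
    by rewrite divr_gt0// mulr_gt0.
  near=> e => _ _ _.
  have er : e < 2 * `|lam k - lam l| / (phi k 0 ^+ 2 + phi l 0 ^+ 2).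
    by near: e; exact: nbhs_right_lt.
  by move: er; rewrite ltr_pdivlMr// => er; lra.
near=> e.
have e0 : 0 < e by near: e; exact: nbhs_right_gt.
have H1e : forall k, phi k 0 != 0 -> forall E : R,
    `|lam k - E| < e * phi k 0 ^+ 2 / 2 ->
    (- R1 <= E <= R1) /\ (good2 a om L E ->
    `|spec_fun a om L E| < e /\ wmass L phi k / `|phi k 0| / 2 <= weight_sum a om L E).
  by near: e; exact: H1.
have H2e : forall k l, phi k 0 != 0 -> phi l 0 != 0 -> k != l ->
    e * phi k 0 ^+ 2 / 2 + e * phi l 0 ^+ 2 / 2 < `|lam k - lam l|.
  by near: e; exact: H2.
pose rad k := e * phi k 0 ^+ 2 / 2.
pose B k : set R := `](lam k - rad k), (lam k + rad k)[%classic.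
pose c k := if phi k 0 == 0 then 0 else (2 * e)^-1 * (wmass L phi k / `|phi k 0| / 2).
have BE k E : B k E <-> `|lam k - E| < rad k.
  by rewrite /B /= in_itv/= ltr_distlC.
have wm0 k : 0 <= wmass L phi k.
  by apply: sumr_ge0 => m _; rewrite mulr_ge0// addr_ge0.
have c0 k : 0 <= c k.
  rewrite /c; case: ifP => // _; apply: mulr_ge0.
    by rewrite invr_ge0 mulr_ge0// ltW.
  by do 2 apply: divr_ge0 => //.
set D : set R := `[(- R1)%R, R1]%classic.
have mD : measurable D by exact: measurable_itv.
have mB k : measurable (B k) by exact: measurable_itv.
have mcB k : measurable_fun [set: R] (fun E : R => (c k * \1_(B k) E)%:E).
  by apply/measurable_EFinP/measurable_funM => //; exact: measurable_indic.
have cB0 k E : (0 <= (c k * \1_(B k) E)%:E)%E by rewrite lee_fin mulr_ge0.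
have sumE : ((4^-1 * \sum_k `|phi k 0| * wmass L phi k)%:E =
   \int[mu]_(E in D) (\sum_k (c k * \1_(B k) E)%:E))%E.
  rewrite ge0_integral_sum//; last by move=> k; apply: measurable_funTS; exact: mcB.
  rewrite mulr_sumr -sumEFin; apply: eq_bigr => k _.
  have [k0|k0] := eqVneq (phi k 0) 0.
    rewrite k0 normr0 mul0r mulr0 /c k0 eqxx; apply/esym.
    under eq_integral do rewrite mul0r.
    by rewrite integral0.
  under eq_integral do rewrite EFinM.
  rewrite ge0_integralZl_EFin//; last first.
    by apply: measurable_funTS; apply/measurable_EFinP; exact: (measurable_indic (mB k)).
  rewrite integral_indic//=; last exact: mB.
  have -> : B k `&` D = B k.
    apply/setIidl => E /BE /(H1e k k0)[+ _].
    by rewrite /D /= in_itv.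
  rewrite /B lebesgue_measure_itv/= lte_fin.
  have rad0 : 0 < rad k by rewrite divr_gt0// mulr_gt0// exprn_even_gt0.
  rewrite ifT; last by lra.
  rewrite -EFinB -EFinM; congr EFin; rewrite /c (negbTE k0) /rad.
  rewrite -(real_normK (num_real (phi k 0))).
  by field; rewrite normr_eq0 k0 gt_eqF.
rewrite sumE; apply: ae_ge0_le_integral => //.
- by move=> E _; apply: sume_ge0.
- by apply: measurable_funTS; apply: emeasurable_sum => k; exact: mcB.
- by move=> E _; rewrite lee_fin f_ge0.
- by apply: measurable_funTS; apply/measurable_EFinP; exact: mf.
apply: negligible_bad => E gE DE.
rewrite sumEFin lee_fin.
have [[k [k0 kE]]|nk] := pselect (exists k, phi k 0 != 0 /\ B k E); last first.
  rewrite big1 ?f_ge0// => k _; rewrite /c; case: ifPn => k0; first by rewrite mul0r.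
  rewrite indicE memNset ?mulr0// => kE; apply: nk; by exists k.
rewrite (bigD1 k)//= big1 ?addr0; last first.
  move=> l lk; rewrite /c; case: ifPn => l0; first by rewrite mul0r.
  rewrite indicE memNset ?mulr0// => /BE lE; move/BE: kE => kE.
  have := H2e k l k0 l0; rewrite eq_sym lk => /(_ isT).
  rewrite ltNge => /negP; apply; apply: le_trans (ler_distD E _ _) _.
  by rewrite (distrC E) ltW// ltrD.
have [_ /(_ gE)[h1 h2]] := H1e k k0 E ((BE k E).1 kE).
rewrite /c (negbTE k0) indicE mem_set// mulr1 /f /window h1 mulr1.
by apply: ler_wpM2l => //; rewrite invr_ge0 mulr_ge0// ltW.
Unshelve. all: by end_near.
Qed.

End integral_lower_bound.

(** * Approximation of the unit vector by eigenvectors *)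

Section box_sums.
Context {R : realType}.
Implicit Types f g : int -> R.

Lemma box_sum_le f g L : (forall n, (`|n| <= L)%N -> f n <= g n) -> box_sum L f <= box_sum L g.
Proof.
move=> fg; rewrite -!box_sumE; apply: ler_sum => j _; apply: fg.
by have := ltn_ord j; lia.
Qed.

Lemma eq_box_sum f g L : (forall n, (`|n| <= L)%N -> f n = g n) -> box_sum L f = box_sum L g.
Proof.
move=> fg; rewrite -!box_sumE; apply: eq_bigr => j _; apply: fg.
by have := ltn_ord j; lia.
Qed.

Lemma box_sum_ge0 f L : (forall n, 0 <= f n) -> 0 <= box_sum L f.
Proof. by move=> f0; rewrite -box_sumE; apply: sumr_ge0. Qed.

Lemma box_sum_mono f M L : (forall n, 0 <= f n) -> (M <= L)%N -> box_sum M f <= box_sum L f.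
Proof.
move=> f0 ML; rewrite -(subnKC ML); elim: (L - M)%N => [|k IH]; first by rewrite addn0.
apply: le_trans IH _; rewrite addnS /box_sum !big_ord_recr/=.
have := f0 (M + k).+1%:Z; have := f0 (- (M + k).+1%:Z); lra.
Qed.

Lemma box_sum_term f L n : (forall n, 0 <= f n) -> (`|n| <= L)%N -> f n <= box_sum L f.
Proof.
move=> f0 nL; rewrite -box_sumE.
have jL : (`|(n + L%:Z)%R| < L.*2.+1)%N by lia.
rewrite (bigD1 (Ordinal jL))//=.
rewrite (_ : `|(n + L%:Z)%R|%N%:Z - L%:Z = n); last by lia.
by rewrite lerDl sumr_ge0.
Qed.

Lemma box_sumD f g L : box_sum L (fun n => f n + g n) = box_sum L f + box_sum L g.
Proof. by rewrite -!box_sumE -big_split. Qed.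

Lemma box_sum_sum (I : finType) (P : pred I) (F : I -> int -> R) L :
  box_sum L (fun n => \sum_(i | P i) F i n) = \sum_(i | P i) box_sum L (F i).
Proof.
rewrite -box_sumE exchange_big/=; apply: eq_bigr => i _; by rewrite box_sumE.
Qed.

Lemma box_sumZ c f L : box_sum L (fun n => c * f n) = c * box_sum L f.
Proof. by rewrite -!box_sumE mulr_sumr. Qed.

Lemma esum_box_le f c : (forall n, 0 <= f n) -> (forall M, box_sum M f <= c) ->
  (\esum_(n in [set: int]) (f n)%:E <= c%:E)%E.
Proof.
move=> f0 fc; apply: ub_ereal_sup => _ [A [fA _] <-].
have [M AM] : exists M : nat, A `<=` [set n | (`|n| <= M)%N].
  exists (\max_(n <- finmap.enum_fset (fset_set A)) `|n|)%N => n /= An.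
  have nA : n \in finmap.enum_fset (fset_set A) by rewrite in_fset_set// mem_set.
  by rewrite (leq_bigmax_seq (F := fun n : int => `|n|%N)).
pose h (j : nat) : int := j%:Z - M%:Z.
apply: (@le_trans _ _ (\sum_(n \in [set h j | j in `I_(M.*2.+1)]) (f n)%:E)%E).
  apply: lee_fsum_nneg_subset => //.
  - by apply: finite_image; exact: finite_II.
  - move=> n /set_mem /AM /= nM; apply/mem_set => /=.
    exists `|(n + M%:Z)%R|%N; rewrite /h /=; lia.
  - by move=> n _; rewrite lee_fin.
rewrite fsbig_image; last by move=> i j _ _; rewrite /h; lia.
by rewrite -(fsbig_ord _ _ (fun j => (f (h j))%:E)) sumEFin lee_fin box_sumE.
Qed.

End box_sums.

Section good_vectors.
Context {R : realType}.
Variables (a om : int -> R) (Am Om : R).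
Hypothesis a0 : forall n, 0 < a n.
Hypothesis aA : forall n, a n <= Am.
Hypothesis omO : forall n, `|om n| <= Om.
Variables (L : nat) (I : finType) (lam : I -> R) (phi : I -> int -> R).
Hypothesis be : box_eigen a om L lam phi.

Lemma box_norm1 k : box_sum L (fun n => phi k n ^+ 2) = 1.
Proof.
have := box_ortho be k k; rewrite eqxx => h; rewrite -[RHS]h.
by apply: eq_box_sum => n _; rewrite expr2.
Qed.

Lemma phi_le1 k n : `|phi k n| <= 1.
Proof.
have [nL|nL] := leqP `|n| L; last by rewrite (box_zero be)// normr0.
rewrite -(ler_pXn2r (n := 2))// ?nnegrE// expr1n real_normK ?num_real//.
by rewrite -(box_norm1 k); apply: (box_sum_term (f := fun n => phi k n ^+ 2)) => // m; exact: sqr_ge0.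
Qed.

(** The eigenvector equation is read at an entry of greatest modulus. *)
Lemma gershgorin k : `|lam k| <= 2 * Am + Om.
Proof.
pose F (j : 'I_(L.*2.+1)) := `|phi k (j%:Z - L%:Z)|.
pose j0 : 'I_(L.*2.+1) := [arg max_(j > ord0) F j]%O.
have jmax j : F j <= F j0.
  by rewrite /j0; case: arg_maxP => // i _; apply.
pose n : int := j0%:Z - L%:Z.
have nL : (`|n| <= L)%N by have := ltn_ord j0; rewrite /n; lia.
have nmax m : `|phi k m| <= `|phi k n|.
  have [mL|mL] := leqP `|m| L; last by rewrite (box_zero be)// normr0.
  have jL : (`|(m + L%:Z)%R| < L.*2.+1)%N by lia.
  have := jmax (Ordinal jL); rewrite /F /=.
  by rewrite (_ : `|(m + L%:Z)%R|%N%:Z - L%:Z = m)//; lia.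
have n0 : 0 < `|phi k n|.
  rewrite normr_gt0; apply/eqP => p0.
  have := box_norm1 k; rewrite (@eq_box_sum _ _ (fun n => 0)); last first.
    move=> m _; have := nmax m; rewrite p0 normr0 normr_le0 => /eqP ->.
    by rewrite expr0n.
  rewrite -box_sumE big1// => /esym/eqP; by rewrite oner_eq0.
rewrite -(ler_pM2r n0) -normrM -(box_eq be k nL) /Jop.
apply: le_trans (ler_normD _ _) _; rewrite mulrDl normrM; apply: lerD; last first.
  exact: ler_wpM2r.
apply: le_trans (ler_normD _ _) _; rewrite !normrM !(gtr0_norm (a0 _)).
have := nmax (n + 1); have := nmax (n - 1) => h1 h2.
have A0 : 0 <= Am by apply: le_trans (aA 0); exact: ltW.
rewrite mulr2n mulrDl mulrDl mul1r; apply: lerD.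
  by apply: ler_pM => //; exact: ltW.
by apply: ler_pM => //; exact: ltW.
Qed.

Variables (N : nat) (B : R).
Hypothesis N0 : (0 < N)%N.
Hypothesis NL : (N <= L)%N.
Hypothesis mass : \sum_k `|phi k 0| * wmass L phi k <= B.

Let inN n k := box_sum n (fun m => phi k m ^+ 2).
Definition good_set : {set I} := [set k | 2^-1 <= inN N k].

(* The masses in [-N, N] of the members of an orthonormal basis add up to 2N + 1. *)
Lemma card_good : (#|good_set| <= N.*2.+1.*2)%N.
Proof.
have H : \sum_k inN N k = N.*2.+1%:R.
  rewrite /inN -(box_sum_sum xpredT).
  rewrite (@eq_box_sum _ _ (fun=> 1)).
    by rewrite -box_sumE sumr_const card_ord.
  move=> n nN; have nL : (`|n| <= L)%N by exact: leq_trans NL.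
  have := box_complete be nL nL; rewrite eqxx => h; rewrite -[RHS]h.
  by apply: eq_bigr => k _; rewrite expr2.
have H2 : \sum_(k in good_set) (2^-1 : R) <= N.*2.+1%:R.
  rewrite -H [leRHS](bigID (mem good_set))/=.
  apply: ler_wpDr; first by apply: sumr_ge0 => k _; apply: box_sum_ge0 => n; exact: sqr_ge0.
  by apply: ler_sum => k; rewrite inE.
move: H2; rewrite sumr_const -mulr_natl => H2.
rewrite -(ler_nat R) -[X in _ <= X%:R]muln2 natrM; lra.
Qed.

Let tail_sum (x y : nat -> R) K : (forall m, 0 <= x m) -> (forall m, 0 <= y m) ->
  (forall m, (N <= m)%N -> x m <= y m) ->
  \sum_(m < K) x m <= \sum_(m < N) x m + \sum_(m < K) y m.
Proof.
move=> x0 y0 xy; elim: K => [|K IH].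
  by rewrite !big_ord0 addr0; apply: sumr_ge0.
have [KN|NK] := ltnP K N.
  rewrite ler_wpDr ?sumr_ge0//.
  rewrite (big_ord_widen N x KN) [leRHS](bigID (fun i : 'I_N => (i < K.+1)%N))/=.
  by rewrite lerDl sumr_ge0.
rewrite !big_ord_recr/=; have := xy K NK; lra.
Qed.

(** At sites beyond [N], [phi ^+ 2 <= |phi| <= (|m| / N) |phi|], so the mass outside [[-N, N]] is at
    most [wmass / N]. If less than half lies inside, then [1 <= 2 / N * wmass]; multiply by
    [phi k 0 ^+ 2 <= |phi k 0|]. *)
Lemma bad_mass k : k \notin good_set -> phi k 0 ^+ 2 <= 2 / N%:R * (`|phi k 0| * wmass L phi k).
Proof.
rewrite inE -ltNge => kb.
have n0 : 0 < N%:R :> R by rewrite ltr0n.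
have tb : 1 <= inN N k + N%:R^-1 * wmass L phi k.
  rewrite -[leLHS](box_norm1 k) /inN /box_sum /wmass.
  have P1 : \sum_(j < L) phi k j.+1%:Z ^+ 2 <= \sum_(j < N) phi k j.+1%:Z ^+ 2 +
      \sum_(j < L) N%:R^-1 * (j.+1%:R * `|phi k j.+1%:Z|).
    apply: (tail_sum (x := fun j => phi k j.+1%:Z ^+ 2)
      (y := fun j => N%:R^-1 * (j.+1%:R * `|phi k j.+1%:Z|))).
    - by move=> m; exact: sqr_ge0.
    - by move=> m; rewrite !mulr_ge0// invr_ge0 ltW.
    - move=> m Nm; rewrite -(real_normK (num_real _)) expr2 mulrA.
      apply: ler_wpM2r => //; apply: le_trans (phi_le1 k _) _.
      by rewrite mulrC ler_pdivlMr// mul1r ler_nat leqW.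
  have P2 : \sum_(j < L) phi k (- j.+1%:Z) ^+ 2 <= \sum_(j < N) phi k (- j.+1%:Z) ^+ 2 +
      \sum_(j < L) N%:R^-1 * (j.+1%:R * `|phi k (- j.+1%:Z)|).
    apply: (tail_sum (x := fun j => phi k (- j.+1%:Z) ^+ 2)
      (y := fun j => N%:R^-1 * (j.+1%:R * `|phi k (- j.+1%:Z)|))).
    - by move=> m; exact: sqr_ge0.
    - by move=> m; rewrite !mulr_ge0// invr_ge0 ltW.
    - move=> m Nm; rewrite -(real_normK (num_real _)) expr2 mulrA.
      apply: ler_wpM2r => //; apply: le_trans (phi_le1 k _) _.
      by rewrite mulrC ler_pdivlMr// mul1r ler_nat leqW.
  have -> : N%:R^-1 * (\sum_(m < L) m.+1%:R * (`|phi k m.+1%:Z| + `|phi k (- m.+1%:Z)|)) =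
     \sum_(j < L) N%:R^-1 * (j.+1%:R * `|phi k j.+1%:Z|) +
     \sum_(j < L) N%:R^-1 * (j.+1%:R * `|phi k (- j.+1%:Z)|).
    by rewrite mulr_sumr -big_split/=; apply: eq_bigr => j _; ring.
  lra.
have h : 1 <= 2 / N%:R * wmass L phi k.
  rewrite mulrAC -mulrA -[_ / _]mulrC; lra.
rewrite -(real_normK (num_real _)) expr2 mulrCA.
apply: ler_wpM2l => //; exact: le_trans (phi_le1 k _) h.
Qed.

(** By completeness, what is left of the unit vector at 0 is its component along the remaining
    eigenvectors; orthonormality gives its squared norm as the sum of their [phi k 0 ^+ 2]. *)
Lemma good_approx M : (M <= L)%N ->
  box_sum M (fun n => ((n == 0)%:R - \sum_(k in good_set) phi k 0 * phi k n) ^+ 2) <= 2 * B / N%:R.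
Proof.
move=> ML; apply: le_trans (box_sum_mono _ ML) _; first by move=> n; exact: sqr_ge0.
have -> : box_sum L (fun n => ((n == 0)%:R - \sum_(k in good_set) phi k 0 * phi k n) ^+ 2)
   = \sum_(k | k \notin good_set) phi k 0 ^+ 2.
  transitivity (box_sum L (fun n => \sum_(k | k \notin good_set) \sum_(l | l \notin good_set)
      (phi k 0 * phi l 0) * (phi k n * phi l n))).
    apply: eq_box_sum => n nL.
    have -> : (n == 0)%:R - \sum_(k in good_set) phi k 0 * phi k n =
        \sum_(k | k \notin good_set) phi k 0 * phi k n.
      rewrite eq_sym -(box_complete be (n := 0) (m := n))//.
      by rewrite (bigID (mem good_set))/= addrAC subrr add0r.
    rewrite expr2 mulr_suml; apply: eq_bigr => k _.
    by rewrite mulr_sumr; apply: eq_bigr => l _; ring.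
  rewrite box_sum_sum; apply: eq_bigr => k kb.
  rewrite box_sum_sum (bigD1 k)//= big1 ?addr0.
    by rewrite box_sumZ (box_ortho be) eqxx mulr1 expr2.
  by move=> l /andP[_ lk]; rewrite box_sumZ (box_ortho be) eq_sym (negbTE lk) mulr0.
apply: (@le_trans _ _ (\sum_(k | k \notin good_set) 2 / N%:R * (`|phi k 0| * wmass L phi k))).
  by apply: ler_sum => k; exact: bad_mass.
rewrite -mulr_sumr mulrAC; apply: ler_wpM2r; first by rewrite invr_ge0.
apply: ler_wpM2l => //; apply: le_trans mass.
rewrite [leRHS](bigID (mem good_set))/= lerDr.
apply: sumr_ge0 => k _; rewrite mulr_ge0//.
by apply: sumr_ge0 => m _; rewrite mulr_ge0// addr_ge0.
Qed.

(** The number of good eigenvectors varies with the box. Padding with zero vectors up to the bound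
    of [card_good] gives one index type for all boxes, so that limits can be taken index by
    index. *)
Lemma good_enumeration : exists (e : 'I_(N.*2.+1.*2) -> int -> R) (E : 'I_(N.*2.+1.*2) -> R),
  [/\ forall i n, `|e i n| <= 1, forall i, `|E i| <= 2 * Am + Om,
    forall i n, (`|n| <= L)%N -> Jop a om (e i) n = E i * e i n,
    forall i M, (M <= L)%N -> box_sum M (fun n => e i n ^+ 2) <= 1 &
    forall M, (M <= L)%N ->
      box_sum M (fun n => ((n == 0)%:R - \sum_i e i 0 * e i n) ^+ 2) <= 2 * B / N%:R].
Proof.
have AO : 0 <= 2 * Am + Om.
  have := aA 0; have := a0 0; have := omO 0; have := normr_ge0 (om 0); lra.
pose pick (i : nat) : option I := nth None (map Some (enum good_set)) i.
pose e (i : nat) : int -> R := if pick i is Some k then phi k else fun=> 0.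
pose E (i : nat) : R := if pick i is Some k then lam k else 0.
exists (fun i => e i), (fun i => E i).
have sumG (F : (int -> R) -> R) : F (fun=> 0) = 0 ->
    \sum_(i < N.*2.+1.*2) F (e i) = \sum_(k in good_set) F (phi k).
  move=> F0.
  transitivity (\sum_(o <- map Some (enum good_set)) F (if o is Some k then phi k else fun=> 0));
    last by rewrite big_map big_enum.
  rewrite (big_nth None) size_map -cardE big_mkord.
  rewrite (big_ord_widen _ (fun i => F (if nth None (map Some (enum good_set)) i is Some k then phi k else fun=> 0)) card_good).
  rewrite [RHS]big_mkcond/=; apply: eq_bigr => i _; rewrite /e /pick.
  case: ltnP => // iG; rewrite nth_default//.
  by rewrite size_map -cardE.
split.
- by move=> i n; rewrite /e; case: (pick i) => [k|]; rewrite ?normr0// phi_le1.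
- by move=> i; rewrite /E; case: (pick i) => [k|]; rewrite ?normr0// gershgorin.
- move=> i n nL; rewrite /e /E; case: (pick i) => [k|]; first exact: (box_eq be).
  by rewrite /Jop !mulr0 !addr0.
- move=> i M ML; rewrite /e; case: (pick i) => [k|].
    by rewrite -(box_norm1 k); apply: box_sum_mono => // n; exact: sqr_ge0.
  by rewrite -box_sumE big1// => j _; rewrite expr0n.
- move=> M ML; apply: le_trans (good_approx ML).
  apply: box_sum_le => n _; rewrite (sumG (fun f => f 0 * f n))//.
  by rewrite mulr0.
Qed.

End good_vectors.

(** * Limits of eigenvectors along growing boxes *)

Section ultra.
Context {R : realType}.

Lemma cvg_sum_seq (U : set_system nat) {FU : Filter U} (J : Type) (r : seq J)
    (f : J -> nat -> R) (l : J -> R) :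
  (forall i, f i j @[j --> U] --> l i) ->
  \sum_(i <- r) f i j @[j --> U] --> \sum_(i <- r) l i.
Proof.
move=> H; elim: r => [|i r IH].
  rewrite big_nil (_ : (fun j => _) = cst 0); first exact: cvg_cst.
  by apply/funext => j; rewrite big_nil.
rewrite big_cons (_ : (fun j => _) = (fun j => f i j + \sum_(i <- r) f i j)).
  by apply: cvgD; [exact: H|exact: IH].
by apply/funext => j; rewrite big_cons.
Qed.

(** Compactness of a segment. With an ultrafilter, all entries and all eigenvalues have limits along
    the same [U], which replaces a diagonal extraction of subsequences. *)
Lemma ultra_bounded_cvg (U : set_system nat) {FU : UltraFilter U} (x : nat -> R) C :
  (forall j, `|x j| <= C) -> exists l : R, x j @[j --> U] --> l.
Proof.
move=> xC; have := @segment_compact R (- C) C; rewrite compact_ultra => cC.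
have UA : (x @ U) `[- C, C]%classic.
  change (U (x @^-1` `[- C, C]%classic)).
  rewrite (_ : x @^-1` _ = setT); first exact: filterT.
  by apply/seteqP; split => j //= _; rewrite in_itv/= -ler_norml.
have UF : UltraFilter (x @ U).
  apply: Build_UltraFilter => G PG UG; apply/seteqP; split => A; last exact: UG.
  move=> GA; have [//|UnA] := in_ultra_setVsetC (x @^-1` A) FU.
  have GnA : G (~` A) by apply: UG.
  have := filterI GA GnA; rewrite setICr => G0.
  by case: (@filter_not_empty _ G PG (G0 _)).
have [l [_ xl]] := cC (x @ U) UF UA.
by exists l.
Qed.

End ultra.

Section limit.
Context {R : realType}.
Variables (a om : int -> R) (Am Om B : R).
Hypothesis a0 : forall n, 0 < a n.
Hypothesis aA : forall n, a n <= Am.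
Hypothesis omO : forall n, `|om n| <= Om.
Hypothesis boxes : forall j : nat, exists2 L, (j <= L)%N &
  exists (lam : 'I_(L.*2.+1) -> R) (phi : 'I_(L.*2.+1) -> int -> R),
    box_eigen a om L lam phi /\ \sum_k `|phi k 0| * wmass L phi k <= B.

Lemma delta0_approx eps : 0 < eps ->
  exists s : seq (R * (int -> R)),
    (forall p, p \in s -> is_eigenvector a om p.2) /\
    (l2norm2 (fun n => ((n == 0)%:R - \sum_(p <- s) p.1 * p.2 n)%R) <= eps%:E)%E.
Proof.
move=> eps0.
pose N := (Num.Def.truncn (2 * B / eps)).+1.
have N0 : (0 < N)%N by [].
have n0 : 0 < N%:R :> R by rewrite ltr0n.
have BN : 2 * B / N%:R <= eps.
  rewrite ler_pdivrMr// [leRHS]mulrC -ler_pdivrMr//.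
  by apply: ltW; exact: truncnS_gt.
pose p := N.*2.+1.*2.
have data (j : nat) : exists eE : ('I_p -> int -> R) * ('I_p -> R),
  [/\ forall i n, `|eE.1 i n| <= 1, forall i, `|eE.2 i| <= 2 * Am + Om,
    forall i n, (`|n| <= j)%N -> Jop a om (eE.1 i) n = eE.2 i * eE.1 i n,
    forall i M, (M <= j)%N -> box_sum M (fun n => eE.1 i n ^+ 2) <= 1 &
    forall M, (M <= j)%N ->
      box_sum M (fun n => ((n == 0)%:R - \sum_i eE.1 i 0 * eE.1 i n) ^+ 2) <= eps].
  have [L jL [lam [phi [be mass]]]] := boxes (maxn j N).
  have NL : (N <= L)%N by rewrite (leq_trans _ jL)// leq_maxr.
  have {}jL : (j <= L)%N by rewrite (leq_trans _ jL)// leq_maxl.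
  have [e [E [h1 h2 h3 h4 h5]]] := good_enumeration a0 aA omO be N0 NL mass.
  exists (e, E); split => //=.
  - by move=> i n nj; apply: h3; exact: leq_trans jL.
  - by move=> i M Mj; apply: h4; exact: leq_trans jL.
  - by move=> M Mj; apply: le_trans BN; apply: h5; exact: leq_trans jL.
(* [U] refines convergence to infinity: whatever holds for all large enough boxes holds near [U]. *)
have [U [UU ooU]] := ultraFilterLemma (@eventually_filter).
pose e j := (projT1 (cid (data j))).1; pose E j := (projT1 (cid (data j))).2.
have eE j : [/\ forall i n, `|e j i n| <= 1, forall i, `|E j i| <= 2 * Am + Om,
    forall i n, (`|n| <= j)%N -> Jop a om (e j i) n = E j i * e j i n,
    forall i M, (M <= j)%N -> box_sum M (fun n => e j i n ^+ 2) <= 1 &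
    forall M, (M <= j)%N ->
      box_sum M (fun n => ((n == 0)%:R - \sum_i e j i 0 * e j i n) ^+ 2) <= eps].
  by rewrite /e /E; case: cid.
have lime i n : exists l : R, e j i n @[j --> U] --> l.
  by apply: (ultra_bounded_cvg (C := 1)) => j; have [h _ _ _ _] := eE j; exact: h.
have limE i : exists l : R, E j i @[j --> U] --> l.
  by apply: (ultra_bounded_cvg (C := 2 * Am + Om)) => j; have [_ h _ _ _] := eE j; exact: h.
pose e' i n := projT1 (cid (lime i n)); pose E' i := projT1 (cid (limE i)).
have ce i n : e j i n @[j --> U] --> e' i n by rewrite /e'; case: cid.
have cE i : E j i @[j --> U] --> E' i by rewrite /E'; case: cid.
have near_ge M : \forall j \near U, (M <= j)%N by apply: ooU; exact: nbhs_infty_ge.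
have eigen i n : Jop a om (e' i) n = E' i * e' i n.
  have c : Jop a om (e j i) n - E j i * e j i n @[j --> U] --> Jop a om (e' i) n - E' i * e' i n.
    apply: cvgB; last by apply: cvgM.
    apply: cvgD; last by apply: cvgM => //; exact: cvg_cst.
    by apply: cvgD; apply: cvgM => //; exact: cvg_cst.
  have z : \forall j \near U, Jop a om (e j i) n - E j i * e j i n = 0.
    apply: filterS (near_ge `|n|%N) => j nj; have [_ _ h _ _] := eE j.
    by rewrite h// subrr.
  apply/eqP; rewrite -subr_eq0 eq_le; apply/andP; split.
    by apply: (cvgr_to_le c); apply: filterS z => j ->.
  by apply: (cvgr_to_ge c); apply: filterS z => j ->.
have cbox M (f : nat -> int -> R) (l : int -> R) : (forall n, f j n @[j --> U] --> l n) ->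
    box_sum M (f j) @[j --> U] --> box_sum M l.
  move=> fl; rewrite -box_sumE.
  rewrite (_ : (fun j => _) = (fun j => \sum_(i < M.*2.+1) f j (i%:Z - M%:Z))).
    by apply: cvg_sum_seq => i; exact: fl.
  by apply/funext => j; rewrite box_sumE.
have l2e i : in_l2 (e' i).
  apply: (@le_lt_trans _ _ 1%:E); last by rewrite ltry.
  apply: esum_box_le => [n|M]; first exact: sqr_ge0.
  have c := @cbox M (fun j n => e j i n ^+ 2) (fun n => e' i n ^+ 2).
  apply: (cvgr_to_le (c _)).
    by move=> n; under eq_fun do rewrite expr2; rewrite expr2; exact: cvgM.
  by apply: filterS (near_ge M) => j Mj; have [_ _ _ h _] := eE j; exact: h.
(* Limits can be zero, for instance at indices that carry padding. They are no eigenvectors, and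
   dropping them leaves the sum unchanged. *)
pose nz i := `[< e' i <> (fun=> 0) >].
exists [seq (e' i 0, e' i) | i <- enum 'I_p & nz i]; split.
  move=> q qs; have [i + ->] : exists2 i, i \in [seq i <- enum 'I_p | nz i] & q = (e' i 0, e' i).
    by apply/mapP.
  rewrite mem_filter => /andP[/asboolP nzi _].
  split; [exact: l2e|split; [exact: nzi|exists (E' i) => n; exact: eigen]].
apply: esum_box_le => [n|M]; first exact: sqr_ge0.
rewrite (@eq_box_sum _ _ (fun n => ((n == 0)%:R - \sum_i e' i 0 * e' i n) ^+ 2)); last first.
  move=> n _; congr ((_ - _) ^+ 2); rewrite big_map big_filter big_enum_cond/=.
  rewrite [RHS](bigID nz)/= [X in _ = _ + X]big1 ?addr0//.
  by move=> i /asboolPn/contrapT ->; rewrite mulr0.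
apply: (cvgr_to_le (@cbox M (fun j n => ((n == 0)%:R - \sum_i e j i 0 * e j i n) ^+ 2) _ _)).
  move=> n; under eq_fun do rewrite expr2; rewrite expr2.
  have c : (n == 0)%:R - \sum_i e j i 0 * e j i n @[j --> U] --> (n == 0)%:R - \sum_i e' i 0 * e' i n.
    apply: cvgB; first exact: cvg_cst.
    by apply: cvg_sum_seq => i; apply: cvgM.
  exact: cvgM.
by apply: filterS (near_ge M) => j Mj; have [_ _ _ _ h] := eE j; exact: h.
Qed.

End limit.

(** * The almost sure bound *)

Lemma independent_reindex (R : realType) d (T : measurableType d) (P : probability T R)
    (X : int -> T -> R) (g h : int -> int) : cancel g h ->
  mutually_independent P X -> mutually_independent P (fun n => X (g n)).
Proof.
move=> gK iX S B uS mB.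
have := iX (map g S) (fun n => B (h n)); rewrite map_inj_uniq; last exact: can_inj gK.
move=> /(_ uS (fun n => mB (h n))); rewrite big_map; under eq_bigr do rewrite gK.
move=> <-; congr (fine (P _)); apply/seteqP; split => t /= H n /=.
  by move=> /mapP[k kS ->]; rewrite gK; exact: H.
by move=> nS; have /= := H (g n); rewrite gK; apply; exact: map_f.
Qed.

Section half.
Context {R : realType} {d : measure_display} {T : measurableType d}.
Variables (P : probability T R) (X : int -> T -> R).
Hypothesis mX : forall n, measurable_fun [set: T] (X n).
Hypothesis iX : mutually_independent P X.
Notation mu := (@lebesgue_measure R).
Variables (A : nat -> R) (b : nat -> R).
Hypothesis A0 : forall j, 0 < A j.
Hypothesis hb : forall m, exists M, exists2 n : nat, (0 < n)%N &
  [/\ 0 <= M,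
      forall (j : nat) B, (j <= m)%N -> measurable B -> (P (X j @^-1` B) <= M%:E * mu B)%E,
      forall j, 16 * (A j * M) <= n%:R, 0 <= b m &
      M ^+ 2 * (1 - (8 * n%:R ^+ 2 + 2)^-1) ^+ m.-1./2 <= b m ^+ 2].

(** [decay_estimate] is used for each distance separately, with a density bound [M] and an integer
    [n] fitted to the sites up to that distance; both may grow with it. *)
Lemma half_estimate (L : nat) (E e : R) (s : T -> R) : 0 < e ->
  (forall j : nat, measurable_fun [set: others X j] (s : others X j -> R)) ->
  (\int[P]_t (window e (E - A 0 ^+ 2 / ric A (fun k => X k%:Z t) E 1 (L.+1 - 1) - s t - X 0 t)
     * rsum A (fun k => X k%:Z t) L E)%:E <= (\sum_(m < L) m.+1%:R * b m.+1)%:E)%E.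
Proof.
move=> e0 ms.
have mo (j : nat) (f : T -> R) : measurable_fun [set: others X j] (f : others X j -> R) ->
    measurable_fun [set: T] f.
  by move=> mf _ B mB; apply: (@others_measurable _ _ _ _ mX j); exact: mf.
pose W t := window e (E - A 0 ^+ 2 / ric A (fun k => X k%:Z t) E 1 (L.+1 - 1) - s t - X 0 t).
have mW : measurable_fun [set: T] W.
  apply: (measurableT_comp (measurable_window e)).
  apply: measurable_funB => //; apply: measurable_funB; last exact: (mo 0%N).
  apply: measurable_funB => //; apply: measurable_funM => //.
  by apply: measurable_funV; exact: measurable_ric.
have W0 t : 0 <= W t by exact: window_ge0.
have mr m : measurable_fun [set: T] (ratio_prod X A E m L 0).
  by apply: (mo 0%N); exact: measurable_ratio_prod.
have r0 m t : 0 <= ratio_prod X A E m L 0 t by exact: ratio_prod_ge0.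
have -> : (\int[P]_t (W t * rsum A (fun k => X k%:Z t) L E)%:E =
    \int[P]_t \sum_(m < L) (m.+1%:R * (W t * ratio_prod X A E m.+1 L 0 t))%:E)%E.
  apply: eq_integral => t _; rewrite sumEFin; congr EFin.
  by rewrite mulr_sumr; apply: eq_bigr => m _; rewrite mulrCA.
rewrite ge0_integral_sum//; last 2 first.
- by move=> m; apply/measurable_EFinP; do 2 apply: measurable_funM => //.
- by move=> m t _; rewrite lee_fin mulr_ge0//; exact: mulr_ge0.
rewrite -sumEFin; apply: lee_sum => m _.
under eq_integral do rewrite EFinM.
rewrite ge0_integralZl_EFin//; last 2 first.
- by move=> t _; rewrite lee_fin; exact: mulr_ge0.
- by apply/measurable_EFinP; exact: measurable_funM.
rewrite EFinM; apply: lee_wpmul2l; first by rewrite lee_fin.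
have [M [n n0 [M0 dom nM b0 hM]]] := hb m.+1.
apply: (@decay_estimate _ _ _ P X mX iX A E M A0 M0 m.+1 _ L _ _ s ms e e0 n) => //.
by move=> j jm B mB; exact: dom.
Qed.

End half.

(** * Fatou's lemma and almost sure finiteness *)

Section liminf.
Context {R : realType}.
Local Open Scope ereal_scope.
Implicit Types (u : (\bar R)^nat) (B C : \bar R).

Lemma limn_einf_supE u : limn_einf u = ereal_sup (range (einfs u)).
Proof. by rewrite limn_einf_lim; apply/cvg_lim => //; exact: cvg_einfs_sup. Qed.

Lemma limn_einf_le u C : (forall n, u n <= C) -> limn_einf u <= C.
Proof.
move=> uC; rewrite limn_einf_supE; apply: ge_ereal_sup => _ [n _ <-].
by apply: le_trans (uC n); apply: ereal_inf_lbound; exists n => /=.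
Qed.

Lemma limn_einf_ge u C : (\forall n \near \oo, C <= u n) -> C <= limn_einf u.
Proof.
move=> [N _ HN]; rewrite limn_einf_supE.
apply: (@le_trans _ _ (einfs u N)); last by apply: ereal_sup_ubound; exists N.
by apply: le_ereal_inf_tmp => _ [n /= Nn <-]; exact: HN.
Qed.

Lemma limn_einf_lt u B n : limn_einf u < B -> exists2 k, (n <= k)%N & u k < B.
Proof.
rewrite limn_einf_supE => uB.
have : einfs u n < B by apply: le_lt_trans uB; apply: ereal_sup_ubound; exists n.
by move=> /ereal_inf_lt[_ [k /= nk <-] kB]; exists k.
Qed.

Lemma fatou_bound d (T : measurableType d) (mu : {measure set T -> \bar R})
    (f : nat -> T -> \bar R) C : (forall n, measurable_fun [set: T] (f n)) ->
  (forall n t, 0 <= f n t) -> (forall n, \int[mu]_t f n t <= C) ->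
  [/\ measurable_fun [set: T] (fun t => limn_einf (f ^~ t)),
      forall t, 0 <= limn_einf (f ^~ t) & \int[mu]_t limn_einf (f ^~ t) <= C].
Proof.
move=> mf f0 fC; split.
- rewrite /limn_einf; apply: measurableT_comp => //.
  by apply: measurable_fun_limn_esup => n; apply: measurableT_comp.
- by move=> t; apply: limn_einf_ge; near=> n; exact: f0.
apply: le_trans (fatou mu measurableT mf _) _; first by move=> n t _; exact: f0.
exact: limn_einf_le.
Unshelve. all: by end_near.
Qed.

Lemma ae_lty d (T : measurableType d) (mu : {measure set T -> \bar R}) (f : T -> \bar R) :
  measurable_fun [set: T] f -> (forall t, 0 <= f t) -> \int[mu]_t f t < +oo ->
  {ae mu, forall t, f t < +oo}.
Proof.
move=> mf f0 fi.
have If : mu.-integrable [set: T] f.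
  apply/integrableP; split => //; under eq_integral do rewrite gee0_abs//.
  exact: fi.
have := integrable_ae measurableT If; apply: filterS => t /(_ I).
by rewrite fin_numE => /andP[_ h]; rewrite ltey.
Qed.

End liminf.

Section two_sided.
Context {R : realType} {d : measure_display} {T : measurableType d}.
Variables (P : probability T R) (X : int -> T -> R).
Hypothesis mX : forall n, measurable_fun [set: T] (X n).
Hypothesis iX : mutually_independent P X.
Notation mu := (@lebesgue_measure R).
Variables (a : int -> R) (b : nat -> R) (Bs : R).
Hypothesis a0 : forall j, 0 < a j.
Hypothesis hb : forall m, exists M, exists2 n : nat, (0 < n)%N &
  [/\ 0 <= M,
      forall (j : int) B, (`|j| <= m)%N -> measurable B ->
        (P (X j @^-1` B) <= M%:E * mu B)%E,
      forall j, 16 * (a j * M) <= n%:R, 0 <= b m &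
      M ^+ 2 * (1 - (8 * n%:R ^+ 2 + 2)^-1) ^+ m.-1./2 <= b m ^+ 2].
Hypothesis hBs : forall L, \sum_(m < L) m.+1%:R * b m.+1 <= Bs.

Definition window_weight (e : R) (L : nat) (E : R) (t : T) : R :=
  window e (spec_fun a (X ^~ t) L E) * weight_sum a (X ^~ t) L E.

Lemma measurable_window_weight e L :
  measurable_fun [set: R * T] (fun p => window_weight e L p.1 p.2).
Proof.
have mV n : measurable_fun [set: R * T] (fun p => X n p.2) by exact: measurableT_comp.
apply: measurable_funM.
  apply: (measurableT_comp (measurable_window e)).
  apply: measurable_funB; last exact: mV.
  apply: measurable_funB; first apply: measurable_funB => //.
    apply: measurable_funM => //; apply: measurable_funV.
    by apply: (@measurable_ric _ _ (R * T)%type (Ar a) (fun k p => X k%:Z p.2) fst).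
  apply: measurable_funM => //; apply: measurable_funV.
  by apply: (@measurable_ric _ _ (R * T)%type (Al a) (fun k p => X (- k%:Z) p.2) fst).
apply: measurable_funD.
  by apply: (@measurable_rsum _ _ (R * T)%type (Ar a) (fun k p => X k%:Z p.2) L fst).
by apply: (@measurable_rsum _ _ (R * T)%type (Al a) (fun k p => X (- k%:Z) p.2) L fst).
Qed.

Lemma window_weight_ge0 e L E t : 0 < e -> 0 <= window_weight e L E t.
Proof. by move=> e0; rewrite mulr_ge0 ?window_ge0// weight_sum_ge0. Qed.

(** The window sees both half-lines, while the weight splits into one sum for each. For the right
    sum the left half-line enters only through [s], a function of [X (- k)] with [k >= 1]; the left
    sum is the same statement for the reflected potential [X']. *)
Lemma window_weight_estimate e L E : 0 < e ->
  (\int[P]_t (window_weight e L E t)%:E <= (2 * Bs)%:E)%E.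
Proof.
move=> e0.
pose W t := window e (spec_fun a (X ^~ t) L E).
pose X' n := X (- n).
have mX' n : measurable_fun [set: T] (X' n) by exact: mX.
have iX' : mutually_independent P X' by apply: (independent_reindex (h := -%R) _ iX) => n; exact: opprK.
pose ra t := rsum (Ar a) (Vr (X ^~ t)) L E.
pose la t := rsum (Al a) (Vl (X ^~ t)) L E.
have mW : measurable_fun [set: T] W.
  apply: (measurableT_comp (measurable_window e)).
  apply: measurable_funB => //; apply: measurable_funB.
    by apply: measurable_funB => //; apply: measurable_funM => //; apply: measurable_funV; exact: measurable_ric.
  by apply: measurable_funM => //; apply: measurable_funV; exact: measurable_ric.
have W0 t : 0 <= W t by exact: window_ge0.
have Al0 j : 0 < Al a j by exact: a0.
have Ar0 j : 0 < Ar a j by exact: a0.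
have mra : measurable_fun [set: T] ra by exact: (@measurable_rsum _ _ T _ (fun k t => X k%:Z t) L (cst E)).
have mla : measurable_fun [set: T] la by exact: (@measurable_rsum _ _ T _ (fun k t => X (- k%:Z) t) L (cst E)).
have ra0 t : 0 <= ra t by rewrite /ra rsum_ge0.
have la0 t : 0 <= la t by rewrite /la rsum_ge0.
have -> : (\int[P]_t (window_weight e L E t)%:E = \int[P]_t (W t * ra t)%:E + \int[P]_t (W t * la t)%:E)%E.
  under eq_integral do rewrite /window_weight /weight_sum mulrDr EFinD.
  rewrite ge0_integralD//.
  - by move=> t _; rewrite lee_fin; exact: (mulr_ge0 (W0 t) (ra0 t)).
  - by apply/measurable_EFinP; exact: (measurable_funM mW mra).
  - by move=> t _; rewrite lee_fin; exact: (mulr_ge0 (W0 t) (la0 t)).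
  - by apply/measurable_EFinP; exact: (measurable_funM mW mla).
rewrite mulrDl mul1r EFinD; apply: leeD.
  apply: (@le_trans _ _ (\sum_(m < L) m.+1%:R * b m.+1)%:E); last by rewrite lee_fin.
  pose s t := Al a 0 ^+ 2 / ric (Al a) (Vl (X ^~ t)) E 1 (L.+1 - 1).
  apply: (half_estimate mX iX Ar0 _ L E (s := s) e0).
    move=> m; have [M [n n0 [M0 dom nM b0 hM]]] := hb m.
    exists M, n => //; split => // [j B jm mB|j]; last exact: nM.
    exact: dom.
  move=> j; apply: measurable_funM => //; apply: measurable_funV.
  apply: (@measurable_ric _ _ (others X j) (Al a) (fun k t => X (- k%:Z) t) (cst E)) => // k k1.
  by apply: measurable_others; apply/eqP; lia.
apply: (@le_trans _ _ (\sum_(m < L) m.+1%:R * b m.+1)%:E); last by rewrite lee_fin.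
pose s t := Ar a 0 ^+ 2 / ric (Ar a) (Vr (X ^~ t)) E 1 (L.+1 - 1).
have h := @half_estimate _ _ _ P X' mX' iX' (Al a) b Al0 _ L E e s e0.
apply: le_trans (h _ _).
- apply: ge0_le_integral => //.
  + by move=> t _; rewrite lee_fin; exact: (mulr_ge0 (W0 t) (la0 t)).
  + by apply/measurable_EFinP; exact: (measurable_funM mW mla).
  + apply/measurable_EFinP; apply: measurable_funM; last exact: mla.
    apply: (measurableT_comp (measurable_window e)); apply: measurable_funB; last exact: mX'.
    apply: measurable_funB; [apply: measurable_funB => //|]; apply: measurable_funM => //;
      apply: measurable_funV; exact: measurable_ric.
  + move=> t _; rewrite lee_fin le_eqVlt; apply/orP; left; apply/eqP.
    congr (window e _ * _); rewrite /spec_fun /s; congr (_ - _); exact: addrAC.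
- move=> m; have [M [n n0 [M0 dom nM b0 hM]]] := hb m.
  exists M, n => //; split => // [j B jm mB|j]; last exact: nM.
  by apply: dom => //; rewrite abszN.
- move=> j; apply: measurable_funM => //; apply: measurable_funV.
  apply: (@measurable_ric _ _ (others X' j) (Ar a) (fun k t => X k%:Z t) (cst E)) => // k k1.
  have -> : X k%:Z = X' (- k%:Z) by rewrite /X' opprK.
  by apply: measurable_others; apply/eqP; lia.
Qed.

End two_sided.

Lemma ae_forall_int (R : realType) d (T : measurableType d) (mu : {measure set T -> \bar R})
    (Q : int -> T -> Prop) :
  (forall n, {ae mu, forall t, Q n t}) -> {ae mu, forall t, forall n, Q n t}.
Proof.
move=> H; have h1 := ae_foralln (fun k => H (Posz k)).
have h2 := ae_foralln (fun k => H (Negz k)).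
by apply: filterS2 h1 h2 => t h1 h2 [] k.
Qed.

Section almost_sure.
Context {R : realType} {d : measure_display} {T : measurableType d}.
Variables (P : probability T R) (X : int -> T -> R).
Hypothesis mX : forall n, measurable_fun [set: T] (X n).
Hypothesis iX : mutually_independent P X.
Notation mu := (@lebesgue_measure R).
Variables (a : int -> R) (b : nat -> R) (Bs Am Om : R).
Hypothesis a0 : forall j, 0 < a j.
Hypothesis aA : forall j, a j <= Am.
Hypothesis XO : forall n, {ae P, forall t, `|X n t| <= Om}.
Hypothesis hb : forall m, exists M, exists2 n : nat, (0 < n)%N &
  [/\ 0 <= M,
      forall (j : int) B, (`|j| <= m)%N -> measurable B ->
        (P (X j @^-1` B) <= M%:E * mu B)%E,
      forall j, 16 * (a j * M) <= n%:R, 0 <= b m &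
      M ^+ 2 * (1 - (8 * n%:R ^+ 2 + 2)^-1) ^+ m.-1./2 <= b m ^+ 2].
Hypothesis hBs : forall L, \sum_(m < L) m.+1%:R * b m.+1 <= Bs.

(** The bound of [gershgorin] on the eigenvalues of every box, plus 1 to make it strict. *)
Let R1 := 2 * Am + Om + 1.
Let S (i L : nat) (t : T) : \bar R :=
  (\int[mu]_(E in `[(- R1)%R, R1]) (window_weight X a (i.+1%:R^-1) L E t)%:E)%E.

Let e0 (i : nat) : 0 < i.+1%:R^-1 :> R. Proof. by rewrite invr_gt0. Qed.

Let S_bound i L : [/\ measurable_fun [set: T] (S i L), forall t, (0 <= S i L t)%E &
  (\int[P]_t S i L t <= mu `[(- R1)%R, R1] * (2 * Bs)%:E)%E].
Proof.
have k0 E t : 0 <= window_weight X a (i.+1%:R^-1) L E t by apply: window_weight_ge0.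
set D : set R := `[(- R1)%R, R1]%classic.
have mD : measurable D by exact: measurable_itv.
pose g (p : R * T) : \bar R := (window_weight X a (i.+1%:R^-1) L p.1 p.2 * \1_D p.1)%:E.
have g0 p : (0 <= g p)%E by rewrite lee_fin mulr_ge0.
have mg : measurable_fun [set: R * T] g.
  apply/measurable_EFinP; apply: measurable_funM; first exact: measurable_window_weight.
  by apply: (measurableT_comp (measurable_indic mD)).
have SE t : S i L t = (\int[mu]_E g (E, t))%E.
  rewrite /S integral_mkcond; apply: eq_integral => E _.
  rewrite /g /patch /= indicE; case: ifPn => _ /=; by rewrite ?mulr1 ?mulr0.
have -> : S i L = (fun t => \int[mu]_E g (E, t))%E by apply/funext.
split.
- exact: (measurable_fun_fubini_tonelli_G (m1 := mu) g).
- by move=> t; apply: integral_ge0.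
rewrite -fubini_tonelli//.
apply: (@le_trans _ _ (\int[mu]_E ((2 * Bs) * \1_D E)%:E)%E).
  apply: ge0_le_integral => //.
  - by move=> E _; apply: integral_ge0.
  - exact: (measurable_fun_fubini_tonelli_F (m2 := P) g).
  - by apply/measurable_EFinP; apply: measurable_funM => //; exact: measurable_indic.
  move=> E _; rewrite /g /=.
  under eq_integral do rewrite mulrC EFinM.
  have mk : measurable_fun [set: T] (fun t => window_weight X a (i.+1%:R^-1) L E t).
    exact: (measurableT_comp (f := fun p => window_weight X a (i.+1%:R^-1) L p.1 p.2)
      (measurable_window_weight mX a _ L) (pair1_measurable E)).
  rewrite ge0_integralZl_EFin//; last 2 first.
  - by move=> t _; rewrite lee_fin.
  - exact/measurable_EFinP.
  rewrite [leRHS]EFinM [leRHS]muleC; apply: lee_wpmul2l; first by rewrite lee_fin.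
  exact: (window_weight_estimate mX iX a0 hb hBs).
under eq_integral do rewrite EFinM.
have B0 : 0 <= 2 * Bs by have := hBs 0; rewrite big_ord0 => ?; rewrite mulr_ge0.
rewrite ge0_integralZl_EFin//; last first.
  by apply/measurable_EFinP; exact: measurable_indic.
by rewrite integral_indic// setIT muleC.
Qed.

(** Fatou's lemma, first in the window width and then in the box size, gives the double liminf [G] a
    finite expectation. Where [G] is finite, arbitrarily large boxes have inner liminf below
    [G + 1], and four times that inner liminf dominates the eigenvector sum of the box by
    [integral_lower_bound]. *)
Lemma ae_delta0_approx : {ae P, forall t, forall eps : R, 0 < eps ->
  exists s : seq (R * (int -> R)),
    (forall p, p \in s -> is_eigenvector a (X ^~ t) p.2) /\
    (l2norm2 (fun n => ((n == 0)%:R - \sum_(p <- s) p.1 * p.2 n)%R) <= eps%:E)%E}.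
Proof.
set C : \bar R := (mu `[(- R1)%R, R1] * (2 * Bs)%:E)%E.
have Cfin : (C < +oo)%E.
  rewrite /C lebesgue_measure_itv/=; case: ifP => _; last by rewrite mul0e ltry.
  by rewrite -EFinB -EFinM ltry.
have F1 L := fatou_bound (mu := P) (fun i => let: And3 h _ _ := S_bound i L in h)
  (fun i => let: And3 _ h _ := S_bound i L in h) (fun i => let: And3 _ _ h := S_bound i L in h).
have F2 := fatou_bound (mu := P) (fun L => let: And3 h _ _ := F1 L in h)
  (fun L => let: And3 _ h _ := F1 L in h) (fun L => let: And3 _ _ h := F1 L in h).
have [m2 f20 b2] := F2.
have aeG := ae_lty m2 f20 (le_lt_trans b2 Cfin).
have aeX : {ae P, forall t, forall n, `|X n t| <= Om}.
  exact: ae_forall_int.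
apply: filterS2 aeG aeX => t Gt XOt.
have G0 := f20 t.
set G := limn_einf (fun L => limn_einf (fun i => S i L t)) in Gt G0.
have Gfin : G \is a fin_num by rewrite ge0_fin_numE.
apply: (@delta0_approx _ a (X ^~ t) Am Om (4 * (fine G + 1))) => // j.
have GB : (G < (fine G + 1)%:E)%E by rewrite -{1}(fineK Gfin) lte_fin ltrDl.
have [L jL LB] := limn_einf_lt (maxn j 1) GB.
have L0 : (0 < L)%N by rewrite (leq_trans _ jL)// leq_maxr.
exists L; first by rewrite (leq_trans _ jL)// leq_maxl.
have [lam [phi be]] := box_spectral (X ^~ t) a0 L.
exists lam, phi; split => //.
have lamR k : `|lam k| < R1.
  by apply: le_lt_trans (gershgorin a0 aA XOt be k) _; rewrite /R1 ltrDl.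
have [/= dl dl0 Hdl] := integral_lower_bound a0 L0 be lamR.
have : ((4^-1 * \sum_k `|phi k 0| * wmass L phi k)%:E <= limn_einf (fun i => S i L t))%E.
  apply: limn_einf_ge; near=> i.
  apply: Hdl; last exact: e0.
  rewrite /= sub0r normrN gtr0_norm//; near: i.
  exact: (near_infty_natSinv_lt (PosNum dl0)).
move=> /le_lt_trans/(_ LB); rewrite lte_fin => h.
by rewrite ltW// mulrC -ltr_pdivrMr// mulrC.
Unshelve. all: by end_near.
Qed.

End almost_sure.

(** * Decay rates *)

Section rates.
Context {R : realType}.
Implicit Types (x z K Q : R).

Lemma expR_ge_pow (k : nat) (y : R) : (0 < k)%N -> 0 <= y -> (y / k%:R) ^+ k <= expR y.
Proof.
move=> k0 y0; have k0' : k%:R != 0 :> R by rewrite pnatr_eq0 -lt0n.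
rewrite -[y in leRHS](divfK k0') expRM_natr lerXn2r ?nnegrE ?expR_ge0//.
  by rewrite divr_ge0.
by apply: le_trans (expR_ge1Dx _); rewrite lerDr.
Qed.

(** It suffices that [k * (1 - 2 * z) >= 7]. Of the 7 powers, 6 serve the square of the target
    [K / x ^+ 3], and one absorbs the square of the density bound, which grows at most like [x]. *)
Lemma powR_rate z : 0 <= z -> z < 2^-1 -> exists2 k : nat, (0 < k)%N &
  forall x, 1 <= x -> [/\ 1 <= x `^ z, (x `^ z) ^+ 2 <= x & x ^+ 7 <= (x / (x `^ z) ^+ 2) ^+ k].
Proof.
move=> z0 z1; pose be := 1 - 2 * z.
have be0 : 0 < be by rewrite /be; lra.
exists (Num.Def.truncn (7 / be)).+1 => // x x1.
have x0 : 0 < x by exact: lt_le_trans x1.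
have wE : (x `^ z) ^+ 2 = x `^ (2 * z) by rewrite -powR_mulrn ?powR_ge0// -powRrM mulrC.
have xE : x / (x `^ z) ^+ 2 = x `^ be.
  by rewrite wE -{1}(powRr1 (ltW x0)) -powRN -powRD// gt_eqF ?implybT.
split.
- by rewrite -(powRr0 x) ler_powR.
- by rewrite wE -{2}(powRr1 (ltW x0)) ler_powR//; lra.
rewrite xE -[leRHS]powR_mulrn ?powR_ge0// -powRrM -powR_mulrn ?(ltW x0)// ler_powR//.
rewrite mulrC -ler_pdivrMr//; apply: ltW; exact: truncnS_gt.
Qed.

(** The stretched exponential is weakened to an inverse cube, which is summable against the weight
    [m]. *)
Lemma decay_rate Am Q z : 0 < Am -> 0 < Q -> 0 <= z -> z < 2^-1 ->
  exists2 K, 0 <= K & forall m : nat, exists2 n : nat, (0 < n)%N &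
    16 * (Am * (Q * m.+1%:R `^ z)) <= n%:R /\
    (Q * m.+1%:R `^ z) ^+ 2 * (1 - (8 * n%:R ^+ 2 + 2)^-1) ^+ m.-1./2
      <= (K / m.+1%:R ^+ 3) ^+ 2.
Proof.
move=> Am0 Q0 z0 z1; have [k k0 Hk] := powR_rate z0 z1.
pose K0 := 16 * Am * Q + 1.
have K00 : 0 < K0 by rewrite addr_gt0// !mulr_gt0.
(* The integer [n] chosen below satisfies [8 n ^+ 2 + 2 <= 10 n ^+ 2 <= 10 (K0 w) ^+ 2], so the
   contraction loss [th] is at least [c / w ^+ 2]. *)
pose c := (10 * K0 ^+ 2)^-1.
have c0 : 0 < c by rewrite invr_gt0 mulr_gt0// exprn_gt0.
pose u := Q ^+ 2 * expR 1 * (2 * k%:R / c) ^+ k.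
have u0 : 0 <= u.
  apply: mulr_ge0; first by apply: mulr_ge0; [exact: sqr_ge0|exact: expR_ge0].
  by apply: exprn_ge0; apply: divr_ge0; [exact: mulr_ge0|exact: ltW].
exists (1 + u) => [|m]; first by rewrite addr_ge0.
set x : R := m.+1%:R; have x1 : 1 <= x by rewrite /x ler1n.
have [w1 wx xk] := Hk x x1; set w := x `^ z in w1 wx xk *.
have x0 : 0 < x by exact: lt_le_trans x1.
have w0 : 0 < w by exact: lt_le_trans w1.
pose y := 16 * (Am * (Q * w)).
have y0 : 0 <= y by rewrite !mulr_ge0// ltW.
have [n n0 [yn nK]] : exists2 n : nat, (0 < n)%N & y <= n%:R /\ n%:R <= K0 * w.
  exists (Num.Def.truncn y).+1 => //; split; first by apply: ltW; exact: truncnS_gt.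
  rewrite -natr1; have h : (Num.Def.truncn y)%:R <= y by rewrite truncn_le.
  by apply: (@le_trans _ _ (y + w)); [rewrite lerD|rewrite /K0 /y; lra].
exists n => //; split => //.
have n1 : 1 <= n%:R :> R by rewrite ler1n.
pose th := (8 * n%:R ^+ 2 + 2)^-1 : R.
have th0 : 0 < th by rewrite invr_gt0 addr_gt0// mulr_gt0// exprn_gt0// ltr0n.
have th1 : th <= 2^-1.
  by rewrite lef_pV2 ?posrE ?addr_gt0 ?mulr_gt0 ?exprn_gt0 ?ltr0n// lerDr mulr_ge0// sqr_ge0.
have thc : c / w ^+ 2 <= th.
  rewrite /c -invfM lef_pV2 ?posrE; last 2 first.
  - by rewrite !mulr_gt0// exprn_gt0.
  - by rewrite addr_gt0// mulr_gt0// exprn_gt0// ltr0n.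
  have : n%:R ^+ 2 <= (K0 * w) ^+ 2 by rewrite lerXn2r ?nnegrE// ?ler0n// mulr_ge0// ltW.
  have : 1 <= n%:R ^+ 2 :> R by rewrite exprn_ege1.
  by clear -K00; clearbody K0; rewrite exprMn; lra.
rewrite -/th; clearbody th.
have h2 : x <= (m.-1./2)%:R * 2 + 3.
  rewrite /x -natrM -natrD ler_nat muln2; case: (m) => [//|j] /=.
  by rewrite -[j in leqLHS]odd_double_half addn3 !ltnS -[leqRHS]add1n leq_add2r leq_b1.
clear y y0 yn; clearbody c w; clearbody x.
move: (m.-1./2) h2 => h h2.
(* The factor [expR 1] pays for the rounding in [h]: [x <= 2 h + 3] loses [3/2 th] in the exponent,
   which is less than 1. *)
have step1 : (1 - th) ^+ h <= expR 1 * expR (- (c / 2 * (x / w ^+ 2))).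
  have h1 : (1 - th) ^+ h <= expR (- th * h%:R).
    rewrite expRM_natr lerXn2r ?nnegrE ?expR_ge0//; first by lra.
    exact: expR_ge1Dx.
  apply: le_trans h1 _; rewrite -expRD ler_expR.
  have h3 : c / 2 * (x / w ^+ 2) <= th * x / 2.
    have -> : c / 2 * (x / w ^+ 2) = (c / w ^+ 2) * (x / 2) by field; rewrite gt_eqF.
    by rewrite -[leRHS]mulrA ler_wpM2r// divr_ge0// ltW.
  have h4 : th * x <= th * (h%:R * 2 + 3) by rewrite ler_pM2l.
  by move: h4; rewrite mulrDr mulrA; lra.
have step2 : expR (- (c / 2 * (x / w ^+ 2))) <= (2 * k%:R / c) ^+ k / x ^+ 7.
  have v0 : 0 < x / w ^+ 2 by rewrite divr_gt0// exprn_gt0.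
  have cv0 : 0 < c / 2 * (x / w ^+ 2) by rewrite mulr_gt0// divr_gt0.
  have kk : 0 < k%:R :> R by rewrite ltr0n.
  rewrite expRN.
  apply: (@le_trans _ _ ((c / 2 * (x / w ^+ 2) / k%:R) ^+ k)^-1).
    rewrite lef_pV2 ?posrE ?expR_gt0 ?exprn_gt0 ?divr_gt0//.
    by apply: expR_ge_pow => //; exact: ltW.
  have -> : c / 2 * (x / w ^+ 2) / k%:R = (x / w ^+ 2) / (2 * k%:R / c).
    by field; rewrite !gt_eqF.
  rewrite expr_div_n invf_div ler_pM2l; last by rewrite exprn_gt0// divr_gt0// mulr_gt0.
  by rewrite lef_pV2 ?posrE ?exprn_gt0.
apply: (@le_trans _ _ (u * (w ^+ 2 / x ^+ 7))).
  have -> : u * (w ^+ 2 / x ^+ 7) = (Q * w) ^+ 2 * (expR 1 * ((2 * k%:R / c) ^+ k / x ^+ 7)).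
    by rewrite /u exprMn; ring.
  rewrite ler_wpM2l ?sqr_ge0//; apply: le_trans step1 _.
  by rewrite ler_wpM2l ?expR_ge0.
rewrite expr_div_n -exprM.
apply: (@le_trans _ _ (u / x ^+ 6)).
  rewrite ler_wpM2l// ler_pdivrMr ?exprn_gt0//.
  by rewrite [x ^+ 7]exprS mulrC mulfK// expf_eq0/= gt_eqF.
rewrite ler_wpM2r ?invr_ge0 ?exprn_ge0 ?(ltW x0)//.
by have := mulr_ge0 u0 u0; rewrite expr2; lra.
Qed.

(** Each term is at most [K / ((m + 1) (m + 2))], and this telescopes. *)
Lemma sum_rate K L : 0 <= K ->
  \sum_(m < L) m.+1%:R * (K / m.+2%:R ^+ 3) <= K.
Proof.
move=> K0; suff : \sum_(m < L) m.+1%:R * (K / m.+2%:R ^+ 3) <= K * (1 - L.+1%:R^-1).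
  by move/le_trans; apply; rewrite ler_piMr// gerBl invr_ge0.
elim: L => [|L IH]; first by rewrite big_ord0 invr1 subrr mulr0.
rewrite big_ord_recr/=; apply: le_trans (lerD IH (lexx _)) _.
rewrite mulrCA -mulrDr ler_wpM2l//.
have l0 : 0 < L.+1%:R :> R by rewrite ltr0n.
have -> : L.+2%:R = L.+1%:R + 1 :> R by rewrite natr1.
set l : R := L.+1%:R in l0 *.
have l1 : 0 < l + 1 by rewrite addr_gt0.
clearbody l.
have -> : 1 - (l + 1)^-1 = 1 - l^-1 + (l * (l + 1))^-1.
  by field; rewrite (gt_eqF l0) (gt_eqF l1).
rewrite lerD2l ler_pdivrMr ?exprn_gt0 ?addr_gt0//.
have -> : (l * (l + 1))^-1 * (l + 1) ^+ 3 = l + 2 + l^-1.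
  by field; rewrite (gt_eqF l0) (gt_eqF l1).
by rewrite -addrA lerDl addr_ge0// invr_ge0 ltW.
Qed.

End rates.

(** * Pure point spectrum *)

Section density.
Context {R : realType}.
Implicit Types (f g : int -> R).

Lemma box_le_esum f M : (forall n, 0 <= f n) ->
  ((box_sum M f)%:E <= \esum_(n in [set: int]) (f n)%:E)%E.
Proof.
move=> f0; pose r := [seq j%:Z - M%:Z | j <- iota 0 M.*2.+1].
have ur : uniq r by rewrite map_inj_uniq ?iota_uniq// => i j /addIr[].
rewrite -box_sumE -sumEFin; apply: ereal_sup_ubound; exists [set` r].
  by split => //; exact: finite_seq.
rewrite -fsbig_seq// /r big_map -[iota 0 _]/(index_iota 0 M.*2.+1).
by rewrite big_mkord.
Qed.

Lemma l2norm2_leP f c : (l2norm2 f <= c%:E)%E <-> forall M, box_sum M (fun n => f n ^+ 2) <= c.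
Proof.
split=> [h M|h]; last by apply: esum_box_le => // n; exact: sqr_ge0.
by rewrite -lee_fin; apply: le_trans h; apply: box_le_esum => n; exact: sqr_ge0.
Qed.

Lemma l2norm2_shift f n0 : l2norm2 (fun n => f (n - n0)) = l2norm2 f.
Proof.
rewrite /l2norm2 [RHS](reindex_esum [set: int] _ (fun n => n - n0))//.
split=> //; first by move=> x y _ _ /addIr.
by move=> n _; exists (n + n0) => //=; rewrite addrK.
Qed.

Lemma l2_tail f eps : in_l2 f -> 0 < eps -> exists L : nat, forall M,
  box_sum M (fun n => (f n *+ (L < `|n|)%N) ^+ 2) <= eps.
Proof.
move=> f2 eps0; have f0 n : 0 <= f n ^+ 2 by exact: sqr_ge0.
have E0 : (0 <= l2norm2 f)%E by apply: esum_ge0 => n _; rewrite lee_fin.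
have Efin : l2norm2 f \is a fin_num by rewrite ge0_fin_numE.
set v := fine (l2norm2 f).
have fv M : box_sum M (fun n => f n ^+ 2) <= v.
  by rewrite -lee_fin /v fineK//; exact: box_le_esum.
have [L Lv] : exists L, v - eps < box_sum L (fun n => f n ^+ 2).
  apply: contrapT => /forallNP h.
  have : (l2norm2 f <= (v - eps)%:E)%E.
    by apply/l2norm2_leP => M; rewrite leNgt; apply/negP; exact: h.
  by rewrite -(fineK Efin) lee_fin -/v; lra.
exists L => M; apply: le_trans (_ : _ <= box_sum (maxn M L) (fun n => (f n *+ (L < `|n|)%N) ^+ 2)) _.
  by apply: box_sum_mono => [n|]; [exact: sqr_ge0|exact: leq_maxl].
have := fv (maxn M L).
have -> : box_sum (maxn M L) (fun n => f n ^+ 2) =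
    box_sum (maxn M L) (fun n => (f n *+ (L < `|n|)%N) ^+ 2) +
    box_sum (maxn M L) (fun n => (f n *+ (`|n| <= L)%N) ^+ 2).
  rewrite -box_sumD; apply: eq_box_sum => n _.
  by case: leqP; rewrite ?mulr0n ?mulr1n expr0n/= ?addr0 ?add0r.
have : box_sum L (fun n => f n ^+ 2) <= box_sum (maxn M L) (fun n => (f n *+ (`|n| <= L)%N) ^+ 2).
  apply: le_trans (box_sum_mono _ (leq_maxr M L)); last by move=> n; exact: sqr_ge0.
  by apply: box_sum_le => n ->; rewrite mulr1n.
lra.
Qed.

Variables (a om : int -> R).

(** The condition of [pure_point] for a single vector, phrased with box sums and a weak inequality
    so that only finite sums have to be handled. *)
Definition approximable f := forall eps, 0 < eps -> exists s : seq (R * (int -> R)),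
  (forall p, p \in s -> is_eigenvector a om p.2) /\
  forall M, box_sum M (fun n => (f n - \sum_(p <- s) p.1 * p.2 n) ^+ 2) <= eps.

Lemma box_sum_sqrD f g M c1 c2 : box_sum M (fun n => f n ^+ 2) <= c1 ->
  box_sum M (fun n => g n ^+ 2) <= c2 ->
  box_sum M (fun n => (f n + g n) ^+ 2) <= 2 * c1 + 2 * c2.
Proof.
move=> h1 h2; apply: (@le_trans _ _ (2 * box_sum M (fun n => f n ^+ 2) + 2 * box_sum M (fun n => g n ^+ 2))).
  rewrite -!box_sumZ -box_sumD; apply: box_sum_le => n _.
  have := sqr_ge0 (f n - g n); rewrite sqrrB sqrrD; lra.
lra.
Qed.

Lemma approximable0 : approximable (fun=> 0).
Proof.
move=> eps eps0; exists [::]; split => // M.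
rewrite -box_sumE big1 ?ltW// => i _; by rewrite big_nil subrr expr0n.
Qed.

Lemma approximableD f g : approximable f -> approximable g -> approximable (fun n => f n + g n).
Proof.
move=> hf hg eps eps0; have e4 : 0 < eps / 4 by rewrite divr_gt0.
have [s1 [e1 h1]] := hf _ e4; have [s2 [e2 h2]] := hg _ e4.
exists (s1 ++ s2); split.
  by move=> p; rewrite mem_cat => /orP[/e1|/e2].
move=> M; have := box_sum_sqrD (h1 M) (h2 M).
have -> : 2 * (eps / 4) + 2 * (eps / 4) = eps by field.
rewrite (@eq_box_sum _ _ (fun n => (f n + g n - \sum_(p <- s1 ++ s2) p.1 * p.2 n) ^+ 2))//.
by move=> n _; rewrite big_cat/=; congr (_ ^+ 2); ring.
Qed.

Lemma approximableZ c f : approximable f -> approximable (fun n => c * f n).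
Proof.
move=> hf eps eps0; have e4 : 0 < eps / (c ^+ 2 + 1).
  by rewrite divr_gt0// ltr_wpDl// sqr_ge0.
have [s [e1 h1]] := hf _ e4; exists [seq (c * p.1, p.2) | p <- s]; split.
  move=> p ps; have [q qs ->] : exists2 q, q \in s & p = (c * q.1, q.2) by apply/mapP.
  exact: (e1 q).
move=> M; apply: le_trans (_ : _ <= c ^+ 2 * (eps / (c ^+ 2 + 1))) _.
  apply: le_trans (ler_wpM2l (sqr_ge0 c) (h1 M)); rewrite -box_sumZ.
  apply: box_sum_le => n _; rewrite big_map -exprMn mulrBr mulr_sumr.
  by under [in leRHS]eq_bigr do rewrite mulrA.
rewrite mulrA ler_pdivrMr ?ltr_wpDl ?sqr_ge0//.
by rewrite mulrC ler_wpM2l ?(ltW eps0)// lerDl.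
Qed.

Lemma approximable_sum (I : Type) (r : seq I) (F : I -> int -> R) :
  (forall i, approximable (F i)) -> approximable (fun n => \sum_(i <- r) F i n).
Proof.
move=> hF; elim: r => [|i r IH].
  rewrite (_ : (fun n => _) = fun=> 0); first exact: approximable0.
  by apply/funext => n; rewrite big_nil.
rewrite (_ : (fun n => _) = fun n => F i n + \sum_(i <- r) F i n); first exact: approximableD.
by apply/funext => n; rewrite big_cons.
Qed.

Lemma pure_point_of_delta :
  (forall n0, approximable (fun n => (n == n0)%:R)) -> pure_point a om.
Proof.
move=> hd psi psi2 eps eps0.
(* The tail and the approximation of the truncated vector each cost [eps / 8]. [box_sum_sqrD]
   doubles them to [eps / 2] in total, which leaves room for the strict inequality. *)
have e8 : 0 < eps / 8 by rewrite divr_gt0.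
have [L tL] := l2_tail psi2 e8.
have happ : approximable (fun n => psi n *+ (`|n| <= L)%N).
  have -> : (fun n => psi n *+ (`|n| <= L)%N) =
      (fun n => \sum_(j < L.*2.+1) psi (j%:Z - L%:Z) * (n == j%:Z - L%:Z)%:R).
    apply/funext => n; case: leqP => nL; last first.
      rewrite big1// => j _; rewrite (_ : n == _ = false) ?mulr0//.
      by apply/eqP => nj; have := ltn_ord j; lia.
    have jL : (`|(n + L%:Z)%R| < L.*2.+1)%N by lia.
    have nj : n = `|(n + L%:Z)%R|%N%:Z - L%:Z by lia.
    rewrite (bigD1 (Ordinal jL))//= -nj eqxx mulr1 big1 ?addr0// => j jn.
    rewrite (_ : n == _ = false) ?mulr0//; apply/eqP => nj'.
    by move/eqP: jn; apply; apply/val_inj => /=; lia.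
  by apply: approximable_sum => j; apply: approximableZ; exact: hd.
have [s [e1 h1]] := happ _ e8; exists s; split => //.
apply: (@le_lt_trans _ _ (eps / 2)%:E); last by rewrite lte_fin ltr_pdivrMr// ltr_pMr// ltr1n.
apply/l2norm2_leP => M; have := box_sum_sqrD (h1 M) (tL M).
have -> : 2 * (eps / 8) + 2 * (eps / 8) = eps / 2 by field.
rewrite (@eq_box_sum _ _ (fun n => (psi n - \sum_(p <- s) p.1 * p.2 n) ^+ 2))// => n _.
by congr (_ ^+ 2); case: leqP => _; rewrite ?mulr0n ?mulr1n; ring.
Qed.

End density.

Section translation.
Context {R : realType}.
Variables (a om : int -> R) (n0 : int).

Lemma is_eigenvector_shift phi :
  is_eigenvector (fun n => a (n + n0)) (fun n => om (n + n0)) phi ->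
  is_eigenvector a om (fun n => phi (n - n0)).
Proof.
move=> [l2 [nz [E eqE]]]; split; first by rewrite /in_l2 -/(l2norm2 _) l2norm2_shift.
split; last first.
  exists E => n; rewrite -eqE /Jop subrK.
  have -> : n + 1 - n0 = n - n0 + 1 by exact: addrAC.
  have -> : n - 1 - n0 = n - n0 - 1 by exact: addrAC.
  by have -> : n - n0 - 1 + n0 = n - 1 by rewrite addrAC subrK.
move=> h; apply: nz; apply/funext => n.
by have /= := congr1 (fun f => f (n + n0)) h; rewrite addrK.
Qed.

Lemma approximable_shift :
  approximable (fun n => a (n + n0)) (fun n => om (n + n0)) (fun n => (n == 0)%:R) ->
  approximable a om (fun n => (n == n0)%:R).
Proof.
move=> h eps /h[s [e1 h1]]; exists [seq (p.1, fun n => p.2 (n - n0)) | p <- s]; split.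
  move=> q qs; have [p /e1 ps ->] : exists2 p, p \in s & q = (p.1, fun n => p.2 (n - n0)).
    by apply/mapP.
  exact: is_eigenvector_shift.
apply/l2norm2_leP; move/l2norm2_leP: h1; rewrite -(l2norm2_shift _ n0).
congr (_ <= _)%E; congr l2norm2; apply/funext => n.
by rewrite big_map subr_eq0.
Qed.

End translation.

Section localization.
Context {R : realType} {d : measure_display} {T : measurableType d}.
Variables (P : probability T R) (X : int -> T -> R).
Hypothesis mX : forall n, measurable_fun [set: T] (X n).
Hypothesis iX : mutually_independent P X.
Notation mu := (@lebesgue_measure R).
Variables (a : int -> R) (Am Om Q z : R).
Hypothesis a0 : forall j, 0 < a j.
Hypothesis aA : forall j, a j <= Am.
Hypothesis XO : forall n, {ae P, forall t, `|X n t| <= Om}.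
Hypotheses (Q0 : 0 < Q) (z0 : 0 <= z) (z1 : z < 2^-1).
Hypothesis dens : forall n B, measurable B ->
  (P (X n @^-1` B) <= (Q * (`|n|%N.+1%:R `^ z))%:E * mu B)%E.

Lemma ae_approximable n0 :
  {ae P, forall t, approximable a (X ^~ t) (fun n => (n == n0)%:R)}.
Proof.
pose X' n := X (n + n0); pose a' n := a (n + n0).
have iX' : mutually_independent P X'.
  by apply: (independent_reindex (h := fun n => n - n0) _ iX) => n; exact: addrK.
have Am0 : 0 < Am by exact: lt_le_trans (a0 0) (aA 0).
(* [|j + n0| + 1 <= (|n0| + 1) (|j| + 1)]: moving the site [n0] to the origin only changes the
   constant in the density bound. *)
pose Q' := Q * (`|n0|%N.+1%:R `^ z).
have Q'0 : 0 < Q' by rewrite mulr_gt0// powR_gt0.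
have [K K0 HK] := decay_rate Am0 Q'0 z0 z1.
have hb m : exists M, exists2 n : nat, (0 < n)%N &
  [/\ 0 <= M,
      forall (j : int) B, (`|j| <= m)%N -> measurable B ->
        (P (X' j @^-1` B) <= M%:E * mu B)%E,
      forall j, 16 * (a' j * M) <= n%:R, 0 <= K / m.+1%:R ^+ 3 &
      M ^+ 2 * (1 - (8 * n%:R ^+ 2 + 2)^-1) ^+ m.-1./2 <= (K / m.+1%:R ^+ 3) ^+ 2].
  have [n npos [h1 h2]] := HK m.
  exists (Q' * m.+1%:R `^ z), n => //; split => //.
  - by rewrite mulr_ge0 ?powR_ge0// ltW.
  - move=> j B jm mB; apply: le_trans (dens _ mB) _.
    apply: lee_wpmul2r => //; rewrite lee_fin /Q' -mulrA -powRM//.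
    rewrite ler_wpM2l ?(ltW Q0)// ge0_ler_powR ?nnegrE//.
    by rewrite -natrM ler_nat; nia.
  - move=> j; apply: le_trans h1; rewrite ler_wpM2l// ler_wpM2r ?aA//.
    by rewrite mulr_ge0 ?powR_ge0// ltW.
  - by rewrite divr_ge0// exprn_ge0.
have := @ae_delta0_approx _ _ _ P X' (fun n => mX (n + n0)) iX' a'
  (fun m => K / m.+1%:R ^+ 3) K Am Om (fun j => a0 _) (fun j => aA _) (fun n => XO _) hb
  (fun L => sum_rate L K0).
apply: filterS => t h; apply: approximable_shift => eps /h[s [e1 h1]].
by exists s; split => //; apply/l2norm2_leP.
Qed.

Lemma ae_pure_point : {ae P, forall t, pure_point a (X ^~ t)}.
Proof.
have := ae_forall_int (mu := P) ae_approximable.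
by apply: filterS => t; exact: pure_point_of_delta.
Qed.

End localization.

Theorem theorem2p2 (R : realType)
  (r : R -> R) (d : int -> R) (c a : int -> R) (delta C zeta : R)
  (* assumptions on the single-site density r *)
  (r_ge0 : forall x, 0 <= r x)
  (r_meas : measurable_fun [set: R] r)
  (r_bounded : exists M : R, forall x, r x <= M)
  (r_compact : exists K : R, forall x, K < `|x| -> r x = 0)
  (r_int1 : (\int[lebesgue_measure]_x (r x)%:E = 1)%E)
  (* assumptions on the scales d_n *)
  (d_pos : forall n, 0 < d n) (d_le1 : forall n, d n <= 1)
  (C_pos : 0 < C) (zeta_lt : zeta < 2^-1)
  (d_lower : forall n : int, n != 0 -> C * (`|n|%:~R : R) `^ (- zeta) <= d n)
  (* background potential and off-diagonal terms *)
  (c_bounded : exists M : R, forall n, `|c n| <= M)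
  (a_bounded : exists M : R, forall n, `|a n| <= M)
  (delta_pos : 0 < delta) (a_ge : forall n, delta <= a n)
  (* the random potential: omega(n) independent, omega(n) - c(n) has density r_n *)
  (dT : measure_display) (T : measurableType dT) (P : probability T R)
  (X : int -> T -> R)
  (X_meas : forall n, measurable_fun [set: T] (X n))
  (X_indep : mutually_independent P X)
  (X_law : forall n (B : set R), measurable B ->
     P (X n @^-1` B) =
     (\int[lebesgue_measure]_(x in B) (rescaled r (d n) (x - c n))%:E)%E) :
  {ae P, forall t, pure_point a (fun n => X n t)}.
Proof.
have [M rM] := r_bounded; have [K rK] := r_compact.
have [Mc cM] := c_bounded; have [Am aA] := a_bounded.
(* [zeta] may be negative; a nonnegative exponent makes the density bound monotone in the
   distance. *)
pose z := Num.max zeta 0.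
have z0 : 0 <= z by rewrite le_max lexx orbT.
have z1 : z < 2^-1 by rewrite gt_max zeta_lt/= invr_gt0.
have M0 : 0 <= M by exact: le_trans (r_ge0 0) (rM 0).
have r0 n x : 0 <= rescaled r (d n) (x - c n).
  by rewrite /rescaled mulr_ge0// invr_ge0 ltW.
(* [(d 0)^-1] covers the site 0, where [d_lower] says nothing; [M + 1] makes [Q] visibly
   positive. *)
pose Q := (M + 1) * (C^-1 + (d 0)^-1).
have Q0 : 0 < Q by apply: mulr_gt0; [exact: ltr_wpDl|rewrite addr_gt0// invr_gt0].
have dQ n : (d n)^-1 <= (C^-1 + (d 0)^-1) * (`|n|%N.+1%:R `^ z).
  have p1 : 1 <= `|n|%N.+1%:R `^ z.
    by rewrite -[leLHS](powRr0 `|n|%N.+1%:R) ler_powR// ler1n.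
  have CD : 0 <= C^-1 + (d 0)^-1 by rewrite addr_ge0// invr_ge0 ltW.
  have [n0|n0] := eqVneq n 0.
    apply: le_trans (ler_wpM2l CD p1); rewrite mulr1 n0 lerDr invr_ge0; exact: ltW.
  have := d_lower n n0; rewrite -abszE -pmulrn; set k := `|n|%N => dk.
  have k1 : 1 <= k%:R :> R by rewrite ler1n /k lt0n absz_eq0.
  have k0 : 0 < k%:R :> R by exact: lt_le_trans k1.
  have kz : k%:R `^ zeta <= k.+1%:R `^ z :> R.
    apply: (@le_trans _ _ (k%:R `^ z)); first by rewrite ler_powR// le_max lexx.
    by rewrite ge0_ler_powR ?nnegrE// ler_nat.
  apply: (@le_trans _ _ (C^-1 * k%:R `^ zeta)).
    have -> : C^-1 * k%:R `^ zeta = (C * k%:R `^ (- zeta))^-1 by rewrite powRN invfM invrK.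
    by rewrite lef_pV2 ?posrE// mulr_gt0// powR_gt0.
  by rewrite ler_pM ?powR_ge0 ?invr_ge0 ?(ltW C_pos)// lerDl invr_ge0 ltW.
apply: (@ae_pure_point _ _ _ P X X_meas X_indep a Am (K + Mc) Q z) => //.
- by move=> j; exact: lt_le_trans (a_ge j).
- by move=> j; apply: le_trans (aA j); exact: ler_norm.
(* Since [d n <= 1], the rescaled density vanishes outside [[-K, K]], so that [|X n| <= K + Mc]
   almost surely. *)
- move=> n; pose B : set R := [set x | K + Mc < `|x|].
  have mB : measurable B.
    rewrite (_ : B = (fun x : R => `|x|) @^-1` `]K + Mc, +oo[).
      rewrite -[X in measurable X]setTI.
      by apply: (@normr_measurable R setT) => //; exact: measurable_itv.
    by apply/seteqP; split => x; rewrite /B /= in_itv/= andbT.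
  exists (X n @^-1` B); split.
  + by rewrite -[X in measurable X]setTI; exact: X_meas.
  + rewrite X_law//; apply: integral0_eq => x Bx; rewrite /rescaled rK ?mulr0//.
    have xc : K < `|x - c n|.
      have := ler_normB (x - c n) (- c n); rewrite opprK subrK normrN => h1.
      by have := cM n; move: Bx; rewrite /B /=; lra.
    apply: lt_le_trans xc _; rewrite normrM ler_peMl// ger0_norm ?invr_ge0 ?(ltW (d_pos n))//.
    by rewrite invf_ge1.
  + by move=> t /= /negP; rewrite -ltNge.
move=> n B mB; rewrite X_law//.
apply: (@le_trans _ _ (\int[lebesgue_measure]_(x in B) (M * (d n)^-1)%:E)%E).
  apply: ge0_le_integral => //.
  - by move=> x _; rewrite lee_fin.
  - apply/measurable_EFinP; apply: measurable_funTS; apply: measurable_funM => //.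
    apply: (measurableT_comp r_meas); apply: measurable_funM => //; exact: measurable_funB.
  - by move=> x _; rewrite lee_fin /rescaled mulrC ler_wpM2r// invr_ge0 ltW.
rewrite integral_cst//; apply: lee_wpmul2r => //; rewrite lee_fin /Q -mulrA.
apply: ler_pM => //; first by rewrite invr_ge0 ltW.
by rewrite lerDl.
Qed.
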